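(* Given $\sigma_1>3$, there is a constant $C$ such that for every $\sigma\ge\sigma_1$ and every $1\le t_0<T$, \[ \Bigl|\int_{t_0}^T\log|\mathcal R(\sigma+it)|\,dt\Bigr|\le C\, 2^{-\sigma}. \]
   Context: Riemann's auxiliary function is the entire function \[ \mathcal R(s)=\int_{0\swarrow 1}\frac{x^{-s}e^{\pi i x^2}}{e^{\pi i x}-e^{-\pi i x}}\,dx , \] where $0\swarrow1$ denotes the straight line of slope $1$, traversed from upper right to lower left, crossing the real axis at a point between $0$ and $1$, and $x^{-s}=e^{-s\log x}$ with the principal branch of $\log x$. It satisfies $\zeta(s)=\mathcal R(s)+\chi(s)\overline{\mathcal R(1-\bar s)}$ with $\chi(s)=\pi^{s-1/2}\Gamma(\frac{1-s}{2})/\Gamma(\frac s2)$. *)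

(* Defs.v *)
From Stdlib Require Import Reals Lra.
From Coquelicot Require Import Coquelicot.
Open Scope R_scope.

Definition Cexp (z : C) : C :=
  (exp (Re z) * cos (Im z), exp (Re z) * sin (Im z)).

(** Principal argument: for [z <> 0] it lies in ]-PI, PI]. *)
Definition Carg (z : C) : R :=
  if Rle_dec 0 (Im z) then acos (Re z / Cmod z) else - acos (Re z / Cmod z).

(** Principal branch of the logarithm; the value at [0] is meaningless. *)
Definition Clog (z : C) : C := (ln (Cmod z), Carg z).

(** [x ^ w = exp (w * log x)], for the principal branch of [log]. *)
Definition Cpower (x w : C) : C := Cexp (w * Clog x)%C.

Definition Raux_integrand (s x : C) : C :=
  (Cpower x (- s) * Cexp (PI * Ci * (x * x))
     / (Cexp (PI * Ci * x) - Cexp (- (PI * Ci * x))))%C.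

(** The line of slope 1 crossing the real axis at [c]. *)
Definition slope1_line (c u : R) : C := (c + (1 + Ci) * u)%C.

(** Riemann's auxiliary function, the contour being the line of slope 1 through
    a point [c] of ]0, 1[, on which the integrand decays like a Gaussian.
    The parameter [u] runs from [+oo] to [-oo], so that the line is traversed
    from upper right to lower left; the factor [1 + Ci] is [dx/du].  For
    [0 < c < 1] the line avoids the integers, where the denominator vanishes,
    and the cut of the logarithm; the value does not depend on such a [c]. *)
Definition Raux (c : R) (s : C) : C :=
  RInt_gen (V := C_R_CompleteNormedModule)
    (fun u : R => (Raux_integrand s (slope1_line c u) * (1 + Ci))%C)
    (Rbar_locally p_infty) (Rbar_locally m_infty).

Lemma Re_div_Cmod_bounds (z : C) : z <> 0 -> -1 <= Re z / Cmod z <= 1.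
Proof.
intros Hz; apply Rabs_le_between.
assert (H0 : 0 < Cmod z) by (apply Cmod_gt_0; exact Hz).
unfold Rdiv; rewrite Rabs_mult, Rabs_inv, (Rabs_pos_eq (Cmod z)) by lra.
apply Rmult_le_reg_r with (Cmod z); [exact H0|].
rewrite Rmult_assoc, Rinv_l by lra.
generalize (re_le_Cmod z); lra.
Qed.

Lemma Carg_bounds (z : C) : z <> 0 -> - PI < Carg z <= PI.
Proof.
intros Hz; unfold Carg.
assert (H0 : 0 < Cmod z) by (apply Cmod_gt_0; exact Hz).
generalize (acos_bound (Re z / Cmod z)) PI_RGT_0; intros Hb HP.
destruct (Rle_dec 0 (Im z)) as [Hi|Hi]; [lra|].
split; [|lra].
apply Ropp_lt_contravar.
destruct (Req_dec (acos (Re z / Cmod z)) PI) as [E|]; [exfalso|lra].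
assert (Hc := cos_acos _ (Re_div_Cmod_bounds z Hz)).
rewrite E, cos_PI in Hc.
assert (Hr : Re z = - Cmod z).
{ replace (Re z) with (Re z / Cmod z * Cmod z) by (field; lra).
  rewrite <- Hc; ring. }
generalize (Cmod2_alt z); rewrite Hr; intros H2.
assert (0 < Im z ^ 2) by (apply pow2_gt_0; lra).
replace ((- Cmod z) ^ 2) with (Cmod z ^ 2) in H2 by ring.
lra.
Qed.

Lemma Cexp_Clog (z : C) : z <> 0 -> Cexp (Clog z) = z.
Proof.
intros Hz.
assert (H0 : 0 < Cmod z) by (apply Cmod_gt_0; exact Hz).
assert (Hb := Re_div_Cmod_bounds z Hz).
assert (Hs : Cmod z * sqrt (1 - (Re z / Cmod z)²) = Rabs (Im z)).
{ rewrite <- (sqrt_Rsqr (Cmod z)) at 1 by lra.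
  rewrite <- sqrt_mult_alt by apply Rle_0_sqr.
  rewrite <- sqrt_Rsqr_abs; f_equal.
  assert (H2 := Cmod2_alt z).
  unfold Rsqr.
  replace (Cmod z * Cmod z * (1 - Re z / Cmod z * (Re z / Cmod z)))
    with (Cmod z ^ 2 - Re z ^ 2) by (field; lra).
  rewrite H2; ring. }
unfold Cexp, Clog.
change (Re (ln (Cmod z), Carg z)) with (ln (Cmod z)).
change (Im (ln (Cmod z), Carg z)) with (Carg z).
rewrite exp_ln by exact H0; unfold Carg.
apply injective_projections; simpl; change (fst z) with (Re z);
  change (snd z) with (Im z); destruct (Rle_dec 0 (Im z)) as [Hi|Hi];
  rewrite ?cos_neg, ?sin_neg, ?cos_acos, ?sin_acos by exact Hb.
- field; lra.
- field; lra.
- rewrite Hs; apply Rabs_pos_eq; exact Hi.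
- rewrite <- Ropp_mult_distr_r, Hs, Rabs_left by lra; ring.
Qed.

(* Main.v *)
(* Moving the contour to the right across the poles 1, ..., N gives
   R(s) = sum_(n <= N) n^(-s) - I_N(s), where I_N is the integral over the line through N + 1/2.
   With N close to sqrt (t / (2 PI)), this yields, for sigma >= 3 and t >= 1,
     |R(s) - 1| <= K 2^(-sigma)   and   Re (exp (9 i / 20) R(s)) >= 1/50;
   the second bound follows from Gaussian envelopes of the integrand when t >= 22, and from evaluating
   the integrand on a grid, in integer interval arithmetic, when t <= 22 (where N = 1).
   So log R has a holomorphic branch P + i Q, with P and Q both O(2^(-sigma)) up to a constant in Q.
   By the Cauchy-Riemann equations J(sigma) = int_t0^T P(sigma, t) dt has the derivative
   Q(sigma, T) - Q(sigma, t0) = O(2^(-sigma)), with a constant independent of t0 and T, and J tends to 0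
   at infinity; integrating J' from sigma to infinity bounds J. *)

Require Import Defs.
From Stdlib Require Import Reals Lra Lia Psatz ZArith List.
From Coquelicot Require Import Coquelicot.
Open Scope R_scope.

(** * Complex exponential, logarithm and derivative *)

(** The bound on |R - 1| carries a huge constant and says nothing about the argument of R near sigma
    = 3; the rotated half-plane fills this gap. There [atan (Y / X)] is a single global branch, so
    both boundary values of Q stay bounded however large T - t0 is, with no argument to follow. The
    two estimates want different lines. A bound by 2^(-sigma) needs a line farther than 2 from the
    origin, hence N >= 3 even for small t, at the cost of the constant. The half-plane bound needs a
    sharp constant, hence N = 1 or 2 when t is small. In place of Cauchy's theorem, the integral
    over the line through c is differentiated in c: the derivatives of the integrand in c and along
    the line are proportional, so only end values remain. The residues come from an explicit
    primitive of the difference of two simple poles. Complex integrals are handled as real ones, by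
    testing against a multiplier [k] in Re (k R); [k = rot] gives the half-plane bound directly, and
    the Cauchy-Riemann equations become the replacement of [k] by [Ci * k]. *)

Lemma C_eq (a b : C) : Re a = Re b -> Im a = Im b -> a = b.
Proof. destruct a, b; simpl; intros -> ->; reflexivity. Qed.

Lemma Cexp_plus (a b : C) : Cexp (a + b) = (Cexp a * Cexp b)%C.
Proof.
apply C_eq; destruct a, b; simpl; rewrite exp_plus, ?cos_plus, ?sin_plus; ring.
Qed.

Lemma Cexp_0 : Cexp 0 = 1%C.
Proof. apply C_eq; simpl; rewrite exp_0, ?cos_0, ?sin_0; ring. Qed.

Lemma Cmod_Cexp (z : C) : Cmod (Cexp z) = exp (Re z).
Proof.
unfold Cmod, Cexp; simpl.
replace (exp (Re z) * cos (Im z) * (exp (Re z) * cos (Im z) * 1) +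
         exp (Re z) * sin (Im z) * (exp (Re z) * sin (Im z) * 1))
  with (Rsqr (exp (Re z)) * (Rsqr (sin (Im z)) + Rsqr (cos (Im z))))
  by (unfold Rsqr; ring).
rewrite sin2_cos2, Rmult_1_r, sqrt_Rsqr; [reflexivity|].
left; apply exp_pos.
Qed.

Lemma Cexp_neq_0 (z : C) : Cexp z <> 0.
Proof.
intros H; assert (E := Cmod_Cexp z); rewrite H, Cmod_0 in E.
generalize (exp_pos (Re z)); lra.
Qed.

Lemma Cexp_opp (z : C) : Cexp (- z) = (/ Cexp z)%C.
Proof.
assert (H : (Cexp (- z) * Cexp z = 1)%C).
{ rewrite <- Cexp_plus, Cplus_comm, Cplus_opp_r; apply Cexp_0. }
assert (Hz := Cexp_neq_0 z).
rewrite <- (Cmult_1_l (/ Cexp z)), <- H; field; exact Hz.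
Qed.

Lemma Re_mult_conj (w : C) : Re (Cconj w * w) = Cmod w * Cmod w.
Proof.
replace (Cmod w * Cmod w) with (Cmod w ^ 2) by ring.
rewrite Cmod2_alt; destruct w; simpl; ring.
Qed.

Lemma Re_le_Cmod (z : C) : Re z <= Cmod z.
Proof. eapply Rle_trans; [apply Rle_abs | apply re_le_Cmod]. Qed.

Lemma im_le_Cmod (z : C) : Rabs (Im z) <= Cmod z.
Proof. eapply Rle_trans; [|apply Rmax_Cmod]; apply Rmax_r. Qed.

Lemma Cmod_le_sum (z : C) : Cmod z <= Rabs (Re z) + Rabs (Im z).
Proof.
assert (Q := Cmod_triangle (RtoC (Re z)) (Ci * RtoC (Im z))).
rewrite Cmod_mult, !Cmod_R, Cmod_Ci in Q.
replace (RtoC (Re z) + Ci * RtoC (Im z))%C with z in Q by (apply C_eq; simpl; ring).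
lra.
Qed.

(* Mean value inequality for [tau -> exp (tau z)], tested against the conjugate of the increment. *)
Lemma Cexp_sub_1_le (z : C) : Cmod (Cexp z - 1) <= Cmod z * exp (Cmod z).
Proof.
set (w := (Cexp z - 1)%C).
destruct (Rle_lt_dec (Cmod w) 0) as [H|Hw].
{ apply Rle_trans with 0; [exact H|]. apply Rmult_le_pos; [apply Cmod_ge_0|].
  left; apply exp_pos. }
set (g := fun t : R => Re (Cconj w * Cexp (t * z))).
assert (Hd : forall t, is_derive g t (Re (Cconj w * (z * Cexp (t * z))))).
{ intros t; unfold g; destruct w as [a b]; destruct z as [x y]; simpl.
  rewrite <- ?(Rminus_def (t * x)); auto_derive; [trivial|]; unfold Rminus; ring. }
destruct (MVT_gen g 0 1 (fun t => Re (Cconj w * (z * Cexp (t * z))))) as [t [Ht E]].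
- intros t _; apply Hd.
- intros t _; apply continuity_pt_filterlim.
  apply (ex_derive_continuous (V := R_NormedModule)); eexists; apply Hd.
- rewrite Rmin_left, Rmax_right in Ht by lra.
  assert (E1 : g 1 - g 0 = Cmod w * Cmod w).
  { rewrite <- Re_mult_conj; unfold g.
    replace (RtoC 1 * z)%C with z by (apply C_eq; destruct z; simpl; ring).
    replace (RtoC 0 * z)%C with (RtoC 0) by (apply C_eq; destruct z; simpl; ring).
    rewrite Cexp_0; unfold w at 4; destruct (Cconj w), (Cexp z); simpl; ring. }
  rewrite E1 in E.
  assert (H : Cmod w * Cmod w <= Cmod w * (Cmod z * exp (Cmod z))).
  { rewrite E, Rminus_0_r, Rmult_1_r.
    eapply Rle_trans; [apply Re_le_Cmod|].
    rewrite !Cmod_mult, Cmod_conj, Cmod_Cexp.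
    apply Rmult_le_compat_l; [lra|]; apply Rmult_le_compat_l; [apply Cmod_ge_0|].
    assert (B : Re (t * z) <= Cmod z).
    { eapply Rle_trans; [apply Re_le_Cmod|].
      rewrite Cmod_mult, Cmod_R, Rabs_pos_eq by lra.
      generalize (Cmod_ge_0 z); nra. }
    destruct B as [B|B]; [left; apply exp_increasing; exact B | rewrite B; lra]. }
  apply Rmult_le_reg_l with (Cmod w); assumption.
Qed.

(** Same test against the conjugate; the derivative of exp (tau z) - tau z is z (exp (tau z) - 1),
    to which the first-order bound applies. *)
Lemma Cexp_sub_1_sub_id_le (z : C) :
  Cmod (Cexp z - 1 - z) <= Cmod z ^ 2 * exp (Cmod z).
Proof.
set (w := (Cexp z - 1 - z)%C).
destruct (Rle_lt_dec (Cmod w) 0) as [H|Hw].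
{ apply Rle_trans with 0; [exact H|]. apply Rmult_le_pos; [apply pow2_ge_0|].
  left; apply exp_pos. }
set (g := fun t : R => Re (Cconj w * (Cexp (t * z) - t * z))).
assert (Hd : forall t, is_derive g t (Re (Cconj w * (z * (Cexp (t * z) - 1))))).
{ intros t; unfold g; destruct w as [a b]; destruct z as [x y]; simpl.
  rewrite <- ?(Rminus_def (t * x)); auto_derive; [trivial|]; unfold Rminus; ring. }
destruct (MVT_gen g 0 1 (fun t => Re (Cconj w * (z * (Cexp (t * z) - 1))))) as [t [Ht E]].
- intros t _; apply Hd.
- intros t _; apply continuity_pt_filterlim.
  apply (ex_derive_continuous (V := R_NormedModule)); eexists; apply Hd.
- rewrite Rmin_left, Rmax_right in Ht by lra.
  assert (E1 : g 1 - g 0 = Cmod w * Cmod w).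
  { rewrite <- Re_mult_conj; unfold g.
    replace (RtoC 1 * z)%C with z by (apply C_eq; destruct z; simpl; ring).
    replace (RtoC 0 * z)%C with (RtoC 0) by (apply C_eq; destruct z; simpl; ring).
    rewrite Cexp_0; unfold w at 4; destruct (Cconj w), (Cexp z), z; simpl; ring. }
  rewrite E1 in E.
  assert (H : Cmod w * Cmod w <= Cmod w * (Cmod z ^ 2 * exp (Cmod z))).
  { rewrite E, Rminus_0_r, Rmult_1_r.
    eapply Rle_trans; [apply Re_le_Cmod|].
    rewrite !Cmod_mult, Cmod_conj.
    apply Rmult_le_compat_l; [lra|].
    replace (Cmod z ^ 2 * exp (Cmod z)) with (Cmod z * (Cmod z * exp (Cmod z))) by ring.
    apply Rmult_le_compat_l; [apply Cmod_ge_0|].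
    assert (B : Cmod (t * z) <= Cmod z).
    { rewrite Cmod_mult, Cmod_R, Rabs_pos_eq by lra.
      generalize (Cmod_ge_0 z); nra. }
    eapply Rle_trans; [apply Cexp_sub_1_le|].
    apply Rmult_le_compat; [apply Cmod_ge_0 | left; apply exp_pos | exact B|].
    destruct B as [B|B]; [left; apply exp_increasing; exact B | rewrite B; lra]. }
  apply Rmult_le_reg_l with (Cmod w); assumption.
Qed.

(** * Complex differentiability *)

Lemma is_C_derive_intro (f : C -> C) (z l : C) :
  (forall eps, 0 < eps -> exists d, 0 < d /\ forall y : C, Cmod (y - z) < d ->
     Cmod (f y - f z - l * (y - z)) <= eps * Cmod (y - z)) ->
  is_derive (K := C_AbsRing) (V := AbsRing_NormedModule C_AbsRing) f z l.
Proof.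
intros H; split.
- apply is_linear_scal_l.
- intros x Hx.
  assert (E := is_filter_lim_locally_unique (K := C_AbsRing) (V := AbsRing_NormedModule C_AbsRing) z x Hx).
  rewrite <- E; intros eps.
  destruct (H eps (cond_pos eps)) as [d [Hd Hy]].
  exists (mkposreal d Hd); intros y By.
  specialize (Hy y By).
  replace (f y - f z - l * (y - z))%C with (f y - f z - (y - z) * l)%C in Hy by ring.
  exact Hy.
Qed.

Lemma is_C_derive_elim (f : C -> C) (z l : C) :
  is_derive (K := C_AbsRing) (V := AbsRing_NormedModule C_AbsRing) f z l ->
  forall eps, 0 < eps -> exists d, 0 < d /\ forall y : C, Cmod (y - z) < d ->
     Cmod (f y - f z - l * (y - z)) <= eps * Cmod (y - z).
Proof.
intros [_ H] eps He.
destruct (H z (fun P HP => HP) (mkposreal eps He)) as [d Hd].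
exists d; split; [apply cond_pos|]; intros y Hy.
specialize (Hd y Hy).
replace (f y - f z - l * (y - z))%C with (f y - f z - (y - z) * l)%C by ring.
exact Hd.
Qed.

(** [is_derive] over the field [C], unfolded to the epsilon-delta bound that the exponential
    estimates and the restriction to real lines use. *)
Definition holo (f : C -> C) (z l : C) : Prop :=
  forall eps, 0 < eps -> exists d, 0 < d /\ forall y : C, Cmod (y - z) < d ->
    Cmod (f y - f z - l * (y - z)) <= eps * Cmod (y - z).

Lemma holo_is_derive (f : C -> C) (z l : C) :
  holo f z l <-> is_derive (K := C_AbsRing) (V := AbsRing_NormedModule C_AbsRing) f z l.
Proof. split; [apply is_C_derive_intro | intros H; exact (is_C_derive_elim f z l H)]. Qed.

Lemma holo_eq (f : C -> C) (z l l' : C) : holo f z l -> l = l' -> holo f z l'.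
Proof. intros H <-; exact H. Qed.

Lemma holo_ext_loc (f g : C -> C) (z l : C) :
  (exists d, 0 < d /\ forall y, Cmod (y - z) < d -> f y = g y) ->
  holo f z l -> holo g z l.
Proof.
intros [d [Hd Hfg]] H eps He; destruct (H eps He) as [d' [Hd' Hy]].
exists (Rmin d d'); split; [apply Rmin_pos; assumption|]; intros y By.
assert (B1 := Rlt_le_trans _ _ _ By (Rmin_l d d')).
assert (B2 := Rlt_le_trans _ _ _ By (Rmin_r d d')).
rewrite <- (Hfg y B1), <- (Hfg z); [exact (Hy y B2)|].
replace (z - z)%C with (RtoC 0) by ring; rewrite Cmod_0; exact Hd.
Qed.

Lemma holo_const (k z : C) : holo (fun _ => k) z 0.
Proof. apply holo_is_derive; apply (is_derive_const (K := C_AbsRing) (V := AbsRing_NormedModule C_AbsRing)). Qed.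

Lemma holo_id (z : C) : holo (fun y => y) z 1.
Proof. apply holo_is_derive; apply (is_derive_id (K := C_AbsRing)). Qed.

Lemma holo_plus (f g : C -> C) (z l m : C) :
  holo f z l -> holo g z m -> holo (fun y => (f y + g y)%C) z (l + m).
Proof.
rewrite !holo_is_derive; intros Hf Hg.
exact (is_derive_plus (K := C_AbsRing) (V := AbsRing_NormedModule C_AbsRing) f g z l m Hf Hg).
Qed.

Lemma holo_mult (f g : C -> C) (z l m : C) :
  holo f z l -> holo g z m -> holo (fun y => (f y * g y)%C) z (l * g z + f z * m).
Proof.
rewrite !holo_is_derive; intros Hf Hg.
exact (is_derive_mult (K := C_AbsRing) f g z l m Hf Hg Cmult_comm).
Qed.

Lemma holo_comp (f g : C -> C) (z l m : C) :
  holo f (g z) l -> holo g z m -> holo (fun y => f (g y)) z (l * m).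
Proof.
rewrite !holo_is_derive; intros Hf Hg.
assert (H := is_derive_comp (K := C_AbsRing) (V := AbsRing_NormedModule C_AbsRing) f g z l m Hf Hg).
rewrite Cmult_comm; exact H.
Qed.

Lemma holo_scal (f : C -> C) (k z l : C) : holo f z l -> holo (fun y => (k * f y)%C) z (k * l).
Proof.
intros H; eapply holo_eq; [apply holo_mult; [apply holo_const | exact H]|]; simpl; ring.
Qed.

Lemma holo_minus (f g : C -> C) (z l m : C) :
  holo f z l -> holo g z m -> holo (fun y => (f y - g y)%C) z (l - m).
Proof.
intros Hf Hg; apply holo_plus; [exact Hf|].
apply holo_ext_loc with (fun y => ((- (1)) * g y)%C).
- exists 1; split; [lra|]; intros; ring.
- eapply holo_eq; [apply holo_scal; exact Hg | ring].
Qed.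

Lemma Cmod_sub_sym (a b : C) : Cmod (a - b) = Cmod (b - a).
Proof. rewrite <- Cmod_opp; f_equal; ring. Qed.

Lemma Cmod_triang_rev (a b : C) : Cmod a - Cmod b <= Cmod (a - b).
Proof.
assert (H := Cmod_triangle (a - b) b).
replace (a - b + b)%C with a in H by ring; lra.
Qed.

Lemma exp_le_3_of (x : R) : x <= 1 -> exp x <= 3.
Proof.
intros H; apply Rle_trans with (exp 1); [|apply exp_le_3].
destruct H as [H|H]; [left; apply exp_increasing; exact H | rewrite H; lra].
Qed.

Lemma holo_Cexp (z : C) : holo Cexp z (Cexp z).
Proof.
intros eps He.
set (M := Cmod (Cexp z) * 3 + 1).
assert (HM : 0 < M) by (unfold M; generalize (Cmod_ge_0 (Cexp z)); lra).
exists (Rmin 1 (eps / M)); split; [apply Rmin_pos; [lra | apply Rdiv_lt_0_compat; lra]|].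
intros y Hy.
assert (B1 := Rlt_le_trans _ _ _ Hy (Rmin_l _ _)).
assert (B2 := Rlt_le_trans _ _ _ Hy (Rmin_r _ _)).
replace (Cexp y - Cexp z - Cexp z * (y - z))%C
  with (Cexp z * (Cexp (y - z) - 1 - (y - z)))%C.
2:{ replace (Cexp y) with (Cexp z * Cexp (y - z))%C
      by (rewrite <- Cexp_plus; f_equal; ring). ring. }
rewrite Cmod_mult.
assert (H := Cexp_sub_1_sub_id_le (y - z)).
set (r := Cmod (y - z)) in *.
assert (Hr : 0 <= r) by apply Cmod_ge_0.
assert (E3 : exp r <= 3) by (apply exp_le_3_of; lra).
assert (H0 := Cmod_ge_0 (Cexp z)).
apply Rle_trans with (Cmod (Cexp z) * (r ^ 2 * 3)).
{ apply Rmult_le_compat_l; [exact H0|]; eapply Rle_trans; [exact H|].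
  apply Rmult_le_compat_l; [apply pow2_ge_0 | exact E3]. }
apply Rle_trans with (M * r * r); [unfold M; nra|].
apply Rmult_le_compat_r; [exact Hr|].
apply Rle_trans with (M * (eps / M)); [apply Rmult_le_compat_l; lra|].
right; field; lra.
Qed.

Lemma holo_Cinv (z : C) : z <> 0 -> holo Cinv z (- / (z * z)).
Proof.
intros Hz eps He.
assert (H0 : 0 < Cmod z) by (apply Cmod_gt_0; exact Hz).
set (m := Cmod z) in *.
exists (Rmin (m / 2) (eps * m ^ 3 / 2)); split.
{ apply Rmin_pos; [lra|]. apply Rdiv_lt_0_compat; [|lra].
  apply Rmult_lt_0_compat; [lra | apply pow_lt; lra]. }
intros y Hy.
assert (B1 := Rlt_le_trans _ _ _ Hy (Rmin_l _ _)).
assert (B2 := Rlt_le_trans _ _ _ Hy (Rmin_r _ _)).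
assert (Hmy : m / 2 <= Cmod y).
{ assert (H := Cmod_triang_rev z (z - y)).
  replace (z - (z - y))%C with y in H by ring.
  rewrite (Cmod_sub_sym z y) in H; fold m in H; lra. }
assert (Hy0 : y <> 0) by (apply Cmod_gt_0; lra).
replace (/ y - / z - - / (z * z) * (y - z))%C
  with ((y - z) * (y - z) * / (z * z * y))%C by (field; auto).
rewrite !Cmod_mult, Cmod_inv, !Cmod_mult by (repeat apply Cmult_neq_0; assumption).
fold m; set (r := Cmod (y - z)) in *; set (k := Cmod y) in *.
assert (Hr : 0 <= r) by apply Cmod_ge_0.
rewrite (Rmult_comm eps), Rmult_assoc; apply Rmult_le_compat_l; [exact Hr|].
apply Rmult_le_reg_r with (m * m * k); [repeat apply Rmult_lt_0_compat; lra|].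
rewrite Rmult_assoc, Rinv_l by (repeat apply Rmult_integral_contrapositive_currified; lra).
rewrite Rmult_1_r.
apply Rle_trans with (eps * m ^ 3 / 2); [lra|].
replace (eps * m ^ 3 / 2) with (eps * (m * m) * (m / 2)) by field.
replace (eps * (m * m * k)) with (eps * (m * m) * k) by ring.
apply Rmult_le_compat_l; [|exact Hmy]. apply Rmult_le_pos; nra.
Qed.

Lemma holo_inv (f : C -> C) (z l : C) :
  f z <> 0 -> holo f z l -> holo (fun y => (/ f y)%C) z (- l / (f z * f z)).
Proof.
intros Hz H; eapply holo_eq; [apply (holo_comp Cinv f); [apply holo_Cinv; exact Hz | exact H]|].
field; exact Hz.
Qed.

Lemma holo_cont (f : C -> C) (z l : C) : holo f z l ->
  forall eps, 0 < eps -> exists d, 0 < d /\ forall y, Cmod (y - z) < d -> Cmod (f y - f z) < eps.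
Proof.
intros H eps He; destruct (H 1 Rlt_0_1) as [d [Hd Hy]].
set (M := Cmod l + 1); assert (HM : 0 < M) by (unfold M; generalize (Cmod_ge_0 l); lra).
exists (Rmin d (eps / M)); split; [apply Rmin_pos; [lra | apply Rdiv_lt_0_compat; lra]|].
intros y By.
assert (B1 := Rlt_le_trans _ _ _ By (Rmin_l _ _)).
assert (B2 := Rlt_le_trans _ _ _ By (Rmin_r _ _)).
specialize (Hy y B1).
assert (T := Cmod_triangle (f y - f z - l * (y - z)) (l * (y - z))).
replace (f y - f z - l * (y - z) + l * (y - z))%C with (f y - f z)%C in T by ring.
rewrite Cmod_mult in T.
assert (Cmod (f y - f z) <= M * Cmod (y - z)) by (unfold M; lra).
apply Rle_lt_trans with (1 := H0).
apply Rlt_le_trans with (M * (eps / M)); [apply Rmult_lt_compat_l; lra|].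
right; field; lra.
Qed.

(** * The principal logarithm off its cut *)

Lemma Carg_unique (r th : R) : 0 < r -> - PI < th <= PI ->
  Carg (r * cos th, r * sin th) = th.
Proof.
intros Hr Hth; unfold Carg.
assert (E : Cmod (r * cos th, r * sin th) = r).
{ unfold Cmod; simpl.
  replace (r * cos th * (r * cos th * 1) + r * sin th * (r * sin th * 1))
    with (Rsqr r * (Rsqr (sin th) + Rsqr (cos th))) by (unfold Rsqr; ring).
  rewrite sin2_cos2, Rmult_1_r; apply sqrt_Rsqr; lra. }
rewrite E; simpl.
replace (r * cos th / r) with (cos th) by (field; lra).
destruct (Rle_dec 0 (r * sin th)) as [H|H].
- destruct (Rle_lt_dec 0 th) as [H1|H1]; [apply acos_cos; lra|].
  assert (sin th < 0) by (apply sin_lt_0_var; lra). nra.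
- destruct (Rle_lt_dec 0 th) as [H1|H1].
  + assert (0 <= sin th) by (apply sin_ge_0; lra). exfalso; nra.
  + rewrite <- (cos_neg th), acos_cos; lra.
Qed.

Lemma Clog_unique (l th : R) : - PI < th <= PI -> Clog (Cexp (l, th)) = (l, th).
Proof.
intros H; unfold Clog; rewrite Cmod_Cexp; simpl; rewrite ln_exp; f_equal.
unfold Cexp; simpl; apply Carg_unique; [apply exp_pos | exact H].
Qed.

Lemma Clog_right_half (z : C) : 0 < Re z -> Clog z = (ln (Cmod z), atan (Im z / Re z)).
Proof.
intros Hz.
assert (H0 : z <> 0) by (intros ->; simpl in Hz; lra).
assert (Hm : 0 < Cmod z) by (apply Cmod_gt_0; exact H0).
assert (Hb := atan_bound (Im z / Re z)).
rewrite <- Clog_unique by (generalize PI_RGT_0; lra); f_equal.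
assert (Hq : Cmod z = Re z * sqrt (1 + (Im z / Re z)²)).
{ transitivity (sqrt ((Re z)²) * sqrt (1 + (Im z / Re z)²)); [|rewrite sqrt_Rsqr; lra].
  unfold Cmod; rewrite <- sqrt_mult_alt by apply Rle_0_sqr; f_equal; unfold Rsqr, Re, Im in *; field; lra. }
assert (Hs : 0 < sqrt (1 + (Im z / Re z)²)).
{ apply sqrt_lt_R0; generalize (Rle_0_sqr (Im z / Re z)); lra. }
apply C_eq; simpl; rewrite exp_ln by exact Hm; rewrite ?cos_atan, ?sin_atan, Hq; field; lra.
Qed.

Lemma ln_le_sub_1 (x : R) : 0 < x -> ln x <= x - 1.
Proof.
intros H; rewrite <- (ln_exp (x - 1)); destruct (Req_dec (x - 1) 0) as [E|E].
- rewrite E, exp_0; replace x with 1 by lra; lra.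
- left; apply ln_increasing; [exact H|]; assert (U := exp_ineq1 (x - 1) E); lra.
Qed.

Lemma atan_pos (x : R) : 0 <= x -> 0 <= atan x.
Proof.
intros [H| <-]; [left; rewrite <- atan_0; apply atan_increasing; exact H | rewrite atan_0; lra].
Qed.

Lemma atan_le_id (x : R) : 0 <= x -> atan x <= x.
Proof.
intros [Hx| <-]; [|rewrite atan_0; lra].
destruct (MVT_gen atan 0 x (fun u => / (1 + u ^ 2))) as [c [_ E]].
- intros u _; apply is_derive_Reals; apply derivable_pt_lim_atan.
- intros u _; apply derivable_continuous_pt; apply derivable_pt_atan.
- rewrite atan_0 in E.
  assert (/ (1 + c ^ 2) <= 1); [|nra].
  rewrite <- Rinv_1; apply Rinv_le_contravar; [lra|]; generalize (pow2_ge_0 c); lra.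
Qed.

Lemma Rabs_atan_le (x : R) : Rabs (atan x) <= Rabs x.
Proof.
destruct (Rle_lt_dec 0 x) as [H|H].
- rewrite !Rabs_pos_eq; [apply atan_le_id; exact H | exact H | apply atan_pos; exact H].
- rewrite <- (Rabs_Ropp (atan x)), <- (Rabs_Ropp x), <- atan_opp, !Rabs_pos_eq;
    [apply atan_le_id; lra | lra | apply atan_pos; lra].
Qed.

(** As [Carg] takes its values in ]-PI, PI], this is the plane cut along the closed negative real
    axis. *)
Definition slit (z : C) : Prop := z <> 0 /\ - PI < Carg z < PI.

(* Near 1 the logarithm is explicit and additivity of the argument does not wrap. *)
Lemma Clog_near (z : C) : slit z -> exists d, 0 < d /\ forall y, Cmod (y - z) < d ->
  exists k, Clog y = (Clog z + k)%C /\ Cexp k = (y / z)%C /\ Cmod k <= 8 * (Cmod (y - z) / Cmod z).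
Proof.
intros [Hz Hs].
assert (H0 : 0 < Cmod z) by (apply Cmod_gt_0; exact Hz).
(* Room left to the argument before it reaches the cut. The 1/2 in the radius keeps y / z in the
   right half-plane; the gap / 8 keeps the increment of the argument, at most 2 |h|, below [gap]. *)
set (gap := Rmin (PI - Carg z) (PI + Carg z)).
assert (Hg : 0 < gap) by (apply Rmin_pos; lra).
exists (Cmod z * Rmin (1/2) (gap / 8)); split.
{ apply Rmult_lt_0_compat; [lra|]; apply Rmin_pos; lra. }
intros y Hy.
set (h := ((y - z) / z)%C).
assert (Eh : Cmod h = Cmod (y - z) / Cmod z) by (unfold h; rewrite Cmod_div by exact Hz; reflexivity).
assert (Bh : Cmod h < Rmin (1/2) (gap / 8)).
{ rewrite Eh; apply Rmult_lt_reg_l with (Cmod z); [lra|].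
  replace (Cmod z * (Cmod (y - z) / Cmod z)) with (Cmod (y - z)) by (field; lra); exact Hy. }
assert (B1 := Rlt_le_trans _ _ _ Bh (Rmin_l _ _)).
assert (B2 := Rlt_le_trans _ _ _ Bh (Rmin_r _ _)).
rewrite <- Eh.
assert (Ey : (y / z)%C = (1 + h)%C) by (unfold h; field; exact Hz).
assert (R1 := proj1 (Rabs_le_between _ _) (re_le_Cmod h)).
assert (I1 : Rabs (Im h) <= Cmod h).
{ generalize (im_le_Cmod h); intros Q; exact Q. }
assert (HRe : 1 / 2 <= Re (1 + h)).
{ change (Re (1 + h)) with (1 + Re h); lra. }
set (w := (1 + h)%C) in *.
assert (Hw : w <> 0) by (intros E; rewrite E in HRe; simpl in HRe; lra).
assert (Hlw := Clog_right_half w ltac:(lra)).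
set (k := (ln (Cmod w), atan (Im w / Re w)) : C) in *.
assert (Ek : Cexp k = w) by (rewrite <- Hlw; apply Cexp_Clog; exact Hw).
assert (Bln : Rabs (ln (Cmod w)) <= 2 * Cmod h).
{ assert (Hmw : 1 / 2 <= Cmod w) by (eapply Rle_trans; [exact HRe | apply Re_le_Cmod]).
  assert (T1 : Cmod w <= 1 + Cmod h) by (eapply Rle_trans; [apply Cmod_triangle|]; rewrite Cmod_1; lra).
  assert (T2 : 1 - Cmod h <= Cmod w).
  { assert (Q := Cmod_triang_rev 1 (- h)); rewrite Cmod_1, Cmod_opp in Q.
    replace (1 - - h)%C with w in Q by (unfold w; ring). exact Q. }
  assert (Hh := Cmod_ge_0 h).
  apply Rabs_le; split.
  - assert (Hi : 0 < / Cmod w) by (apply Rinv_0_lt_compat; lra).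
    assert (Q := ln_le_sub_1 _ Hi).
    rewrite ln_Rinv in Q by lra.
    assert (/ Cmod w <= 1 + 2 * Cmod h); [|lra].
    apply Rmult_le_reg_r with (Cmod w); [lra|]; rewrite Rinv_l by lra; nra.
  - assert (Q := ln_le_sub_1 (Cmod w) ltac:(lra)); lra. }
assert (Bat : Rabs (atan (Im w / Re w)) <= 2 * Cmod h).
{ eapply Rle_trans; [apply Rabs_atan_le|].
  assert (Ei : Im w = Im h) by (unfold w; destruct h; simpl; ring).
  rewrite Ei; unfold Rdiv; rewrite Rabs_mult, Rabs_inv, (Rabs_pos_eq (Re w)) by lra.
  apply Rmult_le_reg_r with (Re w); [lra|]; rewrite Rmult_assoc, Rinv_l by lra.
  generalize (Cmod_ge_0 h); nra. }
exists k; repeat split.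
- replace y with (Cexp (Clog z + k)%C).
  + change (Clog z + k)%C with (ln (Cmod z) + ln (Cmod w), Carg z + atan (Im w / Re w)).
    apply Clog_unique.
    assert (U := proj1 (Rabs_le_between _ _) Bat).
    generalize (Rmin_l (PI - Carg z) (PI + Carg z)) (Rmin_r (PI - Carg z) (PI + Carg z)).
    fold gap; lra.
  + rewrite Cexp_plus, Ek, Cexp_Clog by exact Hz; rewrite <- Ey; field; exact Hz.
- rewrite Ek, Ey; reflexivity.
- eapply Rle_trans; [apply Cmod_le_sum|].
  change (Re k) with (ln (Cmod w)); change (Im k) with (atan (Im w / Re w)).
  generalize (Cmod_ge_0 h); lra.
Qed.

(** With k = Clog y - Clog z one has y / z = exp k, so the remainder is exactly - (exp k - 1 - k),
    which is quadratic in k and hence in y - z. *)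
Lemma holo_Clog (z : C) : slit z -> holo Clog z (/ z).
Proof.
intros Hs eps He.
assert (Hz := proj1 Hs).
assert (H0 : 0 < Cmod z) by (apply Cmod_gt_0; exact Hz).
destruct (Clog_near z Hs) as [d [Hd Hn]].
set (m := Cmod z) in *.
exists (Rmin d (Rmin (m / 8) (eps * m * m / 192))); split.
{ repeat apply Rmin_pos; try lra. apply Rdiv_lt_0_compat; [|lra].
  repeat apply Rmult_lt_0_compat; lra. }
intros y Hy.
assert (B1 := Rlt_le_trans _ _ _ Hy (Rmin_l _ _)).
assert (B2 := Rlt_le_trans _ _ _ Hy (Rmin_r _ _)).
assert (B3 := Rlt_le_trans _ _ _ B2 (Rmin_l _ _)).
assert (B4 := Rlt_le_trans _ _ _ B2 (Rmin_r _ _)).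
destruct (Hn y B1) as [k [E1 [E2 Bk]]].
rewrite E1.
replace (Clog z + k - Clog z - / z * (y - z))%C with (- (Cexp k - 1 - k))%C
  by (rewrite E2; field; exact Hz).
rewrite Cmod_opp.
eapply Rle_trans; [apply Cexp_sub_1_sub_id_le|].
fold m in Bk; set (r := Cmod (y - z)) in *.
assert (Hr : 0 <= r) by apply Cmod_ge_0.
assert (Hk := Cmod_ge_0 k).
assert (Q1 : Cmod k <= 1).
{ eapply Rle_trans; [exact Bk|]. apply Rmult_le_reg_r with m; [lra|].
  replace (8 * (r / m) * m) with (8 * r) by (field; lra); lra. }
assert (E3 := exp_le_3_of _ Q1).
apply Rle_trans with ((8 * (r / m)) ^ 2 * 3).
{ apply Rmult_le_compat; [apply pow2_ge_0 | left; apply exp_pos | | exact E3].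
  apply pow_incr; lra. }
replace ((8 * (r / m)) ^ 2 * 3) with (192 * r / (m * m) * r) by (field; lra).
apply Rmult_le_compat_r; [exact Hr|].
apply Rmult_le_reg_r with (m * m); [nra|].
replace (192 * r / (m * m) * (m * m)) with (192 * r) by (field; lra). lra.
Qed.

Lemma slit_right_half (z : C) : 0 < Re z -> slit z.
Proof.
intros H; split; [intros ->; simpl in H; lra|].
assert (E := Clog_right_half z H); apply (f_equal snd) in E; simpl in E; rewrite E.
generalize (atan_bound (Im z / Re z)) PI_RGT_0; lra.
Qed.

Lemma slit_Im (z : C) : Im z <> 0 -> slit z.
Proof.
intros H.
assert (H0 : z <> 0) by (intros ->; simpl in H; lra).
assert (Hm : 0 < Cmod z) by (apply Cmod_gt_0; exact H0).
split; [exact H0|].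
assert (B := Carg_bounds z H0); split; [lra|].
destruct (Req_dec (Carg z) PI) as [E|]; [exfalso|lra].
assert (Q := Cexp_Clog z H0); unfold Clog in Q; rewrite E in Q.
apply (f_equal Im) in Q; simpl in Q; rewrite sin_PI in Q; lra.
Qed.

Lemma holo_line (f : C -> C) (z0 v l : C) (t : R) :
  holo f (z0 + v * t) l ->
  is_derive (fun tau : R => Re (f (z0 + v * tau)%C)) t (Re (l * v)) /\
  is_derive (fun tau : R => Im (f (z0 + v * tau)%C)) t (Im (l * v)).
Proof.
intros H.
(* Real and imaginary parts share one argument: only additivity, real homogeneity and |p a| <= |a|
   matter. *)
assert (P : forall (p : C -> R), (forall a b, p (a - b)%C = p a - p b) ->
  (forall a, Rabs (p a) <= Cmod a) -> (forall a (k : R), p (a * k)%C = p a * k) ->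
  is_derive (fun tau : R => p (f (z0 + v * tau)%C)) t (p (l * v)%C)).
{ intros p Ps Pb Pk; apply is_derive_Reals; intros eps He.
  set (M := Cmod v + 1); assert (HM : 0 < M) by (unfold M; generalize (Cmod_ge_0 v); lra).
  destruct (H (eps / (2 * M))) as [d [Hd Hy]]; [apply Rdiv_lt_0_compat; lra|].
  assert (Hdm : 0 < d / M) by (apply Rdiv_lt_0_compat; lra).
  exists (mkposreal _ Hdm); intros h Hh0 Hh; simpl in Hh.
  set (y := (z0 + v * RtoC (t + h))%C).
  assert (Ey : (y - (z0 + v * t))%C = (v * h)%C) by (unfold y; rewrite RtoC_plus; ring).
  assert (Em : Cmod (v * h) <= M * Rabs h).
  { rewrite Cmod_mult, Cmod_R; unfold M; generalize (Rabs_pos h); nra. }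
  assert (Bm : Cmod (v * h) < d).
  { apply Rle_lt_trans with (1 := Em); apply Rlt_le_trans with (M * (d / M));
      [apply Rmult_lt_compat_l; lra | right; field; lra]. }
  assert (Q := Hy y); rewrite Ey in Q; specialize (Q Bm).
  replace ((p (f y) - p (f (z0 + v * t)%C)) / h - p (l * v)%C)
    with (p (f y - f (z0 + v * t) - l * (v * h))%C / h).
  2:{ rewrite !Ps; replace (l * (v * h))%C with (l * v * h)%C by ring.
      rewrite Pk; field; exact Hh0. }
  unfold Rdiv at 1; rewrite Rabs_mult, Rabs_inv.
  assert (Hah := Rabs_pos_lt h Hh0).
  apply Rmult_lt_reg_r with (Rabs h); [exact Hah|].
  rewrite Rmult_assoc, Rinv_l, Rmult_1_r by lra.
  apply Rle_lt_trans with (1 := Pb _); apply Rle_lt_trans with (1 := Q).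
  apply Rle_lt_trans with (eps / (2 * M) * (M * Rabs h)).
  - apply Rmult_le_compat_l; [left; apply Rdiv_lt_0_compat; lra | exact Em].
  - replace (eps / (2 * M) * (M * Rabs h)) with (eps * Rabs h / 2) by (field; lra). nra. }
split; apply P.
- intros [] []; simpl; ring.
- apply re_le_Cmod.
- intros [] k; simpl; ring.
- intros [] []; simpl; ring.
- intros a; exact (im_le_Cmod a).
- intros [] k; simpl; ring.
Qed.

(** * Integrals over the line of exponentially decaying functions *)

Definition Edec (K : R) (g : R -> R) : Prop :=
  (forall u, continuous g u) /\ forall u, Rabs (g u) <= K * exp (- Rabs u).

Lemma Edec_ex_RInt (K : R) (g : R -> R) (a b : R) : Edec K g -> ex_RInt g a b.
Proof. intros [H _]; apply (ex_RInt_continuous (V := R_CompleteNormedModule)); auto. Qed.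

Lemma RInt_exp_tail (G k a b : R) : 0 < k ->
  is_RInt (fun u => G * exp (- k * (u - a))) a b (G / k * (1 - exp (- k * (b - a)))).
Proof.
intros Hk.
assert (H := is_RInt_derive (V := R_CompleteNormedModule)
  (fun u => - (G / k) * exp (- k * (u - a))) (fun u => G * exp (- k * (u - a))) a b).
replace (G / k * (1 - exp (- k * (b - a))))
  with (minus (- (G / k) * exp (- k * (b - a))) (- (G / k) * exp (- k * (a - a)))).
- apply H; intros u _.
  + auto_derive; [trivial|]; unfold Rminus; field; lra.
  + apply (ex_derive_continuous (V := R_NormedModule)); auto_derive; trivial.
- unfold minus, plus, opp; simpl. replace (- k * (a - a)) with 0 by ring; rewrite exp_0; ring.
Qed.

(** One-sided, because the half-plane bound is a lower bound; two-sided versions follow by applying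
    it to g and - g. *)
Lemma RInt_lower_exp (g : R -> R) (G k a b : R) : 0 < k -> 0 <= G -> a <= b -> ex_RInt g a b ->
  (forall u, a <= u <= b -> - (G * exp (- k * (u - a))) <= g u) ->
  - (G / k) <= RInt g a b.
Proof.
intros Hk HG Hab Hex H.
assert (T := RInt_exp_tail (- G) k a b Hk).
assert (Q : RInt (fun u => - G * exp (- k * (u - a))) a b <= RInt g a b).
{ apply RInt_le; [exact Hab | eexists; exact T | exact Hex|].
  intros u Hu; specialize (H u ltac:(lra)); lra. }
rewrite (is_RInt_unique _ _ _ _ T) in Q.
assert (0 <= G / k) by (apply Rdiv_le_0_compat; lra).
generalize (exp_pos (- k * (b - a))).
replace (- G / k) with (- (G / k)) in Q by (field; lra). nra.
Qed.

Lemma RInt_exp_tail_left (G k a b : R) : 0 < k ->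
  is_RInt (fun u => G * exp (- k * (b - u))) a b (G / k * (1 - exp (- k * (b - a)))).
Proof.
intros Hk.
assert (H := is_RInt_derive (V := R_CompleteNormedModule)
  (fun u => G / k * exp (- k * (b - u))) (fun u => G * exp (- k * (b - u))) a b).
replace (G / k * (1 - exp (- k * (b - a))))
  with (minus (G / k * exp (- k * (b - b))) (G / k * exp (- k * (b - a)))).
- apply H; intros u _.
  + auto_derive; [trivial|]; unfold Rminus; field; lra.
  + apply (ex_derive_continuous (V := R_NormedModule)); auto_derive; trivial.
- unfold minus, plus, opp; simpl. replace (- k * (b - b)) with 0 by ring; rewrite exp_0; ring.
Qed.

Lemma RInt_lower_exp_left (g : R -> R) (G k a b : R) : 0 < k -> 0 <= G -> a <= b -> ex_RInt g a b ->
  (forall u, a <= u <= b -> - (G * exp (- k * (b - u))) <= g u) ->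
  - (G / k) <= RInt g a b.
Proof.
intros Hk HG Hab Hex H.
assert (T := RInt_exp_tail_left (- G) k a b Hk).
assert (Q : RInt (fun u => - G * exp (- k * (b - u))) a b <= RInt g a b).
{ apply RInt_le; [exact Hab | eexists; exact T | exact Hex|].
  intros u Hu; specialize (H u ltac:(lra)); lra. }
rewrite (is_RInt_unique _ _ _ _ T) in Q.
assert (0 <= G / k) by (apply Rdiv_le_0_compat; lra).
generalize (exp_pos (- k * (b - a))).
replace (- G / k) with (- (G / k)) in Q by (field; lra). nra.
Qed.

(* The integral over the whole line; it is meaningful under [Edec], see [II_approx]. *)
Definition II (g : R -> R) : R := real (Lim_seq (fun n => RInt g (- INR n) (INR n))).

Lemma Edec_K_pos (K : R) (g : R -> R) : Edec K g -> 0 <= K.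
Proof.
intros [_ H]; specialize (H 0); rewrite Rabs_R0, Ropp_0, exp_0 in H.
generalize (Rabs_pos (g 0)); lra.
Qed.

Lemma Edec_opp (K : R) (g : R -> R) : Edec K g -> Edec K (fun u => - g u).
Proof.
intros [H1 H2]; split; intros u.
- apply (continuous_opp (V := R_NormedModule)); apply H1.
- rewrite Rabs_Ropp; apply H2.
Qed.

Lemma RInt_Ropp (g : R -> R) (a b : R) : ex_RInt g a b -> RInt (fun u => - g u) a b = - RInt g a b.
Proof. intros H; exact (RInt_opp (V := R_CompleteNormedModule) g a b H). Qed.

Lemma Edec_tail (K : R) (g : R -> R) (a b : R) : Edec K g -> 0 <= a <= b ->
  Rabs (RInt g a b) <= K * exp (- a) /\ Rabs (RInt g (- b) (- a)) <= K * exp (- a).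
Proof.
intros HE Hab.
assert (HK := Edec_K_pos _ _ HE).
assert (HP : 0 <= K * exp (- a)) by (generalize (exp_pos (- a)); nra).
assert (P : forall h, Edec K h ->
  - (K * exp (- a)) <= RInt h a b /\ - (K * exp (- a)) <= RInt h (- b) (- a)).
{ intros h Hh; split; replace (K * exp (- a)) with (K * exp (- a) / 1) by field.
  - apply RInt_lower_exp; try lra; [eapply Edec_ex_RInt; exact Hh|].
    intros u Hu; destruct Hh as [_ Hh]; specialize (Hh u).
    rewrite (Rabs_pos_eq u) in Hh by lra.
    rewrite Rmult_assoc, <- exp_plus; replace (- a + - (1) * (u - a)) with (- u) by ring.
    apply Rabs_le_between in Hh; lra.
  - apply RInt_lower_exp_left; try lra; [eapply Edec_ex_RInt; exact Hh|].
    intros u Hu; destruct Hh as [_ Hh]; specialize (Hh u).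
    rewrite (Rabs_left1 u) in Hh by lra.
    rewrite Rmult_assoc, <- exp_plus; replace (- a + - (1) * (- a - u)) with (- - u) by ring.
    apply Rabs_le_between in Hh; lra. }
destruct (P g HE) as [A1 A2]; destruct (P _ (Edec_opp _ _ HE)) as [B1 B2].
rewrite RInt_Ropp in B1, B2 by (eapply Edec_ex_RInt; exact HE).
split; apply Rabs_le; lra.
Qed.

Lemma RInt_split3 (g : R -> R) (a b c d : R) : (forall x y, ex_RInt g x y) ->
  RInt g a d = RInt g a b + RInt g b c + RInt g c d.
Proof.
intros H.
rewrite <- (RInt_Chasles (V := R_CompleteNormedModule) g a c d), <- (RInt_Chasles (V := R_CompleteNormedModule) g a b c)
  by apply H; reflexivity.
Qed.

Lemma Edec_cauchy (K : R) (g : R -> R) (a b a' b' : R) : Edec K g ->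
  0 <= a <= a' -> 0 <= b <= b' ->
  Rabs (RInt g (- a') b' - RInt g (- a) b) <= K * (exp (- a) + exp (- b)).
Proof.
intros HE Ha Hb.
rewrite (RInt_split3 g (- a') (- a) b b') by (intros; eapply Edec_ex_RInt; exact HE).
destruct (Edec_tail K g a a' HE Ha) as [_ T1]; destruct (Edec_tail K g b b' HE Hb) as [T2 _].
replace (RInt g (- a') (- a) + RInt g (- a) b + RInt g b b' - RInt g (- a) b)
  with (RInt g (- a') (- a) + RInt g b b') by ring.
eapply Rle_trans; [apply Rabs_triang|]; lra.
Qed.

Lemma exp_neg_small (eps : R) : 0 < eps -> exists A, 0 <= A /\ forall a, A <= a -> exp (- a) < eps.
Proof.
intros He; exists (Rmax 0 (1 - ln eps)); split; [apply Rmax_l|]; intros a Ha.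
assert (H := Rle_trans _ _ _ (Rmax_r _ _) Ha).
rewrite <- (exp_ln eps He); apply exp_increasing; lra.
Qed.

Lemma Edec_is_lim (K : R) (g : R -> R) : Edec K g ->
  is_lim_seq (fun n => RInt g (- INR n) (INR n)) (II g).
Proof.
intros HE; apply Lim_seq_correct', ex_lim_seq_cauchy_corr.
intros eps; assert (HK := Edec_K_pos _ _ HE).
destruct (exp_neg_small (eps / (2 * (K + 1)))) as [A [HA H]].
{ apply Rdiv_lt_0_compat; [apply cond_pos | lra]. }
destruct (INR_unbounded A) as [N HN]; exists N.
assert (P : forall n m, (N <= n <= m)%nat ->
  Rabs (RInt g (- INR m) (INR m) - RInt g (- INR n) (INR n)) < eps).
{ intros n m [Hn Hm]; apply le_INR in Hn; apply le_INR in Hm.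
  eapply Rle_lt_trans; [apply Edec_cauchy; [exact HE | lra | lra]|].
  specialize (H (INR n) ltac:(lra)).
  assert (E : pos eps = (K + 1) * (eps / (2 * (K + 1)) + eps / (2 * (K + 1)))) by (field; lra).
  rewrite E; generalize (exp_pos (- INR n)); nra. }
intros n m Hn Hm; destruct (Nat.le_gt_cases n m) as [L|L].
- rewrite Rabs_minus_sym; apply P; lia.
- apply P; lia.
Qed.

Lemma II_approx (K : R) (g : R -> R) (a b : R) : Edec K g -> 0 <= a -> 0 <= b ->
  Rabs (II g - RInt g (- a) b) <= K * (exp (- a) + exp (- b)).
Proof.
intros HE Ha Hb.
assert (L := Edec_is_lim K g HE).
assert (L2 : is_lim_seq (fun n => Rabs (RInt g (- INR n) (INR n) - RInt g (- a) b))
  (Rabs (II g - RInt g (- a) b))).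
{ apply (is_lim_seq_abs _ (II g - RInt g (- a) b)).
  apply is_lim_seq_minus'; [exact L | apply is_lim_seq_const]. }
refine (is_lim_seq_le_loc _ (fun _ => K * (exp (- a) + exp (- b))) (Finite _) (Finite _) _ L2 (is_lim_seq_const _)).
destruct (INR_unbounded (Rmax a b)) as [N HN]; exists N; intros n Hn.
apply le_INR in Hn.
generalize (Rmax_l a b) (Rmax_r a b); intros; apply Edec_cauchy; [exact HE | lra | lra].
Qed.

Lemma Rabs_small_eq (x y C : R) : (forall a, 0 <= a -> Rabs (x - y) <= C * exp (- a)) -> x = y.
Proof.
intros H; destruct (Req_dec x y) as [E|E]; [exact E|exfalso].
assert (P : 0 < Rabs (x - y)) by (apply Rabs_pos_lt; lra).
assert (HC : 0 < C).
{ specialize (H 0 (Rle_refl _)); rewrite Ropp_0, exp_0 in H; lra. }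
destruct (exp_neg_small (Rabs (x - y) / C)) as [A [HA Q]]; [apply Rdiv_lt_0_compat; lra|].
specialize (H A HA); specialize (Q A (Rle_refl _)).
apply (Rmult_lt_compat_l C) in Q; [|lra].
replace (C * (Rabs (x - y) / C)) with (Rabs (x - y)) in Q by (field; lra); lra.
Qed.

Lemma II_unique (K C : R) (g : R -> R) (v : R) : Edec K g ->
  (forall a, 0 <= a -> Rabs (RInt g (- a) a - v) <= C * exp (- a)) -> II g = v.
Proof.
intros HE H; apply (Rabs_small_eq _ _ (2 * K + C)); intros a Ha.
specialize (H a Ha); assert (Q := II_approx K g a a HE Ha Ha).
replace (II g - v) with ((II g - RInt g (- a) a) + (RInt g (- a) a - v)) by ring.
eapply Rle_trans; [apply Rabs_triang|]; lra.
Qed.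

Lemma II_le (K : R) (g : R -> R) : Edec K g -> Rabs (II g) <= 2 * K.
Proof.
intros HE; assert (Q := II_approx K g 0 0 HE (Rle_refl _) (Rle_refl _)).
rewrite Ropp_0, RInt_point, exp_0 in Q; unfold zero in Q; simpl in Q.
rewrite Rminus_0_r in Q; lra.
Qed.

Lemma Edec_lin (K L k l : R) (g h : R -> R) : Edec K g -> Edec L h ->
  Edec (Rabs k * K + Rabs l * L) (fun u => k * g u + l * h u).
Proof.
intros [H1 H2] [H3 H4]; split; intros u.
- apply (continuous_plus (V := R_NormedModule)); apply (continuous_scal_r (V := R_NormedModule)); auto.
- eapply Rle_trans; [apply Rabs_triang|]; rewrite !Rabs_mult.
  specialize (H2 u); specialize (H4 u).
  generalize (Rabs_pos k) (Rabs_pos l); intros; nra.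
Qed.

Lemma RInt_lin (k l a b : R) (g h : R -> R) : ex_RInt g a b -> ex_RInt h a b ->
  RInt (fun u => k * g u + l * h u) a b = k * RInt g a b + l * RInt h a b.
Proof.
intros Hg Hh.
assert (E1 := RInt_scal (V := R_CompleteNormedModule) g a b k Hg).
assert (E2 := RInt_scal (V := R_CompleteNormedModule) h a b l Hh).
change (k * RInt g a b) with (scal k (RInt g a b)); change (l * RInt h a b) with (scal l (RInt h a b)).
rewrite <- E1, <- E2.
apply (RInt_plus (V := R_CompleteNormedModule) (fun u => scal k (g u)) (fun u => scal l (h u)));
  apply (ex_RInt_scal (V := R_NormedModule)); assumption.
Qed.

Lemma II_lin (K L k l : R) (g h : R -> R) : Edec K g -> Edec L h ->
  II (fun u => k * g u + l * h u) = k * II g + l * II h.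
Proof.
intros Hg Hh; apply (II_unique _ (Rabs k * (2 * K) + Rabs l * (2 * L))) with (1 := Edec_lin K L k l g h Hg Hh).
intros a Ha; rewrite RInt_lin by (eapply Edec_ex_RInt; eassumption).
assert (Q1 := II_approx K g a a Hg Ha Ha); assert (Q2 := II_approx L h a a Hh Ha Ha).
rewrite Rabs_minus_sym.
replace (k * II g + l * II h - (k * RInt g (- a) a + l * RInt h (- a) a))
  with (k * (II g - RInt g (- a) a) + l * (II h - RInt h (- a) a)) by ring.
eapply Rle_trans; [apply Rabs_triang|]; rewrite !Rabs_mult.
generalize (Rabs_pos k) (Rabs_pos l); intros; nra.
Qed.

Lemma II_ext (g h : R -> R) : (forall u, g u = h u) -> II g = II h.
Proof.
intros H; unfold II; f_equal; apply Lim_seq_ext; intros n; apply RInt_ext; auto.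
Qed.

(** The constant [K], known only to exist, does not enter the result: it merely lets the truncation
    error fall below a supposed deficit [d]. The tails have their own explicit constants and
    rates. *)
Lemma II_lower (K : R) (g : R -> R) (a b G1 k1 G2 k2 : R) : Edec K g ->
  0 < k1 -> 0 <= G1 -> 0 < k2 -> 0 <= G2 ->
  (forall u, b <= u -> - (G1 * exp (- k1 * (u - b))) <= g u) ->
  (forall u, u <= a -> - (G2 * exp (- k2 * (a - u))) <= g u) ->
  RInt g a b - G1 / k1 - G2 / k2 <= II g.
Proof.
intros HE Hk1 HG1 Hk2 HG2 H1 H2.
apply Rnot_lt_le; intros N.
set (d := RInt g a b - G1 / k1 - G2 / k2 - II g) in *.
assert (Hd : 0 < d) by (unfold d; lra).
assert (HK := Edec_K_pos _ _ HE).
destruct (exp_neg_small (d / (2 * (K + 1)))) as [A [HA HQ]]; [apply Rdiv_lt_0_compat; lra|].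
set (M := Rmax A (Rmax (Rabs a) (Rabs b))).
assert (M1 : A <= M) by apply Rmax_l.
assert (M2 : Rabs a <= M) by (eapply Rle_trans; [apply Rmax_l | apply Rmax_r]).
assert (M3 : Rabs b <= M) by (eapply Rle_trans; [apply Rmax_r | apply Rmax_r]).
apply Rabs_le_between in M2; apply Rabs_le_between in M3.
assert (Q := II_approx K g M M HE ltac:(lra) ltac:(lra)).
rewrite (RInt_split3 g (- M) a b M) in Q by (intros; eapply Edec_ex_RInt; exact HE).
assert (T1 : - (G1 / k1) <= RInt g b M).
{ apply RInt_lower_exp; try lra; [eapply Edec_ex_RInt; exact HE|]; intros u Hu; apply H1; lra. }
assert (T2 : - (G2 / k2) <= RInt g (- M) a).
{ apply RInt_lower_exp_left; try lra; [eapply Edec_ex_RInt; exact HE|]; intros u Hu; apply H2; lra. }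
specialize (HQ M M1).
assert (E : d = (K + 1) * (d / (2 * (K + 1)) + d / (2 * (K + 1)))) by (field; lra).
apply Rabs_le_between in Q; generalize (exp_pos (- M)); intros.
assert (K * (exp (- M) + exp (- M)) < d) by (rewrite E; nra).
unfold d in *; lra.
Qed.

(** * Differentiation under the integral sign *)

Definition clamp (a b t : R) : R := Rmax a (Rmin b t).

Lemma clamp_in (a b t : R) : a <= b -> a <= clamp a b t <= b.
Proof.
intros H; unfold clamp; split; [apply Rmax_l|].
apply Rmax_lub; [exact H | apply Rmin_l].
Qed.

Lemma clamp_id (a b t : R) : a <= t <= b -> clamp a b t = t.
Proof. intros H; unfold clamp; rewrite Rmin_right, Rmax_right; lra. Qed.

Lemma clamp_lip (a b t v : R) : Rabs (clamp a b t - clamp a b v) <= Rabs (t - v).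
Proof.
unfold clamp; apply Rabs_le; unfold Rmax, Rmin.
generalize (Rle_abs (t - v)) (Rle_abs (- (t - v))); rewrite Rabs_Ropp; intros.
repeat destruct Rle_dec; lra.
Qed.

(* Differentiation under the integral sign when the integrand's [x]-derivative is a [t]-derivative.
   Clamping the second variable makes hypotheses on the closed rectangle sufficient. *)
Lemma is_derive_RInt_exact (P Q D : R -> R -> R) (a b x : R) : a <= b ->
  (exists d, 0 < d /\ forall y, Rabs (y - x) < d -> forall t, a <= t <= b ->
     is_derive (fun z => P z t) y (D y t)) ->
  (forall t, a <= t <= b -> is_derive (fun v => Q x v) t (D x t)) ->
  (forall t, a <= t <= b -> continuity_2d_pt D x t) ->
  locally x (fun y => ex_RInt (P y) a b) ->
  is_derive (fun z => RInt (P z) a b) x (Q x b - Q x a).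
Proof.
intros Hab [d [Hd HP]] HQ HD Hex.
set (P' := fun z t => P z (clamp a b t)).
assert (HP' : forall y, Rabs (y - x) < d -> forall t, is_derive (fun z => P' z t) y (D y (clamp a b t))).
{ intros y Hy t; apply HP; [exact Hy | apply clamp_in; exact Hab]. }
assert (Eq : forall z, RInt (P' z) a b = RInt (P z) a b).
{ intros z; apply RInt_ext; intros t Ht; rewrite Rmin_left, Rmax_right in Ht by exact Hab.
  unfold P'; rewrite clamp_id by lra; reflexivity. }
apply (is_derive_ext (fun z => RInt (P' z) a b)); [exact Eq|].
assert (H := is_derive_RInt_param P' a b x).
replace (Q x b - Q x a) with (RInt (fun t => Derive (fun u => P' u t) x) a b).
- apply H.
  + exists (mkposreal d Hd); intros y Hy t _; eexists; apply HP'; exact Hy.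
  + intros t Ht; rewrite Rmin_left, Rmax_right in Ht by exact Hab.
    apply continuity_2d_pt_ext_loc with (fun u v => D u (clamp a b v)).
    * exists (mkposreal d Hd); intros u v Hu _; symmetry; apply is_derive_unique, HP'; exact Hu.
    * intros eps; destruct (HD t Ht eps) as [d' Hd']; exists d'.
      intros u v Hu Hv; rewrite (clamp_id a b t) by exact Ht.
      apply Hd'; [exact Hu|].
      rewrite <- (clamp_id a b t) by exact Ht.
      eapply Rle_lt_trans; [apply clamp_lip | exact Hv].
  + revert Hex; apply filter_imp; intros y Hy.
    eapply ex_RInt_ext; [|exact Hy]; intros t Ht.
    rewrite Rmin_left, Rmax_right in Ht by exact Hab.
    unfold P'; rewrite clamp_id by lra; reflexivity.
- apply is_RInt_unique.
  apply is_RInt_ext with (D x).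
  + intros t Ht; rewrite Rmin_left, Rmax_right in Ht by exact Hab.
    symmetry; replace (D x t) with (D x (clamp a b t)) by (rewrite clamp_id by lra; reflexivity).
    apply is_derive_unique, HP'; rewrite Rminus_diag, Rabs_R0; exact Hd.
  + apply (is_RInt_derive (V := R_CompleteNormedModule) (Q x) (D x)).
    * intros t Ht; rewrite Rmin_left, Rmax_right in Ht by exact Hab; apply HQ; exact Ht.
    * intros t Ht; rewrite Rmin_left, Rmax_right in Ht by exact Hab.
      intros U [eps HU]; destruct (HD t Ht eps) as [d' Hd'].
      exists d'; intros v Hv; apply HU; apply Hd'; [|exact Hv].
      rewrite Rminus_diag, Rabs_R0; apply cond_pos.
Qed.

(** * The integrand on the lines of slope 1 *)

(** This is 2 i sin (PI x), whose squared modulus is 4 sinh^2 (PI Im x) + 4 sin^2 (PI Re x). *)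
Definition Rden (x : C) : C := (Cexp (PI * Ci * x) - Cexp (- (PI * Ci * x)))%C.

Lemma Re_slope1_line (c u : R) : Re (slope1_line c u) = c + u.
Proof. unfold slope1_line; simpl; ring. Qed.

Lemma Im_slope1_line (c u : R) : Im (slope1_line c u) = u.
Proof. unfold slope1_line; simpl; ring. Qed.

Lemma Cmod_sqr_eq (z : C) (a b : R) : Re z = a -> Im z = b -> Cmod z ^ 2 = a ^ 2 + b ^ 2.
Proof. intros <- <-; apply Cmod2_alt. Qed.

Lemma Cmod_den_sqr (x : C) :
  Cmod (Rden x) ^ 2 = (exp (PI * Im x) - exp (- (PI * Im x))) ^ 2 + 4 * sin (PI * Re x) ^ 2.
Proof.
destruct x as [a b]; unfold Rden.
rewrite (Cmod_sqr_eq _ ((exp (- (PI * b)) - exp (PI * b)) * cos (PI * a))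
  ((exp (- (PI * b)) + exp (PI * b)) * sin (PI * a))).
- simpl Re; simpl Im.
  replace (((exp (- (PI * b)) - exp (PI * b)) * cos (PI * a)) ^ 2 +
    ((exp (- (PI * b)) + exp (PI * b)) * sin (PI * a)) ^ 2)
  with ((exp (- (PI * b)) - exp (PI * b)) ^ 2 * ((sin (PI * a))² + (cos (PI * a))²)
    + 4 * (exp (PI * b) * exp (- (PI * b))) * sin (PI * a) ^ 2) by (unfold Rsqr; ring).
  rewrite sin2_cos2, <- exp_plus, Rplus_opp_r, exp_0; ring.
- simpl.
  replace ((PI * 0 - 0 * 1) * a - (PI * 1 + 0 * 0) * b) with (- (PI * b)) by ring.
  replace ((PI * 0 - 0 * 1) * b + (PI * 1 + 0 * 0) * a) with (PI * a) by ring.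
  rewrite Ropp_involutive, cos_neg; ring.
- simpl.
  replace ((PI * 0 - 0 * 1) * a - (PI * 1 + 0 * 0) * b) with (- (PI * b)) by ring.
  replace ((PI * 0 - 0 * 1) * b + (PI * 1 + 0 * 0) * a) with (PI * a) by ring.
  rewrite Ropp_involutive, sin_neg; ring.
Qed.

Lemma sinh_ge (y : R) : 0 <= y -> 2 * y <= exp y - exp (- y).
Proof.
intros [Hy| <-]; [|rewrite Ropp_0, exp_0; lra].
destruct (MVT_gen (fun y => exp y - exp (- y)) 0 y (fun y => exp y + exp (- y))) as [c [_ E]].
- intros u _; auto_derive; [trivial | ring].
- intros u _; apply continuity_pt_filterlim, (ex_derive_continuous (V := R_NormedModule) (fun y => exp y - exp (- y)) u); auto_derive; trivial.
- cbv beta in E; rewrite Ropp_0, exp_0 in E.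
  assert (2 <= exp c + exp (- c)); [|nra].
  assert (P : exp c * exp (- c) = 1) by (rewrite <- exp_plus, Rplus_opp_r; apply exp_0).
  generalize (exp_pos c) (exp_pos (- c)) (pow2_ge_0 (exp c - exp (- c))); nra.
Qed.

Lemma Cmod_den_ge_Im (x : C) : 2 * PI * Rabs (Im x) <= Cmod (Rden x).
Proof.
assert (HP := PI_RGT_0).
apply Rsqr_incr_0_var; [|apply Cmod_ge_0].
rewrite !Rsqr_pow2, Cmod_den_sqr.
assert (S := sinh_ge (PI * Rabs (Im x)) ltac:(generalize (Rabs_pos (Im x)); nra)).
assert (E : (exp (PI * Im x) - exp (- (PI * Im x))) ^ 2 =
  (exp (PI * Rabs (Im x)) - exp (- (PI * Rabs (Im x)))) ^ 2).
{ unfold Rabs; destruct Rcase_abs; [|reflexivity].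
  replace (PI * - Im x) with (- (PI * Im x)) by ring; rewrite Ropp_involutive; ring. }
rewrite E.
assert (Q : 0 <= 2 * (PI * Rabs (Im x))) by (generalize (Rabs_pos (Im x)); nra).
assert (T := pow_incr _ _ 2 (conj Q S)).
replace (2 * PI * Rabs (Im x)) with (2 * (PI * Rabs (Im x))) by ring.
generalize (pow2_ge_0 (sin (PI * Re x))); lra.
Qed.

Lemma Cmod_den_ge_sin (x : C) : 2 * Rabs (sin (PI * Re x)) <= Cmod (Rden x).
Proof.
apply Rsqr_incr_0_var; [|apply Cmod_ge_0].
rewrite !Rsqr_pow2, Cmod_den_sqr.
replace ((2 * Rabs (sin (PI * Re x))) ^ 2) with (4 * Rabs (sin (PI * Re x)) ^ 2) by ring.
rewrite pow2_abs; generalize (pow2_ge_0 (exp (PI * Im x) - exp (- (PI * Im x)))); lra.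
Qed.

Lemma sin_PI_mult_neq_0 (n : nat) (c : R) : INR n < c < INR n + 1 -> sin (PI * c) <> 0.
Proof.
intros Hc H; assert (HP := PI_RGT_0).
apply sin_eq_0_0 in H; destruct H as [k Hk].
assert (E : c = IZR k) by (apply Rmult_eq_reg_l with PI; lra).
rewrite INR_IZR_INZ, E in Hc; rewrite <- plus_IZR in Hc.
destruct Hc as [H1 H2]; apply lt_IZR in H1; apply lt_IZR in H2; lia.
Qed.

Lemma den_neq_0_Im (x : C) : Im x <> 0 -> Rden x <> 0.
Proof.
intros H; apply Cmod_gt_0; eapply Rlt_le_trans; [|apply Cmod_den_ge_Im].
generalize PI_RGT_0 (Rabs_pos_lt _ H); intros; nra.
Qed.

Lemma den_neq_0_Re (x : C) : sin (PI * Re x) <> 0 -> Rden x <> 0.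
Proof.
intros H; apply Cmod_gt_0; eapply Rlt_le_trans; [|apply Cmod_den_ge_sin].
generalize (Rabs_pos_lt _ H); lra.
Qed.

Lemma den_line_neq_0 (n : nat) (c u : R) : INR n < c < INR n + 1 -> Rden (slope1_line c u) <> 0.
Proof.
intros Hc; destruct (Req_dec u 0) as [->|Hu].
- apply den_neq_0_Re; rewrite Re_slope1_line, Rplus_0_r; apply (sin_PI_mult_neq_0 n); exact Hc.
- apply den_neq_0_Im; rewrite Im_slope1_line; exact Hu.
Qed.

Lemma slit_line (c u : R) : 0 < c -> slit (slope1_line c u).
Proof.
intros Hc; destruct (Req_dec u 0) as [->|Hu].
- apply slit_right_half; rewrite Re_slope1_line; lra.
- apply slit_Im; rewrite Im_slope1_line; exact Hu.
Qed.

Definition Rnum (s x : C) : C := (Cpower x (- s) * Cexp (PI * Ci * (x * x)))%C.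

Lemma Raux_integrand_eq (s x : C) : Raux_integrand s x = (Rnum s x * / Rden x)%C.
Proof. reflexivity. Qed.

Definition dRnum (s x : C) : C := (Rnum s x * (- s * / x + PI * Ci * (x + x)))%C.
Definition dRden (x : C) : C := (PI * Ci * (Cexp (PI * Ci * x) + Cexp (- (PI * Ci * x))))%C.
Definition dRaux_integrand (s x : C) : C :=
  (dRnum s x * / Rden x + Rnum s x * (- dRden x * / (Rden x * Rden x)))%C.

Lemma holo_den (x : C) : holo Rden x (dRden x).
Proof.
assert (H : forall k : C, holo (fun y => Cexp (k * y)) x (Cexp (k * x) * k)).
{ intros k; apply (holo_comp Cexp (fun y => (k * y)%C)); [apply holo_Cexp|].
  eapply holo_eq; [apply holo_scal, holo_id | ring]. }
unfold Rden, dRden; eapply holo_eq.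
- apply holo_minus; [apply H|].
  apply holo_ext_loc with (fun y => Cexp (- (PI * Ci) * y)); [|apply H].
  exists 1; split; [lra|]; intros; f_equal; ring.
- replace (- (PI * Ci) * x)%C with (- (PI * Ci * x))%C by ring; ring.
Qed.

Lemma holo_dden (x : C) : exists l, holo dRden x l.
Proof.
assert (H : forall k : C, holo (fun y => Cexp (k * y)) x (Cexp (k * x) * k)).
{ intros k; apply (holo_comp Cexp (fun y => (k * y)%C)); [apply holo_Cexp|].
  eapply holo_eq; [apply holo_scal, holo_id | ring]. }
eexists; unfold dRden; apply holo_scal, holo_plus; [apply H|].
apply holo_ext_loc with (fun y => Cexp (- (PI * Ci) * y)); [|apply H].
exists 1; split; [lra|]; intros; f_equal; ring.
Qed.

Lemma holo_num (s x : C) : slit x -> holo (Rnum s) x (dRnum s x).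
Proof.
intros Hx; unfold Rnum, dRnum, Cpower; eapply holo_eq.
- apply (holo_mult (fun y => Cexp (- s * Clog y)) (fun y => Cexp (PI * Ci * (y * y)))).
  + apply (holo_comp Cexp (fun y => (- s * Clog y)%C)); [apply holo_Cexp|].
    apply holo_scal, holo_Clog; exact Hx.
  + apply (holo_comp Cexp (fun y => (PI * Ci * (y * y))%C)); [apply holo_Cexp|].
    apply holo_scal, holo_mult; apply holo_id.
- unfold Rnum, Cpower; ring.
Qed.

Lemma holo_dnum (s x : C) : slit x -> exists l, holo (dRnum s) x l.
Proof.
intros Hx; eexists; unfold dRnum; apply holo_mult; [apply holo_num; exact Hx|].
apply holo_plus.
- apply holo_scal, holo_Cinv; exact (proj1 Hx).
- apply holo_scal, holo_plus; apply holo_id.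
Qed.

Lemma holo_Raux_integrand (s x : C) : slit x -> Rden x <> 0 ->
  holo (Raux_integrand s) x (dRaux_integrand s x).
Proof.
intros Hx Hd; unfold dRaux_integrand; eapply holo_eq.
- apply (holo_mult (Rnum s) (fun y => (/ Rden y)%C)); [apply holo_num; exact Hx|].
  apply holo_inv; [exact Hd | apply holo_den].
- reflexivity.
Qed.

(** A second derivative serves to make the first one continuous, as differentiation under the
    integral sign requires. *)
Lemma holo_dRaux_integrand (s x : C) : slit x -> Rden x <> 0 ->
  exists l, holo (dRaux_integrand s) x l.
Proof.
intros Hx Hd; destruct (holo_dnum s x Hx) as [l1 H1]; destruct (holo_dden x) as [l2 H2].
eexists; unfold dRaux_integrand; apply holo_plus.
- apply holo_mult; [exact H1 | apply holo_inv; [exact Hd | apply holo_den]].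
- apply holo_mult; [apply holo_num; exact Hx|].
  apply holo_mult.
  + apply holo_ext_loc with (fun y => ((- (1)) * dRden y)%C).
    * exists 1; split; [lra|]; intros; ring.
    * apply holo_scal; exact H2.
  + apply holo_inv; [apply Cmult_neq_0; exact Hd | apply holo_mult; apply holo_den].
Qed.

(* [k] selects a real coordinate: [k = 1] gives the real part, [k = - Ci] the imaginary part. *)
Definition Gline (k s : C) (c u : R) : R :=
  Re (k * (Raux_integrand s (slope1_line c u) * (1 + Ci)))%C.

Lemma Cmod_line_sub (c u c' u' : R) :
  Cmod (slope1_line c' u' - slope1_line c u) <= Rabs (c' - c) + 2 * Rabs (u' - u).
Proof.
eapply Rle_trans; [apply Cmod_le_sum|].
replace (Re (slope1_line c' u' - slope1_line c u)) with ((c' - c) + (u' - u))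
  by (unfold slope1_line; simpl; ring).
replace (Im (slope1_line c' u' - slope1_line c u)) with (u' - u)
  by (unfold slope1_line; simpl; ring).
generalize (Rabs_triang (c' - c) (u' - u)); lra.
Qed.

Lemma continuity_2d_line (g : C -> C) (k l : C) (c u : R) : holo g (slope1_line c u) l ->
  continuity_2d_pt (fun c u => Re (k * g (slope1_line c u))%C) c u.
Proof.
intros H eps.
set (M := Cmod k + 1); assert (HM : 0 < M) by (unfold M; generalize (Cmod_ge_0 k); lra).
destruct (holo_cont g _ l H (eps / M)) as [d [Hd Q]].
{ apply Rdiv_lt_0_compat; [apply cond_pos | exact HM]. }
assert (Hd3 : 0 < d / 3) by lra.
exists (mkposreal _ Hd3); intros c' u' Hc Hu; simpl in Hc, Hu.
assert (B := Q (slope1_line c' u') ltac:(eapply Rle_lt_trans; [apply Cmod_line_sub | lra])).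
replace (Re (k * g (slope1_line c' u')) - Re (k * g (slope1_line c u)))
  with (Re (k * (g (slope1_line c' u') - g (slope1_line c u)))%C) by (simpl; ring).
eapply Rle_lt_trans; [apply re_le_Cmod|]; rewrite Cmod_mult.
replace (pos eps) with (M * (eps / M)) by (field; lra).
assert (Cmod k < M) by (unfold M; lra).
generalize (Cmod_ge_0 k) (Cmod_ge_0 (g (slope1_line c' u') - g (slope1_line c u))); intros; nra.
Qed.

Lemma is_derive_line_c (g : C -> C) (k l : C) (c u : R) : holo g (slope1_line c u) l ->
  is_derive (fun c => Re (k * g (slope1_line c u))%C) c (Re (k * l)).
Proof.
intros H.
assert (E : slope1_line c u = ((1 + Ci) * u + 1 * c)%C) by (unfold slope1_line; ring).
rewrite E in H.
assert (Q := proj1 (holo_line (fun y => (k * g y)%C) _ 1 (k * l) c (holo_scal _ k _ _ H))).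
replace (k * l)%C with (k * l * 1)%C by ring.
eapply is_derive_ext; [|exact Q]; intros t; simpl.
replace (slope1_line t u) with ((1 + Ci) * u + 1 * t)%C by (unfold slope1_line; ring); reflexivity.
Qed.

Lemma is_derive_line_u (g : C -> C) (k l : C) (c u : R) : holo g (slope1_line c u) l ->
  is_derive (fun u => Re (k * g (slope1_line c u))%C) u (Re (k * (l * (1 + Ci)))).
Proof.
intros H.
assert (Q := proj1 (holo_line (fun y => (k * g y)%C) _ (1 + Ci) (k * l) u (holo_scal _ k _ _ H))).
replace (k * (l * (1 + Ci)))%C with (k * l * (1 + Ci))%C by ring; exact Q.
Qed.

Lemma Gline_continuous (k s : C) (c u : R) : 0 < c -> Rden (slope1_line c u) <> 0 ->
  continuous (Gline k s c) u.
Proof.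
intros Hc Hd; apply (ex_derive_continuous (V := R_NormedModule)); unfold Gline.
eexists; eapply is_derive_ext;
  [|apply (is_derive_line_u (Raux_integrand s) (k * (1 + Ci)) _ c u (holo_Raux_integrand s _ (slit_line c u Hc) Hd))].
intros t; simpl; ring.
Qed.

(** With x = c + (1 + i) u and f the integrand, the c-derivative of (1 + i) f (x) is (1 + i) f' (x),
    which is also the u-derivative of f (x). The integral of the derivative therefore reduces to end
    values of f. *)
Lemma is_derive_RInt_Gline (k s : C) (a b c d : R) : a <= b -> 0 < d ->
  (forall y, Rabs (y - c) < d -> 0 < y /\ forall u, a <= u <= b -> Rden (slope1_line y u) <> 0) ->
  is_derive (fun y => RInt (Gline k s y) a b) c
    (Re (k * Raux_integrand s (slope1_line c b))%C - Re (k * Raux_integrand s (slope1_line c a))%C).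
Proof.
intros Hab Hd H.
assert (H0 : Rabs (c - c) < d) by (rewrite Rminus_diag, Rabs_R0; exact Hd).
assert (Eq : forall y u, Gline k s y u = Re (k * (1 + Ci) * Raux_integrand s (slope1_line y u))%C)
  by (intros y u; unfold Gline; f_equal; ring).
apply (is_derive_RInt_exact (Gline k s)
  (fun y u => Re (k * Raux_integrand s (slope1_line y u))%C)
  (fun y u => Re (k * (1 + Ci) * dRaux_integrand s (slope1_line y u))%C) a b c Hab).
- exists d; split; [exact Hd|]; intros y Hy t Ht; destruct (H y Hy) as [H1 H2].
  eapply is_derive_ext; [intros z; symmetry; apply Eq|].
  apply is_derive_line_c, holo_Raux_integrand; [apply slit_line; exact H1 | apply H2; exact Ht].
- intros t Ht; destruct (H c H0) as [H1 H2].
  replace (k * (1 + Ci) * dRaux_integrand s (slope1_line c t))%C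
    with (k * (dRaux_integrand s (slope1_line c t) * (1 + Ci)))%C by ring.
  apply is_derive_line_u, holo_Raux_integrand; [apply slit_line; exact H1 | apply H2; exact Ht].
- intros t Ht; destruct (H c H0) as [H1 H2].
  destruct (holo_dRaux_integrand s (slope1_line c t)) as [l Hl];
    [apply slit_line; exact H1 | apply H2; exact Ht|].
  eapply continuity_2d_line; exact Hl.
- exists (mkposreal d Hd); intros y Hy; destruct (H y Hy) as [H1 H2].
  apply (ex_RInt_continuous (V := R_CompleteNormedModule)); intros t Ht.
  rewrite Rmin_left, Rmax_right in Ht by exact Hab.
  apply Gline_continuous; [exact H1 | apply H2; exact Ht].
Qed.

(** * Shifting the contour *)

Lemma PI_bounds : 3 < PI <= 4.
Proof. generalize PI2_3_2 PI_4; lra. Qed.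

Lemma Cmod_line_bounds (c u : R) : 0 < c -> c / 2 <= Cmod (slope1_line c u) <= c + 2 * Rabs u.
Proof.
intros Hc.
assert (B1 := re_le_Cmod (slope1_line c u)); assert (B2 := im_le_Cmod (slope1_line c u)).
assert (B3 := Cmod_le_sum (slope1_line c u)).
rewrite Re_slope1_line in *; rewrite Im_slope1_line in *.
assert (T := Rabs_triang c u); rewrite (Rabs_pos_eq c) in T by lra.
assert (T2 := Rle_abs (c + u)); assert (T3 := Rle_abs (- u)); rewrite Rabs_Ropp in T3.
split; lra.
Qed.

Lemma Rabs_Carg_le (z : C) : z <> 0 -> Rabs (Carg z) <= 4.
Proof. intros H; apply Rabs_le; generalize (Carg_bounds z H) PI_bounds; lra. Qed.

Lemma Cmod_Clog_line_le (c u : R) : 0 < c -> Cmod (Clog (slope1_line c u)) <= c + 2 * Rabs u + 2 / c + 4.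
Proof.
intros Hc; assert (B := Cmod_line_bounds c u Hc).
assert (Hz : slope1_line c u <> 0) by (apply Cmod_gt_0; lra).
eapply Rle_trans; [apply Cmod_le_sum|]; simpl.
assert (A1 := Rabs_Carg_le _ Hz).
set (r := Cmod (slope1_line c u)) in *.
assert (Hr : 0 < r) by lra.
assert (L1 := ln_le_sub_1 r Hr).
assert (L2 := ln_le_sub_1 (/ r) (Rinv_0_lt_compat _ Hr)); rewrite ln_Rinv in L2 by exact Hr.
assert (I : / r <= 2 / c).
{ replace (2 / c) with (/ (c / 2)) by (field; lra); apply Rinv_le_contravar; lra. }
assert (0 < / r) by (apply Rinv_0_lt_compat; exact Hr).
assert (Rabs (ln r) <= c + 2 * Rabs u + 2 / c) by (apply Rabs_le; generalize (Rabs_pos u); lra).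
lra.
Qed.

Lemma exp_le_compat (x y : R) : x <= y -> exp x <= exp y.
Proof. intros [H| ->]; [left; apply exp_increasing; exact H | lra]. Qed.

(** |log x| grows at most linearly along the line, so the Gaussian beats exp (S |log x|) for every
    S, uniformly for c in a compact interval. *)
Lemma line_decay (c1 c2 S : R) : 0 < c1 -> c1 <= c2 -> 0 <= S -> exists K, 0 < K /\
  forall c u, c1 <= c <= c2 ->
  exp (S * Cmod (Clog (slope1_line c u))) * exp (- (2 * PI * (c + u) * u)) <= K * exp (- Rabs u).
Proof.
intros H1 H12 HS.
(* The coefficients of |u|: 2 S from the logarithm, 8 c2 from 2 PI c u with PI <= 4, and 1 for the
   target exp (- |u|). Then m |u| - 6 u^2 <= m^2. *)
set (m := 2 * S + 8 * c2 + 1).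
exists (exp (S * (c2 + 2 / c1 + 4) + m ^ 2)); split; [apply exp_pos|]; intros c u Hc.
rewrite <- !exp_plus; apply exp_le_compat.
assert (L := Cmod_Clog_line_le c u ltac:(lra)).
assert (I : 2 / c <= 2 / c1).
{ unfold Rdiv; apply Rmult_le_compat_l; [lra|]; apply Rinv_le_contravar; lra. }
assert (HL : S * Cmod (Clog (slope1_line c u)) <= S * (c2 + 2 / c1 + 4) + 2 * S * Rabs u).
{ replace (S * (c2 + 2 / c1 + 4) + 2 * S * Rabs u) with (S * (c2 + 2 * Rabs u + 2 / c1 + 4)) by ring.
  apply Rmult_le_compat_l; [exact HS | lra]. }
assert (HP := PI_bounds).
assert (Hu : - (2 * PI * (c + u) * u) <= 8 * c2 * Rabs u - 6 * Rabs u ^ 2).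
{ rewrite pow2_abs.
  assert (T : - (c * u) <= c2 * Rabs u).
  { assert (T3 := Rle_abs (- u)); rewrite Rabs_Ropp in T3; generalize (Rabs_pos u); nra. }
  assert (0 <= c2 * Rabs u) by (generalize (Rabs_pos u); nra).
  assert (0 <= u ^ 2) by apply pow2_ge_0.
  nra. }
assert (m * Rabs u - 6 * Rabs u ^ 2 <= m ^ 2).
{ generalize (pow2_ge_0 (m - Rabs u)); assert (0 <= m) by (unfold m; nra); generalize (Rabs_pos u); nra. }
unfold m in *; lra.
Qed.

Lemma Cmod_Cpower_le (x s : C) : Cmod (Cpower x (- s)) <= exp (Cmod s * Cmod (Clog x)).
Proof.
unfold Cpower; rewrite Cmod_Cexp; apply exp_le_compat.
eapply Rle_trans; [apply Re_le_Cmod|]; rewrite Cmod_mult, Cmod_opp; apply Rle_refl.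
Qed.

Lemma Cmod_gauss_line (c u : R) :
  Cmod (Cexp (PI * Ci * (slope1_line c u * slope1_line c u))) = exp (- (2 * PI * (c + u) * u)).
Proof. rewrite Cmod_Cexp; f_equal; unfold slope1_line; simpl; ring. Qed.

Lemma num_decay (s : C) (c1 c2 : R) : 0 < c1 -> c1 <= c2 -> exists K, 0 < K /\
  forall c u, c1 <= c <= c2 -> Cmod (Rnum s (slope1_line c u)) <= K * exp (- Rabs u).
Proof.
intros H1 H12; destruct (line_decay c1 c2 (Cmod s) H1 H12 (Cmod_ge_0 s)) as [K [HK H]].
exists K; split; [exact HK|]; intros c u Hc.
eapply Rle_trans; [|apply H; exact Hc]; unfold Rnum.
rewrite Cmod_mult, Cmod_gauss_line; apply Rmult_le_compat_r; [left; apply exp_pos | apply Cmod_Cpower_le].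
Qed.

Lemma Cmod_Raux_integrand (s x : C) : Rden x <> 0 ->
  Cmod (Raux_integrand s x) = Cmod (Rnum s x) / Cmod (Rden x).
Proof. intros H; rewrite Raux_integrand_eq, Cmod_mult, Cmod_inv by exact H; reflexivity. Qed.

(** Uniform in c even when the range contains integers: the factor 1 / |u| accounts for a pole met
    at u = 0. *)
Lemma Raux_integrand_far (s : C) (c1 c2 : R) : 0 < c1 -> c1 <= c2 -> exists K, 0 < K /\
  forall c u, c1 <= c <= c2 -> u <> 0 ->
  Cmod (Raux_integrand s (slope1_line c u)) <= K * exp (- Rabs u) / Rabs u.
Proof.
intros H1 H12; destruct (num_decay s c1 c2 H1 H12) as [K [HK H]].
exists K; split; [exact HK|]; intros c u Hc Hu.
assert (Hd := den_neq_0_Im (slope1_line c u) ltac:(rewrite Im_slope1_line; exact Hu)).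
assert (D := Cmod_den_ge_Im (slope1_line c u)); rewrite Im_slope1_line in D.
assert (Hp := Rabs_pos_lt u Hu); assert (HP := PI_bounds).
rewrite Cmod_Raux_integrand by exact Hd.
apply Rmult_le_compat; [apply Cmod_ge_0 | | apply H; exact Hc|].
- left; apply Rinv_0_lt_compat; nra.
- apply Rinv_le_contravar; nra.
Qed.

(** Compactness for |u| <= 1, where the line misses the zeros; beyond, the sinh term alone is large
    enough. *)
Lemma den_line_lower (n : nat) (c : R) : INR n < c < INR n + 1 -> exists m, 0 < m /\
  forall u, m <= Cmod (Rden (slope1_line c u)).
Proof.
intros Hc.
set (q := fun u => (exp (PI * u) - exp (- (PI * u))) ^ 2 + 4 * sin (PI * (c + u)) ^ 2).
assert (Eq : forall u, Cmod (Rden (slope1_line c u)) ^ 2 = q u).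
{ intros u; rewrite Cmod_den_sqr, Re_slope1_line, Im_slope1_line; reflexivity. }
destruct (continuity_ab_min q (-1) 1) as [u0 [Hmin _]]; [lra| |].
{ intros u _; apply continuity_pt_filterlim, (ex_derive_continuous (V := R_NormedModule) q u).
  unfold q; auto_derive; trivial. }
set (d0 := Cmod (Rden (slope1_line c u0))).
assert (Hd0 : 0 < d0) by (apply Cmod_gt_0, (den_line_neq_0 n); exact Hc).
exists (Rmin 1 d0); split; [apply Rmin_pos; lra|]; intros u.
destruct (Rle_lt_dec (Rabs u) 1) as [Hu|Hu].
- eapply Rle_trans; [apply Rmin_r|].
  apply Rsqr_incr_0_var; [|apply Cmod_ge_0]; rewrite !Rsqr_pow2; unfold d0; rewrite !Eq.
  apply Hmin; apply Rabs_le_between; exact Hu.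
- eapply Rle_trans; [apply Rmin_l|].
  assert (D := Cmod_den_ge_Im (slope1_line c u)); rewrite Im_slope1_line in D.
  generalize PI_bounds; nra.
Qed.

Lemma Cmod_1_Ci : Cmod (1 + Ci) <= 2.
Proof. eapply Rle_trans; [apply Cmod_triangle|]; rewrite Cmod_1, Cmod_Ci; lra. Qed.

Lemma Gline_le (k s : C) (c u : R) :
  Rabs (Gline k s c u) <= Cmod k * (2 * Cmod (Raux_integrand s (slope1_line c u))).
Proof.
eapply Rle_trans; [apply re_le_Cmod|]; rewrite !Cmod_mult.
apply Rmult_le_compat_l; [apply Cmod_ge_0|].
generalize Cmod_1_Ci (Cmod_ge_0 (Raux_integrand s (slope1_line c u))); nra.
Qed.

Lemma INR_lt_pos (n : nat) (c : R) : INR n < c -> 0 < c.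
Proof. generalize (pos_INR n); lra. Qed.

Lemma Edec_Gline (k s : C) (n : nat) (c : R) : INR n < c < INR n + 1 -> exists K, Edec K (Gline k s c).
Proof.
intros Hc; assert (H0 := INR_lt_pos n c (proj1 Hc)).
destruct (num_decay s c c H0 (Rle_refl _)) as [K [HK H]].
destruct (den_line_lower n c Hc) as [m [Hm D]].
exists (Cmod k * (2 * (K / m))); split; intros u.
- apply Gline_continuous; [exact H0 | apply (den_line_neq_0 n); exact Hc].
- eapply Rle_trans; [apply Gline_le|].
  rewrite !Rmult_assoc; apply Rmult_le_compat_l; [apply Cmod_ge_0|]; apply Rmult_le_compat_l; [lra|].
  rewrite Cmod_Raux_integrand by (apply (den_line_neq_0 n); exact Hc).
  replace (K / m * exp (- Rabs u)) with (K * exp (- Rabs u) / m) by (field; lra).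
  apply Rmult_le_compat; [apply Cmod_ge_0 | | apply H; lra | apply Rinv_le_contravar; auto].
  left; apply Rinv_0_lt_compat; apply Rlt_le_trans with m; auto.
Qed.

(** The minus signs come from the orientation of the contour, from +oo down to -oo, whereas [II]
    integrates upwards. *)
Lemma Raux_II (c : R) (s : C) : 0 < c < 1 ->
  Raux c s = (- II (Gline 1 s c), - II (Gline (- Ci) s c)).
Proof.
intros Hc.
assert (Hc' : INR 0 < c < INR 0 + 1) by (simpl; lra).
destruct (Edec_Gline 1 s 0 c Hc') as [K1 E1]; destruct (Edec_Gline (- Ci) s 0 c Hc') as [K2 E2].
unfold Raux; apply (is_RInt_gen_unique (V := C_R_CompleteNormedModule)); intros P [eps HP].
assert (HK1 := Edec_K_pos _ _ E1); assert (HK2 := Edec_K_pos _ _ E2).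
destruct (exp_neg_small (eps / (2 * (K1 + K2 + 1)))) as [A [HA Q]].
{ apply Rdiv_lt_0_compat; [apply cond_pos | lra]. }
apply (Filter_prod _ _ _ (fun a => A < a) (fun b => b < - A)).
{ exists A; auto. }
{ exists (- A); auto. }
intros a b Ha Hb.
exists (- RInt (Gline 1 s c) b a, - RInt (Gline (- Ci) s c) b a); split.
- apply (is_RInt_fct_extend_pair (U := R_NormedModule) (V := R_NormedModule)); simpl fst; simpl snd.
  + apply is_RInt_ext with (Gline 1 s c).
    { intros u _; unfold Gline; simpl; ring. }
    apply (is_RInt_swap (V := R_NormedModule)), (RInt_correct (V := R_CompleteNormedModule)).
    eapply Edec_ex_RInt; exact E1.
  + apply is_RInt_ext with (Gline (- Ci) s c).
    { intros u _; unfold Gline; simpl; ring. }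
    apply (is_RInt_swap (V := R_NormedModule)), (RInt_correct (V := R_CompleteNormedModule)).
    eapply Edec_ex_RInt; exact E2.
- apply HP.
  assert (X : forall K g, 0 <= K <= K1 + K2 -> Edec K g -> Rabs (- RInt g b a - - II g) < eps).
  { intros K g HK Hg.
    assert (T := II_approx K g (- b) a Hg ltac:(lra) ltac:(lra)); rewrite Ropp_involutive in T.
    replace (- RInt g b a - - II g) with (II g - RInt g b a) by ring.
    eapply Rle_lt_trans; [exact T|].
    assert (Q1 := Q (- b) ltac:(lra)); assert (Q2 := Q a ltac:(lra)).
    assert (E : pos eps = (K1 + K2 + 1) * (eps / (2 * (K1 + K2 + 1)) + eps / (2 * (K1 + K2 + 1)))) by (field; lra).
    rewrite Ropp_involutive in Q1; generalize (exp_pos b) (exp_pos (- a)); intros; rewrite E.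
    apply Rle_lt_trans with ((K1 + K2 + 1) * (exp b + exp (- a)));
      [apply Rmult_le_compat_r; lra | apply Rmult_lt_compat_l; lra]. }
  split; simpl; [apply (X K1) | apply (X K2)]; auto; lra.
Qed.

Definition Iline (k s : C) (c : R) : R := II (Gline k s c).

Lemma Re_Raux (k s : C) (c : R) : 0 < c < 1 -> Re (k * Raux c s)%C = - Iline k s c.
Proof.
intros Hc; rewrite Raux_II by exact Hc.
assert (Hc' : INR 0 < c < INR 0 + 1) by (simpl; lra).
destruct (Edec_Gline 1 s 0 c Hc') as [K1 E1]; destruct (Edec_Gline (- Ci) s 0 c Hc') as [K2 E2].
unfold Iline; rewrite (II_ext (Gline k s c) (fun u => Re k * Gline 1 s c u + (- Im k) * Gline (- Ci) s c u)).
- rewrite (II_lin K1 K2) by assumption; simpl; unfold Re, Im; ring.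
- intros u; unfold Gline; simpl; unfold Re, Im; ring.
Qed.

(** * Moving the line between two poles *)

Lemma RInt_Gline_sub_le (k s : C) (a b c1 c2 M : R) : a <= b -> c1 < c2 ->
  (exists d, 0 < d /\ forall y u, c1 - d < y < c2 + d -> a <= u <= b -> 0 < y /\ Rden (slope1_line y u) <> 0) ->
  (forall y, c1 <= y <= c2 -> Cmod (Raux_integrand s (slope1_line y b)) <= M /\
     Cmod (Raux_integrand s (slope1_line y a)) <= M) ->
  Rabs (RInt (Gline k s c2) a b - RInt (Gline k s c1) a b) <= Cmod k * (2 * M) * (c2 - c1).
Proof.
intros Hab Hc [d [Hd Hreg]] HM.
(* The mean value theorem in the abscissa y stands in for Cauchy's theorem on a parallelogram: only
   its two horizontal sides contribute. *)
set (df := fun y => Re (k * Raux_integrand s (slope1_line y b))%C - Re (k * Raux_integrand s (slope1_line y a))%C).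
assert (Hder : forall y, c1 <= y <= c2 -> is_derive (fun y => RInt (Gline k s y) a b) y (df y)).
{ intros y Hy; apply (is_derive_RInt_Gline k s a b y d Hab Hd); intros z Hz.
  apply Rabs_lt_between in Hz; split.
  - apply (Hreg z a); lra.
  - intros u Hu; apply (Hreg z u); lra. }
destruct (MVT_gen (fun y => RInt (Gline k s y) a b) c1 c2 df) as [y [Hy E]].
- intros y Hy; rewrite Rmin_left, Rmax_right in Hy by lra; apply Hder; lra.
- intros y Hy; rewrite Rmin_left, Rmax_right in Hy by lra.
  apply continuity_pt_filterlim, (ex_derive_continuous (V := R_NormedModule) (fun y => RInt (Gline k s y) a b) y).
  eexists; apply Hder; exact Hy.
- rewrite Rmin_left, Rmax_right in Hy by lra; cbv beta in E; rewrite E.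
  rewrite Rabs_mult, (Rabs_pos_eq (c2 - c1)) by lra.
  apply Rmult_le_compat_r; [lra|]; unfold df.
  destruct (HM y Hy) as [M1 M2].
  assert (T1 := re_le_Cmod (k * Raux_integrand s (slope1_line y b))).
  assert (T2 := re_le_Cmod (k * Raux_integrand s (slope1_line y a))).
  rewrite Cmod_mult in T1, T2; assert (Hk := Cmod_ge_0 k).
  unfold Rminus; eapply Rle_trans; [apply Rabs_triang|]; rewrite Rabs_Ropp; nra.
Qed.

Lemma Iline_shift (k s : C) (n : nat) (c1 c2 : R) : INR n < c1 -> c1 < c2 -> c2 < INR n + 1 ->
  Iline k s c1 = Iline k s c2.
Proof.
intros H1 H12 H2; assert (H0 := INR_lt_pos n c1 H1).
destruct (Edec_Gline k s n c1 ltac:(lra)) as [K1 E1]; destruct (Edec_Gline k s n c2 ltac:(lra)) as [K2 E2].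
destruct (Raux_integrand_far s c1 c2 H0 ltac:(lra)) as [K [HK F]].
apply (Rabs_small_eq _ _ (2 * K1 + 2 * K2 + Cmod k * (2 * K) * (c2 - c1))); intros a Ha.
(* Cutting at a + 1 rather than a makes |u| >= 1 on the horizontal sides, where 1 / |u| is then at
   most 1. *)
assert (A1 := II_approx K1 _ (a + 1) (a + 1) E1 ltac:(lra) ltac:(lra)).
assert (A2 := II_approx K2 _ (a + 1) (a + 1) E2 ltac:(lra) ltac:(lra)).
fold (Iline k s c1) in A1; fold (Iline k s c2) in A2.
assert (Hexp : exp (- (a + 1)) <= exp (- a)) by (apply exp_le_compat; lra).
assert (D := RInt_Gline_sub_le k s (- (a + 1)) (a + 1) c1 c2 (K * exp (- a)) ltac:(lra) H12).
assert (B : Rabs (RInt (Gline k s c2) (- (a + 1)) (a + 1) - RInt (Gline k s c1) (- (a + 1)) (a + 1))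
  <= Cmod k * (2 * (K * exp (- a))) * (c2 - c1)).
{ apply D.
  - exists (Rmin (c1 - INR n) (INR n + 1 - c2)); split; [apply Rmin_pos; lra|].
    intros y u Hy _; generalize (Rmin_l (c1 - INR n) (INR n + 1 - c2)) (Rmin_r (c1 - INR n) (INR n + 1 - c2)).
    intros; assert (INR n < y < INR n + 1) by lra.
    split; [apply (INR_lt_pos n); lra | apply (den_line_neq_0 n); lra].
  - intros y Hy; assert (P : forall v, Rabs v = a + 1 ->
      Cmod (Raux_integrand s (slope1_line y v)) <= K * exp (- a)).
    { intros v Hv; assert (v <> 0) by (intros ->; rewrite Rabs_R0 in Hv; lra).
      eapply Rle_trans; [apply F; assumption|]; rewrite Hv.
      unfold Rdiv; rewrite Rmult_assoc; apply Rmult_le_compat_l; [lra|].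
      apply Rmult_le_reg_r with (a + 1); [lra|]; rewrite Rmult_assoc, Rinv_l by lra.
      generalize (exp_pos (- a)); nra. }
    split; apply P; [|rewrite Rabs_Ropp]; apply Rabs_pos_eq; lra. }
assert (Hk := Cmod_ge_0 k).
assert (HK1 := Edec_K_pos _ _ E1); assert (HK2 := Edec_K_pos _ _ E2).
set (R1 := RInt (Gline k s c1) (- (a + 1)) (a + 1)) in *.
set (R2 := RInt (Gline k s c2) (- (a + 1)) (a + 1)) in *.
replace (Iline k s c1 - Iline k s c2)
  with ((Iline k s c1 - R1) + - (R2 - R1) + - (Iline k s c2 - R2)) by ring.
eapply Rle_trans; [apply Rabs_triang|]; rewrite Rabs_Ropp.
eapply Rle_trans; [apply Rplus_le_compat_r, Rabs_triang|]; rewrite Rabs_Ropp.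
generalize (exp_pos (- (a + 1))); nra.
Qed.

(** * Crossing a pole *)

Lemma Cexp_2PI_nat (k : nat) : Cexp (PI * Ci * (2 * INR k))%C = 1%C.
Proof.
unfold Cexp; simpl.
replace ((PI * 0 - 0 * 1) * (2 * INR k - 0 * 0) - (PI * 1 + 0 * 0) * (2 * 0 + 0 * INR k)) with 0 by ring.
replace ((PI * 0 - 0 * 1) * (2 * 0 + 0 * INR k) + (PI * 1 + 0 * 0) * (2 * INR k - 0 * 0))
  with (0 + 2 * INR k * PI) by ring.
rewrite cos_period, sin_period, exp_0, cos_0, sin_0; apply C_eq; simpl; ring.
Qed.

Lemma Rden_shift (n : nat) (y : C) :
  Rden (INR n + y) = (Cexp (PI * Ci * INR n) * (Cexp (PI * Ci * y) - Cexp (- (PI * Ci * y))))%C.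
Proof.
unfold Rden.
replace (- (PI * Ci * (INR n + y)))%C with (PI * Ci * INR n + - (PI * Ci * y) + - (PI * Ci * (2 * INR n)))%C by ring.
replace (PI * Ci * (INR n + y))%C with (PI * Ci * INR n + PI * Ci * y)%C by ring.
rewrite !Cexp_plus, (Cexp_opp (PI * Ci * (2 * INR n))), Cexp_2PI_nat; field.
Qed.

(** n^2 and n have the same parity. So at x = n the Gaussian numerator cancels the sign (-1)^n of
    the denominator, and the residue is n^(-s) / (2 PI i). *)
Lemma Cexp_square_nat (n : nat) :
  Cexp (PI * Ci * (INR n * INR n)) = Cexp (PI * Ci * INR n).
Proof.
assert (H : exists k, (n * n = n + 2 * k)%nat).
{ induction n as [|n [k Hk]]; [exists 0%nat; reflexivity|].
  exists (k + n)%nat; lia. }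
destruct H as [k Hk].
replace (INR n * INR n)%C with (INR n + 2 * INR k)%C.
- replace (PI * Ci * (INR n + 2 * INR k))%C with (PI * Ci * INR n + PI * Ci * (2 * INR k))%C by ring.
  rewrite Cexp_plus, Cexp_2PI_nat; ring.
- rewrite <- !RtoC_mult, <- RtoC_plus; f_equal.
  apply (f_equal INR) in Hk; rewrite plus_INR, !mult_INR in Hk; simpl in Hk; lra.
Qed.

Lemma sinh_C_bounds (z : C) : Cmod z <= 1 / 6 ->
  Cmod (2 * z - (Cexp z - Cexp (- z))) <= 6 * Cmod z ^ 2 /\ Cmod z <= Cmod (Cexp z - Cexp (- z)).
Proof.
intros Hz; assert (H0 := Cmod_ge_0 z).
assert (E := exp_le_3_of (Cmod z) ltac:(lra)).
assert (B1 := Cexp_sub_1_sub_id_le z); assert (B2 := Cexp_sub_1_sub_id_le (- z)).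
rewrite Cmod_opp in B2.
assert (B : Cmod (2 * z - (Cexp z - Cexp (- z))) <= 6 * Cmod z ^ 2).
{ replace (2 * z - (Cexp z - Cexp (- z)))%C
    with ((Cexp (- z) - 1 - - z) - (Cexp z - 1 - z))%C by ring.
  eapply Rle_trans; [apply Cmod_triangle|]; rewrite Cmod_opp.
  generalize (pow2_ge_0 (Cmod z)); nra. }
split; [exact B|].
assert (T := Cmod_triang_rev (2 * z) (2 * z - (Cexp z - Cexp (- z)))).
replace (2 * z - (2 * z - (Cexp z - Cexp (- z))))%C with (Cexp z - Cexp (- z))%C in T by ring.
rewrite Cmod_mult, Cmod_R, Rabs_pos_eq in T by lra; nra.
Qed.

Lemma PI_Ci_neq_0 : (PI * Ci)%C <> 0.
Proof.
apply Cmod_gt_0; rewrite Cmod_mult, Cmod_Ci, Cmod_R, Rabs_pos_eq; generalize PI_bounds; lra.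
Qed.

Lemma Cmod_PI_Ci (y : C) : Cmod (PI * Ci * y) = PI * Cmod y.
Proof.
rewrite !Cmod_mult, Cmod_Ci, Cmod_R, Rabs_pos_eq by (generalize PI_bounds; lra); ring.
Qed.

(** Boundedness of integrand minus polar part is all that the jump needs. With D = exp z - exp (-
    z), the difference splits into a Lipschitz increment of the numerator over D, and 2 z - D,
    quadratic in z, over 2 z D. *)
Lemma Raux_pole_remainder (s : C) (n : nat) : (1 <= n)%nat -> exists rho M, 0 < rho /\ 0 < M /\
  forall y : C, y <> 0 -> Cmod y < rho ->
  Cmod (Raux_integrand s (INR n + y) - Cpower (INR n) (- s) / (2 * (PI * Ci * y))) <= M.
Proof.
intros Hn; assert (HP := PI_bounds).
assert (Hn' : 1 <= INR n) by (apply (le_INR 1); exact Hn).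
assert (Hs : slit (INR n)) by (apply slit_right_half; simpl; lra).
set (E := Cexp (PI * Ci * INR n)).
assert (HE : E <> 0) by apply Cexp_neq_0.
set (g0 := Cpower (INR n) (- s)).
assert (H0 : (Rnum s (INR n) / E)%C = g0).
{ unfold Rnum; rewrite Cexp_square_nat; fold E g0; field; exact HE. }
destruct (holo_num s (INR n) Hs 1 Rlt_0_1) as [d [Hd Q]].
set (L := (Cmod (dRnum s (INR n)) + 1) / Cmod E).
assert (HmE : 0 < Cmod E) by (apply Cmod_gt_0; exact HE).
assert (HL : 0 < L) by (apply Rdiv_lt_0_compat; [generalize (Cmod_ge_0 (dRnum s (INR n))); lra | exact HmE]).
(* |y| < 1 / 24 gives |PI i y| <= 1 / 6, the range of [sinh_C_bounds]; [L] and [3 * Cmod g0] bound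
   the two terms of the splitting. *)
exists (Rmin d (1 / 24)), (L + 3 * Cmod g0 + 1).
assert (Hg := Cmod_ge_0 g0).
split; [apply Rmin_pos; lra|]; split; [lra|]; intros y Hy By.
assert (B1 := Rlt_le_trans _ _ _ By (Rmin_l _ _)); assert (B2 := Rlt_le_trans _ _ _ By (Rmin_r _ _)).
assert (Hm : 0 < Cmod y) by (apply Cmod_gt_0; exact Hy).
set (z := (PI * Ci * y)%C).
assert (Ez : Cmod z = PI * Cmod y) by apply Cmod_PI_Ci.
assert (Hz : z <> 0) by (apply Cmod_gt_0; rewrite Ez; nra).
destruct (sinh_C_bounds z ltac:(rewrite Ez; nra)) as [S1 S2].
set (D := (Cexp z - Cexp (- z))%C) in *.
assert (HD : D <> 0) by (apply Cmod_gt_0; nra).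
rewrite Raux_integrand_eq, Rden_shift; fold z D E.
set (g := Rnum s (INR n + y)).
assert (Lip : Cmod (g / E - g0) <= L * Cmod y).
{ rewrite <- H0.
  replace (g / E - Rnum s (INR n) / E)%C with ((g - Rnum s (INR n)) * / E)%C by (field; exact HE).
  rewrite Cmod_mult, Cmod_inv by exact HE.
  replace (L * Cmod y) with ((Cmod (dRnum s (INR n)) + 1) * Cmod y * / Cmod E) by (unfold L; field; lra).
  apply Rmult_le_compat_r; [left; apply Rinv_0_lt_compat; exact HmE|].
  assert (Q' := Q (INR n + y)%C); replace (INR n + y - INR n)%C with y in Q' by ring.
  specialize (Q' B1).
  replace (g - Rnum s (INR n))%C
    with ((g - Rnum s (INR n) - dRnum s (INR n) * y) + dRnum s (INR n) * y)%C by ring.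
  eapply Rle_trans; [apply Cmod_triangle|]; rewrite Cmod_mult; fold g in Q'; lra. }
replace (g * / (E * D) - g0 / (2 * z))%C
  with ((g / E - g0) * / D + g0 * (2 * z - D) * / (2 * z * D))%C
  by (field; repeat split; assumption).
eapply Rle_trans; [apply Cmod_triangle|].
assert (T1 : Cmod ((g / E - g0) * / D) <= L).
{ rewrite Cmod_mult, Cmod_inv by exact HD.
  apply Rmult_le_reg_r with (Cmod D); [nra|]; rewrite Rmult_assoc, Rinv_l by (apply Rgt_not_eq; nra).
  assert (Cmod y <= Cmod D) by nra.
  assert (L * Cmod y <= L * Cmod D) by (apply Rmult_le_compat_l; lra). lra. }
assert (T2 : Cmod (g0 * (2 * z - D) * / (2 * z * D)) <= 3 * Cmod g0).
{ assert (H2z : (2 * z * D)%C <> 0).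
  { apply Cmult_neq_0; [apply Cmult_neq_0|]; try assumption.
    intros H; apply (f_equal Re) in H; simpl in H; lra. }
  rewrite Cmod_mult, Cmod_inv by exact H2z.
  apply Rmult_le_reg_r with (Cmod (2 * z * D)); [apply Cmod_gt_0; exact H2z|].
  rewrite Rmult_assoc, Rinv_l by (apply Rgt_not_eq, Cmod_gt_0; exact H2z).
  rewrite !Cmod_mult, Cmod_R, (Rabs_pos_eq 2) by lra.
  assert (Hz0 : 0 <= Cmod z) by apply Cmod_ge_0.
  replace (3 * Cmod g0 * (2 * Cmod z * Cmod D)) with (Cmod g0 * (6 * Cmod z * Cmod D)) by ring.
  rewrite Rmult_1_r; apply Rmult_le_compat_l; [exact Hg|].
  apply Rle_trans with (1 := S1). nra. }
lra.
Qed.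

(* [1 / (e + z) - 1 / (z - e)] with [z = (1 + Ci) u], multiplied by [1 + Ci]. *)
Definition jump_re (e u : R) : R := 2 * e * (e ^ 2 - 2 * u ^ 2) / (e ^ 4 + 4 * u ^ 4).
Definition jump_im (e u : R) : R := 2 * e * (e ^ 2 + 2 * u ^ 2) / (e ^ 4 + 4 * u ^ 4).

Lemma jump_den_pos (e u : R) : 0 < e ->
  0 < 2 * u ^ 2 + 2 * e * u + e ^ 2 /\ 0 < 2 * u ^ 2 - 2 * e * u + e ^ 2.
Proof.
intros He; assert (0 < e ^ 2) by (apply pow_lt; exact He).
split; [generalize (pow2_ge_0 (u + e / 2)) | generalize (pow2_ge_0 (u - e / 2))]; lra.
Qed.

(** Sophie Germain's factorisation, which also yields the partial fractions behind the two
    primitives below. *)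
Lemma jump_den_neq_0 (e u : R) : 0 < e -> e ^ 4 + 4 * u ^ 4 <> 0.
Proof.
intros He; destruct (jump_den_pos e u He); apply Rgt_not_eq.
replace (e ^ 4 + 4 * u ^ 4) with ((2 * u ^ 2 + 2 * e * u + e ^ 2) * (2 * u ^ 2 - 2 * e * u + e ^ 2)) by ring.
apply Rmult_lt_0_compat; assumption.
Qed.

Lemma is_RInt_jump_re (e h : R) : 0 < e ->
  is_RInt (jump_re e) (- h) h
    (ln ((2 * h ^ 2 + 2 * e * h + e ^ 2) / (2 * h ^ 2 - 2 * e * h + e ^ 2))).
Proof.
intros He.
set (F := fun u => / 2 * (ln (2 * u ^ 2 + 2 * e * u + e ^ 2) - ln (2 * u ^ 2 - 2 * e * u + e ^ 2))).
assert (H := is_RInt_derive (V := R_CompleteNormedModule) F (jump_re e) (- h) h).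
destruct (jump_den_pos e h He) as [Q1 Q2].
replace (ln ((2 * h ^ 2 + 2 * e * h + e ^ 2) / (2 * h ^ 2 - 2 * e * h + e ^ 2))) with (minus (F h) (F (- h))).
- apply H; intros u _; destruct (jump_den_pos e u He) as [P1 P2].
  + unfold F, jump_re; auto_derive.
    * repeat split; try lra; simpl in *; lra.
    * replace (e ^ 4 + 4 * u ^ 4) with ((2 * u ^ 2 + 2 * e * u + e ^ 2) * (2 * u ^ 2 - 2 * e * u + e ^ 2)) by ring.
      field; repeat split; apply Rgt_not_eq; simpl in *; lra.
  + apply (ex_derive_continuous (V := R_NormedModule) (jump_re e) u); unfold jump_re; auto_derive.
    exact (jump_den_neq_0 e u He).
- unfold F, minus, plus, opp; simpl; rewrite ln_div by (simpl in *; lra).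
  replace (- h * (- h * 1)) with (h * (h * 1)) by ring.
  replace (2 * e * - h) with (- (2 * e * h)) by ring.
  unfold Rminus; rewrite Ropp_involutive; field.
Qed.

Lemma is_RInt_jump_im (e h : R) : 0 < e ->
  is_RInt (jump_im e) (- h) h (2 * (atan ((2 * h + e) / e) + atan ((2 * h - e) / e))).
Proof.
intros He.
set (F := fun u => atan ((2 * u + e) / e) + atan ((2 * u - e) / e)).
assert (H := is_RInt_derive (V := R_CompleteNormedModule) F (jump_im e) (- h) h).
replace (2 * (atan ((2 * h + e) / e) + atan ((2 * h - e) / e))) with (minus (F h) (F (- h))).
- apply H; intros u _; destruct (jump_den_pos e u He) as [P1 P2].
  + unfold F, jump_im; auto_derive; [trivial|].
    replace (e ^ 4 + 4 * u ^ 4) with ((2 * u ^ 2 + 2 * e * u + e ^ 2) * (2 * u ^ 2 - 2 * e * u + e ^ 2)) by ring.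
    field; repeat split; apply Rgt_not_eq; simpl in *; try nra.
  + apply (ex_derive_continuous (V := R_NormedModule) (jump_im e) u); unfold jump_im; auto_derive.
    exact (jump_den_neq_0 e u He).
- unfold F, minus, plus, opp; simpl.
  replace ((2 * - h + e) / e) with (- ((2 * h - e) / e)) by (field; lra).
  replace ((2 * - h - e) / e) with (- ((2 * h + e) / e)) by (field; lra).
  rewrite !atan_opp; ring.
Qed.

Lemma jump_re_small (h : R) : 0 < h <= 1 / 2 ->
  Rabs (ln ((2 * h ^ 2 + 2 * h ^ 2 * h + (h ^ 2) ^ 2) / (2 * h ^ 2 - 2 * h ^ 2 * h + (h ^ 2) ^ 2))) <= 4 * h.
Proof.
intros Hh.
replace ((2 * h ^ 2 + 2 * h ^ 2 * h + (h ^ 2) ^ 2) / (2 * h ^ 2 - 2 * h ^ 2 * h + (h ^ 2) ^ 2))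
  with ((2 + 2 * h + h ^ 2) / (2 - 2 * h + h ^ 2)) by (field; split; nra).
assert (Q : 1 <= (2 + 2 * h + h ^ 2) / (2 - 2 * h + h ^ 2) <= 1 + 4 * h).
{ split; apply Rmult_le_reg_r with (2 - 2 * h + h ^ 2); try nra;
    unfold Rdiv; rewrite Rmult_assoc, Rinv_l by nra; nra. }
set (x := (2 + 2 * h + h ^ 2) / (2 - 2 * h + h ^ 2)) in *.
rewrite Rabs_pos_eq.
- generalize (ln_le_sub_1 x); lra.
- rewrite <- ln_1; destruct (proj1 Q) as [H|H]; [left; apply ln_increasing; lra | rewrite H; lra].
Qed.

Lemma atan_ge_sub_inv (y : R) : 0 < y -> PI / 2 - / y <= atan y.
Proof.
intros Hy; assert (H := atan_inv y Hy).
assert (Q := atan_le_id (/ y) ltac:(left; apply Rinv_0_lt_compat; exact Hy)).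
lra.
Qed.

(** With half-gap e = h^2 and window [-h, h], both arctangents tend to PI / 2, so the polar parts
    contribute 2 PI, the whole of a residue, up to O(h). *)
Lemma jump_im_small (h : R) : 0 < h <= 1 / 2 ->
  Rabs (2 * (atan ((2 * h + h ^ 2) / h ^ 2) + atan ((2 * h - h ^ 2) / h ^ 2)) - 2 * PI) <= 4 * h.
Proof.
intros Hh.
replace ((2 * h + h ^ 2) / h ^ 2) with (2 / h + 1) by (field; lra).
replace ((2 * h - h ^ 2) / h ^ 2) with (2 / h - 1) by (field; lra).
assert (H4 : 2 <= / h) by (rewrite <- (Rinv_inv 2); apply Rinv_le_contravar; lra).
assert (P : forall y, / h <= y -> PI / 2 - h <= atan y < PI / 2).
{ intros y Hy; split; [|apply atan_bound].
  eapply Rle_trans; [|apply atan_ge_sub_inv; lra].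
  assert (/ y <= / / h) by (apply Rinv_le_contravar; lra).
  rewrite Rinv_inv in H; lra. }
assert (P1 := P (2 / h + 1) ltac:(unfold Rdiv; lra)).
assert (P2 := P (2 / h - 1) ltac:(unfold Rdiv; lra)).
apply Rabs_le; lra.
Qed.

Lemma jump_C (e u : R) : 0 < e ->
  ((1 + Ci) * (/ (e + (1 + Ci) * u) - / (- e + (1 + Ci) * u)))%C = (jump_re e u, jump_im e u).
Proof.
intros He.
assert (Z1 : (e + (1 + Ci) * u)%C <> 0).
{ intros H; assert (H1 := f_equal Re H); assert (H2 := f_equal Im H); simpl in H1, H2; nra. }
assert (Z2 : (- e + (1 + Ci) * u)%C <> 0).
{ intros H; assert (H1 := f_equal Re H); assert (H2 := f_equal Im H); simpl in H1, H2; nra. }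
assert (Hd := jump_den_neq_0 e u He).
assert (E : ((jump_re e u, jump_im e u) * ((e + (1 + Ci) * u) * (- e + (1 + Ci) * u)) =
  (1 + Ci) * ((- e + (1 + Ci) * u) - (e + (1 + Ci) * u)))%C).
{ apply C_eq; simpl; unfold jump_re, jump_im; field; exact Hd. }
transitivity ((1 + Ci) * ((- e + (1 + Ci) * u) - (e + (1 + Ci) * u)) *
  / ((e + (1 + Ci) * u) * (- e + (1 + Ci) * u)))%C.
- field; split; assumption.
- rewrite <- E; field; split; assumption.
Qed.

Lemma Rabs_le_linear_eq (x y C h0 : R) : 0 < h0 ->
  (forall h, 0 < h <= h0 -> Rabs (x - y) <= C * h) -> x = y.
Proof.
intros Hh0 H; destruct (Req_dec x y) as [E|E]; [exact E|exfalso].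
assert (P : 0 < Rabs (x - y)) by (apply Rabs_pos_lt; lra).
assert (HC : 0 < C).
{ specialize (H h0 ltac:(lra)); nra. }
set (h := Rmin h0 (Rabs (x - y) / (2 * C))).
assert (Hq : 0 < Rabs (x - y) / (2 * C)) by (apply Rdiv_lt_0_compat; lra).
assert (Q := H h ltac:(split; [apply Rmin_pos; lra | apply Rmin_l])).
assert (Q2 : h <= Rabs (x - y) / (2 * C)) by apply Rmin_r.
apply (Rmult_le_compat_l C) in Q2; [|lra].
replace (C * (Rabs (x - y) / (2 * C))) with (Rabs (x - y) / 2) in Q2 by (field; lra); lra.
Qed.

(** Both lines are brought to distance e = h^2 from the pole. Outside the window |u| <= h the
    integrand is at most K / h between the lines, which are 2 h^2 apart: a difference O(h). Inside,
    the remainders are bounded on a window of length 2 h, and the polar parts give the residue up to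
    O(h). The left side does not depend on h, so equality follows. *)
Lemma Iline_jump (k s : C) (n : nat) : (1 <= n)%nat ->
  Iline k s (INR n + 1 / 2) - Iline k s (INR n - 1 / 2) = Re (k * Cpower (INR n) (- s))%C.
Proof.
intros Hn; assert (Hn' : 1 <= INR n) by (apply (le_INR 1); exact Hn).
assert (HP := PI_bounds).
assert (Hm : INR (n - 1) = INR n - 1) by (rewrite minus_INR by exact Hn; reflexivity).
destruct (Raux_pole_remainder s n Hn) as [rho [M [Hrho [HM Hrem]]]].
destruct (Raux_integrand_far s (INR n - 1 / 2) (INR n + 1 / 2) ltac:(lra) ltac:(lra)) as [K [HK F]].
set (w := (k * (Cpower (INR n) (- s) / (2 * (PI * Ci))))%C).
assert (H2 : (2 : C) <> 0) by (intros H; apply (f_equal Re) in H; simpl in H; lra).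
assert (HPC := PI_Ci_neq_0).
assert (Ew : Re (k * Cpower (INR n) (- s))%C = - (2 * PI) * Im w).
{ replace (k * Cpower (INR n) (- s))%C with (w * (2 * (PI * Ci)))%C by (revert HPC; unfold w; generalize (PI * Ci)%C; intros q Hq; field; repeat split; assumption).
  simpl; ring. }
assert (Hk := Cmod_ge_0 k).
apply (Rabs_le_linear_eq _ _ (8 * Cmod k * K + 8 * Cmod k * M + 8 * Cmod w) (Rmin (1 / 2) (rho / 4))).
{ apply Rmin_pos; lra. }
intros h [Hh0 Hh].
assert (Hh1 := Rle_trans _ _ _ Hh (Rmin_l _ _)); assert (Hh2 := Rle_trans _ _ _ Hh (Rmin_r _ _)).
set (e := h ^ 2).
assert (He : 0 < e) by (apply pow_lt; exact Hh0).
assert (Heh : e <= h / 2) by (unfold e; nra).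
assert (S1 : Iline k s (INR n + 1 / 2) = Iline k s (INR n + e)).
{ symmetry; apply (Iline_shift k s n); lra. }
assert (S2 : Iline k s (INR n - 1 / 2) = Iline k s (INR n - e)).
{ apply (Iline_shift k s (n - 1)); rewrite ?Hm; lra. }
rewrite S1, S2, Ew; clear S1 S2 Ew.
destruct (Edec_Gline k s n (INR n + e) ltac:(lra)) as [K1 E1].
destruct (Edec_Gline k s (n - 1) (INR n - e) ltac:(rewrite Hm; lra)) as [K2 E2].
assert (HK1 := Edec_K_pos _ _ E1); assert (HK2 := Edec_K_pos _ _ E2).
set (G1 := Gline k s (INR n + e)) in *; set (G2 := Gline k s (INR n - e)) in *.
assert (X1 : forall x y, ex_RInt G1 x y) by (intros; eapply Edec_ex_RInt; exact E1).
assert (X2 : forall x y, ex_RInt G2 x y) by (intros; eapply Edec_ex_RInt; exact E2).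
assert (Hout : forall a b, a <= b -> (forall u, a <= u <= b -> h <= Rabs u) ->
  Rabs (RInt G1 a b - RInt G2 a b) <= 4 * Cmod k * K * h).
{ intros a b Hab Hu.
  replace (4 * Cmod k * K * h) with (Cmod k * (2 * (K / h)) * ((INR n + e) - (INR n - e))).
  2:{ unfold e; field; lra. }
  apply RInt_Gline_sub_le; [exact Hab | lra | |].
  - exists (1 / 4); split; [lra|]; intros y u Hy Hu'; split; [lra|].
    apply den_neq_0_Im; rewrite Im_slope1_line; intros ->.
    specialize (Hu 0 Hu'); rewrite Rabs_R0 in Hu; lra.
  - assert (P : forall y v, INR n - e <= y <= INR n + e -> h <= Rabs v ->
      Cmod (Raux_integrand s (slope1_line y v)) <= K / h).
    { intros y v Hy Hv.
      eapply Rle_trans; [apply F; [lra | intros ->; rewrite Rabs_R0 in Hv; lra]|].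
      assert (exp (- Rabs v) <= 1) by (rewrite <- exp_0; apply exp_le_compat; lra).
      apply Rmult_le_compat; [generalize (exp_pos (- Rabs v)); nra | | nra | apply Rinv_le_contravar; lra].
      left; apply Rinv_0_lt_compat; lra. }
    intros y Hy; split; apply P; auto; apply Hu; lra. }
assert (Hmid : Rabs (RInt G1 (- h) h - RInt G2 (- h) h - - (2 * PI) * Im w)
  <= (8 * Cmod k * M + 8 * Cmod w) * h).
{ set (J := fun u => Re w * jump_re e u + - Im w * jump_im e u).
  assert (IR := is_RInt_jump_re e h He); assert (IM := is_RInt_jump_im e h He).
  assert (XJ : ex_RInt J (- h) h).
  { eexists; unfold J; apply (is_RInt_plus (V := R_NormedModule) (fun u => Re w * jump_re e u));
      apply (is_RInt_scal (V := R_NormedModule)); eassumption. }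
  assert (EJ : RInt J (- h) h = Re w * RInt (jump_re e) (- h) h + - Im w * RInt (jump_im e) (- h) h).
  { apply RInt_lin; eexists; eassumption. }
  rewrite (is_RInt_unique _ _ _ _ IR), (is_RInt_unique _ _ _ _ IM) in EJ.
  assert (B1 := jump_re_small h ltac:(lra)); assert (B2 := jump_im_small h ltac:(lra)); fold e in B1, B2.
  set (lr := ln _) in B1, EJ; set (at2 := 2 * (_ + _)) in B2, EJ.
  assert (P : Rabs (RInt (fun u => 1 * (1 * G1 u + -1 * G2 u) + -1 * J u) (- h) h) <= (h - - h) * (4 * Cmod k * M)).
  { apply abs_RInt_le_const; [lra | |].
    - apply (ex_RInt_plus (V := R_NormedModule) (fun u => 1 * (1 * G1 u + -1 * G2 u)) (fun u => -1 * J u)).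
      + apply (ex_RInt_scal (V := R_NormedModule) (fun u => 1 * G1 u + -1 * G2 u)).
        apply (ex_RInt_plus (V := R_NormedModule) (fun u => 1 * G1 u) (fun u => -1 * G2 u));
          apply (ex_RInt_scal (V := R_NormedModule)); auto.
      + apply (ex_RInt_scal (V := R_NormedModule)); exact XJ.
    - intros u Hu.
      set (y1 := (e + (1 + Ci) * u)%C); set (y2 := (- e + (1 + Ci) * u)%C).
      assert (N1 : y1 <> 0).
      { intros H; assert (H1 := f_equal Re H); assert (H2' := f_equal Im H); simpl in H1, H2'; nra. }
      assert (N2 : y2 <> 0).
      { intros H; assert (H1 := f_equal Re H); assert (H2' := f_equal Im H); simpl in H1, H2'; nra. }
      assert (Hru : Rabs u <= h) by (apply Rabs_le; lra).
      assert (Hcu : Cmod ((1 + Ci) * u) <= 2 * h).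
      { rewrite Cmod_mult, Cmod_R; generalize Cmod_1_Ci (Cmod_ge_0 (1 + Ci)) (Rabs_pos u); nra. }
      assert (C1 : Cmod y1 < rho).
      { eapply Rle_lt_trans; [apply Cmod_triangle|]; rewrite Cmod_R, Rabs_pos_eq by lra; lra. }
      assert (C2 : Cmod y2 < rho).
      { eapply Rle_lt_trans; [apply Cmod_triangle|].
        rewrite Cmod_opp, Cmod_R, Rabs_pos_eq by lra; lra. }
      assert (R1 := Hrem y1 N1 C1); assert (R2 := Hrem y2 N2 C2).
      set (f1 := Raux_integrand s (INR n + y1)) in *; set (f2 := Raux_integrand s (INR n + y2)) in *.
      set (b1 := (f1 - _)%C) in R1; set (b2 := (f2 - _)%C) in R2.
      replace (1 * (1 * G1 u + -1 * G2 u) + -1 * J u) with (Re (k * ((b1 - b2) * (1 + Ci)))%C).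
      + eapply Rle_trans; [apply re_le_Cmod|]; rewrite !Cmod_mult.
        assert (T : Cmod (b1 - b2) <= 2 * M).
        { eapply Rle_trans; [apply Cmod_triangle|]; rewrite Cmod_opp; lra. }
        assert (T2 : Cmod (b1 - b2) * Cmod (1 + Ci) <= 4 * M).
        { generalize Cmod_1_Ci (Cmod_ge_0 (1 + Ci)) (Cmod_ge_0 (b1 - b2)); nra. }
        replace (4 * Cmod k * M) with (Cmod k * (4 * M)) by ring.
        apply Rmult_le_compat_l; assumption.
      + replace (J u) with (Re (w * (jump_re e u, jump_im e u))%C)
          by (unfold J; generalize (jump_re e u) (jump_im e u); intros; simpl; unfold Re, Im; ring).
        rewrite <- jump_C by exact He; fold y1 y2.
        replace (G1 u) with (Re (k * (f1 * (1 + Ci)))%C).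
        2:{ unfold G1, Gline, f1; do 4 f_equal; unfold slope1_line, y1; rewrite RtoC_plus; ring. }
        replace (G2 u) with (Re (k * (f2 * (1 + Ci)))%C).
        2:{ unfold G2, Gline, f2; do 4 f_equal; unfold slope1_line, y2; rewrite RtoC_minus; ring. }
        replace (k * ((b1 - b2) * (1 + Ci)))%C
          with (k * (f1 * (1 + Ci)) - k * (f2 * (1 + Ci)) - w * ((1 + Ci) * (/ y1 - / y2)))%C.
        * generalize (k * (f1 * (1 + Ci)))%C (k * (f2 * (1 + Ci)))%C (w * ((1 + Ci) * (/ y1 - / y2)))%C.
          intros p q r; simpl; unfold Re; ring.
        * unfold b1, b2, w; clear - HPC N1 N2 H2; clearbody y1 y2 f1 f2.
          revert HPC; generalize (PI * Ci)%C; intros q Hq; field; repeat split; assumption. }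
  rewrite RInt_lin in P; [|apply (ex_RInt_plus (V := R_NormedModule) (fun u => 1 * G1 u) (fun u => -1 * G2 u));
          apply (ex_RInt_scal (V := R_NormedModule)); auto | exact XJ].
  rewrite RInt_lin in P by auto; rewrite EJ in P.
  replace (RInt G1 (- h) h - RInt G2 (- h) h - - (2 * PI) * Im w)
    with ((1 * (1 * RInt G1 (- h) h + -1 * RInt G2 (- h) h) + -1 * (Re w * lr + - Im w * at2))
      + (Re w * lr + - (Im w * (at2 - 2 * PI)))) by ring.
  eapply Rle_trans; [apply Rabs_triang|].
  assert (T : Rabs (Re w * lr + - (Im w * (at2 - 2 * PI))) <= 8 * Cmod w * h).
  { eapply Rle_trans; [apply Rabs_triang|]; rewrite Rabs_Ropp, !Rabs_mult.
    assert (U1 := re_le_Cmod w); assert (U2 := im_le_Cmod w).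
    assert (V1 : Rabs (Re w) * Rabs lr <= Cmod w * (4 * h))
      by (apply Rmult_le_compat; auto; apply Rabs_pos).
    assert (V2 : Rabs (Im w) * Rabs (at2 - 2 * PI) <= Cmod w * (4 * h))
      by (apply Rmult_le_compat; auto; apply Rabs_pos).
    lra. }
  lra. }
(* For fixed h, a supposed excess [dd] is contradicted by truncating both integrals so far out that
   the tails total less than [dd]. *)
apply Rnot_lt_le; intros N.
set (dd := Rabs (Iline k s (INR n + e) - Iline k s (INR n - e) - - (2 * PI) * Im w)
  - (8 * Cmod k * K + 8 * Cmod k * M + 8 * Cmod w) * h) in *.
assert (Hdd : 0 < dd) by (unfold dd; lra).
destruct (exp_neg_small (dd / (2 * (K1 + K2 + 1)))) as [A [HA HQ]]; [apply Rdiv_lt_0_compat; lra|].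
set (a := Rmax A 1).
assert (Ha1 : 1 <= a) by apply Rmax_r.
specialize (HQ a (Rmax_l _ _)).
assert (A1 := II_approx K1 G1 a a E1 ltac:(lra) ltac:(lra)); change (II G1) with (Iline k s (INR n + e)) in A1.
assert (A2 := II_approx K2 G2 a a E2 ltac:(lra) ltac:(lra)); change (II G2) with (Iline k s (INR n - e)) in A2.
rewrite (RInt_split3 G1 (- a) (- h) h a X1) in A1; rewrite (RInt_split3 G2 (- a) (- h) h a X2) in A2.
assert (O1 := Hout (- a) (- h) ltac:(lra) ltac:(intros u Hu; rewrite Rabs_left1; lra)).
assert (O2 := Hout h a ltac:(lra) ltac:(intros u Hu; rewrite Rabs_pos_eq; lra)).
apply Rabs_le_between in A1; apply Rabs_le_between in A2; apply Rabs_le_between in O1;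
  apply Rabs_le_between in O2; apply Rabs_le_between in Hmid.
assert (E : dd = (K1 + K2 + 1) * (dd / (2 * (K1 + K2 + 1)) + dd / (2 * (K1 + K2 + 1)))) by (field; lra).
assert (T : K1 * (exp (- a) + exp (- a)) + K2 * (exp (- a) + exp (- a)) < dd).
{ rewrite E; generalize (exp_pos (- a)); intros.
  apply Rle_lt_trans with ((K1 + K2 + 1) * (exp (- a) + exp (- a))); [lra|].
  apply Rmult_lt_compat_l; lra. }
assert (Fin : Rabs (Iline k s (INR n + e) - Iline k s (INR n - e) - - (2 * PI) * Im w)
  < (8 * Cmod k * K + 8 * Cmod k * M + 8 * Cmod w) * h + dd) by (apply Rabs_def1; lra).
unfold dd in Fin; lra.
Qed.

(** * Expansion with a partial sum of the zeta series *)

Fixpoint zeta_partial (k s : C) (N : nat) : R :=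
  match N with
  | O => 0
  | S m => zeta_partial k s m + Re (k * Cpower (INR (S m)) (- s))%C
  end.

Lemma Re_Raux_expand (k s : C) (c : R) (N : nat) : 0 < c < 1 ->
  Re (k * Raux c s)%C = zeta_partial k s N - Iline k s (INR N + 1 / 2).
Proof.
intros Hc; induction N as [|N IH].
- rewrite Re_Raux by exact Hc; simpl.
  assert (E : Iline k s c = Iline k s (0 + 1 / 2)); [|rewrite E; ring].
  destruct (Rtotal_order c (1 / 2)) as [H|[H|H]].
  + apply (Iline_shift k s 0); simpl; lra.
  + f_equal; lra.
  + symmetry; apply (Iline_shift k s 0); simpl; lra.
- rewrite IH; assert (J := Iline_jump k s (S N) ltac:(lia)).
  change (zeta_partial k s (S N)) with (zeta_partial k s N + Re (k * Cpower (INR (S N)) (- s))%C).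
  rewrite <- J, S_INR.
  replace (INR N + 1 - 1 / 2) with (INR N + 1 / 2) by field; ring.
Qed.

(** * Dependence on s *)

(* Weights [v] for which [exp (- s Log x) v x] may be integrated along the line, for every [s]. *)
Definition weight (c : R) (v : C -> C) : Prop :=
  (forall u, exists l, holo v (slope1_line c u) l) /\
  forall S, 0 <= S -> exists K, forall u,
    exp (S * Cmod (Clog (slope1_line c u))) * Cmod (v (slope1_line c u)) <= K * exp (- Rabs u).

(** In the variable log x this is a Laplace transform; differentiating in s brings down the factor -
    log x. *)
Definition Laplace (c : R) (v : C -> C) (s : C) : R :=
  II (fun u => Re (Cexp (- s * Clog (slope1_line c u)) * v (slope1_line c u))%C).

Lemma Cmod_Cexp_le (z : C) : Cmod (Cexp z) <= exp (Cmod z).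
Proof. rewrite Cmod_Cexp; apply exp_le_compat, Re_le_Cmod. Qed.

Lemma weight_Edec (c : R) (v g : C -> C) (S K : R) : 0 < c ->
  (forall u, exists l, holo v (slope1_line c u) l) ->
  (forall u, exists l, holo g (slope1_line c u) l) ->
  (forall u, Cmod (g (slope1_line c u)) <= exp (S * Cmod (Clog (slope1_line c u)))) ->
  (forall u, exp (S * Cmod (Clog (slope1_line c u))) * Cmod (v (slope1_line c u)) <= K * exp (- Rabs u)) ->
  Edec K (fun u => Re (g (slope1_line c u) * v (slope1_line c u))%C).
Proof.
intros Hc Hv Hg Hgb HK; split; intros u.
- destruct (Hv u) as [l Hl]; destruct (Hg u) as [m Hm].
  apply (ex_derive_continuous (V := R_NormedModule)
    (fun u => Re (g (slope1_line c u) * v (slope1_line c u))%C)).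
  eexists; eapply is_derive_ext;
    [|exact (is_derive_line_u (fun x => (g x * v x)%C) 1 _ c u (holo_mult g v _ m l Hm Hl))].
  intros t; simpl; ring.
- eapply Rle_trans; [apply re_le_Cmod|]; rewrite Cmod_mult.
  eapply Rle_trans; [|apply HK]; apply Rmult_le_compat_r; [apply Cmod_ge_0 | apply Hgb].
Qed.

Lemma holo_Cexp_Clog (k z : C) : slit z -> holo (fun x => Cexp (k * Clog x)) z (Cexp (k * Clog z) * (k * / z)).
Proof.
intros Hz; apply (holo_comp Cexp (fun x => (k * Clog x)%C)); [apply holo_Cexp|].
apply holo_scal, holo_Clog; exact Hz.
Qed.

Lemma weight_kernel_Edec (c : R) (v : C -> C) (s : C) : 0 < c -> weight c v -> exists K,
  Edec K (fun u => Re (Cexp (- s * Clog (slope1_line c u)) * v (slope1_line c u))%C).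
Proof.
intros Hc [Hv Hd]; destruct (Hd (Cmod s) (Cmod_ge_0 s)) as [K HK]; exists K.
apply (weight_Edec c v (fun x => Cexp (- s * Clog x)) (Cmod s)); auto.
- intros u; eexists; apply holo_Cexp_Clog, slit_line; exact Hc.
- intros u; eapply Rle_trans; [apply Cmod_Cexp_le|]; rewrite Cmod_mult, Cmod_opp; apply Rle_refl.
Qed.

(** Since l <= exp l, one more logarithm costs one more unit of [S]. Quantifying over all [S] in
    [weight] thus makes the class stable under differentiation in s. *)
Lemma weight_mult_Clog (c : R) (v : C -> C) (k : C) : 0 < c -> weight c v ->
  weight c (fun x => (k * Clog x * v x)%C).
Proof.
intros Hc [Hv Hd]; split.
- intros u; destruct (Hv u) as [l Hl]; eexists; apply holo_mult; [|exact Hl].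
  apply holo_scal, holo_Clog, slit_line; exact Hc.
- intros S HS; destruct (Hd (S + 1) ltac:(lra)) as [K HK].
  exists (Cmod k * K); intros u; rewrite !Cmod_mult.
  specialize (HK u); set (l := Cmod (Clog (slope1_line c u))) in *.
  set (w := Cmod (v (slope1_line c u))) in *.
  assert (Hw : 0 <= w) by apply Cmod_ge_0.
  replace ((S + 1) * l) with (S * l + l) in HK by ring; rewrite exp_plus in HK.
  assert (B := exp_ineq1_le l); assert (Hl : 0 <= l) by apply Cmod_ge_0.
  replace (exp (S * l) * (Cmod k * l * w)) with (Cmod k * (exp (S * l) * w * l)) by ring.
  rewrite (Rmult_assoc (Cmod k) K); apply Rmult_le_compat_l; [apply Cmod_ge_0|].
  assert (0 <= exp (S * l) * w) by (generalize (exp_pos (S * l)); nra).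
  nra.
Qed.

Lemma weight_scal (c : R) (v : C -> C) (k : C) : weight c v -> weight c (fun x => (k * v x)%C).
Proof.
intros [Hv Hd]; split.
- intros u; destruct (Hv u) as [l Hl]; eexists; apply holo_scal; exact Hl.
- intros S HS; destruct (Hd S HS) as [K HK]; exists (Cmod k * K); intros u; specialize (HK u).
  rewrite Cmod_mult.
  replace (exp (S * Cmod (Clog (slope1_line c u))) * (Cmod k * Cmod (v (slope1_line c u))))
    with (Cmod k * (exp (S * Cmod (Clog (slope1_line c u))) * Cmod (v (slope1_line c u)))) by ring.
  rewrite (Rmult_assoc (Cmod k) K); apply Rmult_le_compat_l; [apply Cmod_ge_0 | exact HK].
Qed.

Lemma Laplace_lin (c : R) (v w : C -> C) (a b : R) (s : C) : 0 < c -> weight c v -> weight c w ->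
  Laplace c (fun x => (a * v x + b * w x)%C) s = a * Laplace c v s + b * Laplace c w s.
Proof.
intros Hc Hv Hw; destruct (weight_kernel_Edec c v s Hc Hv) as [K1 E1];
  destruct (weight_kernel_Edec c w s Hc Hw) as [K2 E2].
unfold Laplace; rewrite <- (II_lin K1 K2) by assumption; apply II_ext; intros u; simpl; unfold Re; ring.
Qed.

Lemma Laplace_taylor (c : R) (v : C -> C) (s : C) : 0 < c -> weight c v -> exists K, 0 <= K /\
  forall h, Cmod h <= 1 ->
  Rabs (Laplace c v (s + h) - Laplace c v s - Laplace c (fun x => (- h * Clog x * v x)%C) s) <= K * Cmod h ^ 2.
Proof.
intros Hc Hw.
(* Beyond |s|, two units absorb the squared logarithm and one absorbs exp (|h| |log x|) with |h| <=
   1. *)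
destruct (proj2 Hw (Cmod s + 3)) as [K HK]; [generalize (Cmod_ge_0 s); lra|].
assert (K0 : 0 <= K).
{ specialize (HK 0); rewrite Rabs_R0, Ropp_0, exp_0 in HK.
  assert (0 <= exp ((Cmod s + 3) * Cmod (Clog (slope1_line c 0))) * Cmod (v (slope1_line c 0))); [|lra].
  apply Rmult_le_pos; [left; apply exp_pos | apply Cmod_ge_0]. }
exists (2 * K); split; [lra|]; intros h Hh.
assert (Hw2 := weight_mult_Clog c v (- h) Hc Hw).
destruct (weight_kernel_Edec c v (s + h) Hc Hw) as [K1 E1].
destruct (weight_kernel_Edec c v s Hc Hw) as [K2 E2].
destruct (weight_kernel_Edec c _ s Hc Hw2) as [K3 E3].
unfold Laplace.
set (g1 := fun u => Re (Cexp (- (s + h) * Clog (slope1_line c u)) * v (slope1_line c u))%C) in *.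
set (g2 := fun u => Re (Cexp (- s * Clog (slope1_line c u)) * v (slope1_line c u))%C) in *.
set (g3 := fun u => Re (Cexp (- s * Clog (slope1_line c u)) *
  (- h * Clog (slope1_line c u) * v (slope1_line c u)))%C) in *.
assert (E12 := Edec_lin K1 K2 1 (-1) g1 g2 E1 E2).
assert (E123 := Edec_lin _ K3 1 (-1) _ g3 E12 E3).
replace (II g1 - II g2 - II g3) with (1 * II (fun u => 1 * g1 u + -1 * g2 u) + -1 * II g3)
  by (rewrite (II_lin K1 K2) by assumption; ring).
rewrite <- (II_lin (Rabs 1 * K1 + Rabs (-1) * K2) K3) by assumption.
rewrite Rmult_assoc; apply II_le; split; [apply E123|].
intros u; specialize (HK u).
set (l := Clog (slope1_line c u)) in *; set (w := v (slope1_line c u)) in *.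
replace (1 * (1 * g1 u + -1 * g2 u) + -1 * g3 u)
  with (Re (Cexp (- s * l) * w * (Cexp (- h * l) - 1 - (- h * l)))%C).
2:{ unfold g1, g2, g3; fold l w.
  replace (- (s + h) * l)%C with (- s * l + - h * l)%C by ring; rewrite Cexp_plus; simpl; ring. }
eapply Rle_trans; [apply re_le_Cmod|]; rewrite !Cmod_mult.
assert (A1 : Cmod (Cexp (- s * l)) <= exp (Cmod s * Cmod l)).
{ eapply Rle_trans; [apply Cmod_Cexp_le|]; rewrite Cmod_mult, Cmod_opp; apply Rle_refl. }
assert (A2 := Cexp_sub_1_sub_id_le (- h * l)); rewrite Cmod_mult, Cmod_opp in A2.
assert (Hl : 0 <= Cmod l) by apply Cmod_ge_0.
assert (Hh0 : 0 <= Cmod h) by apply Cmod_ge_0.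
assert (Hw0 : 0 <= Cmod w) by apply Cmod_ge_0.
assert (A3 : (Cmod h * Cmod l) ^ 2 * exp (Cmod h * Cmod l) <= Cmod h ^ 2 * exp (3 * Cmod l)).
{ replace (3 * Cmod l) with (Cmod l + Cmod l + Cmod l) by ring; rewrite !exp_plus.
  rewrite Rpow_mult_distr, Rmult_assoc; apply Rmult_le_compat_l; [apply pow2_ge_0|].
  assert (B := exp_ineq1_le (Cmod l)).
  apply Rmult_le_compat; [apply pow2_ge_0 | left; apply exp_pos | nra | apply exp_le_compat; nra]. }
apply Rle_trans with (exp (Cmod s * Cmod l) * Cmod w * (Cmod h ^ 2 * exp (3 * Cmod l))).
- apply Rmult_le_compat; [apply Rmult_le_pos; [apply Cmod_ge_0 | exact Hw0] | apply Cmod_ge_0 | | lra].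
  apply Rmult_le_compat_r; assumption.
- replace ((Cmod s + 3) * Cmod l) with (Cmod s * Cmod l + 3 * Cmod l) in HK by ring.
  rewrite exp_plus in HK.
  generalize (pow2_ge_0 (Cmod h)); nra.
Qed.

Lemma Laplace_Clog_split (c : R) (v : C -> C) (a b : R) (s : C) : 0 < c -> weight c v ->
  Laplace c (fun x => (- (a + Ci * b) * Clog x * v x)%C) s =
  a * Laplace c (fun x => (- (1) * Clog x * v x)%C) s + b * Laplace c (fun x => (- Ci * Clog x * v x)%C) s.
Proof.
intros Hc Hw; rewrite <- Laplace_lin by (try apply weight_mult_Clog; assumption).
apply II_ext; intros u; f_equal; ring.
Qed.

Lemma Laplace_expand (c : R) (v : C -> C) (s : C) : 0 < c -> weight c v -> exists K, 0 <= K /\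
  forall a b, Rabs a + Rabs b <= 1 ->
  Rabs (Laplace c v (s + (a + Ci * b)) - Laplace c v s
    - (a * Laplace c (fun x => (- (1) * Clog x * v x)%C) s + b * Laplace c (fun x => (- Ci * Clog x * v x)%C) s))
  <= K * (Rabs a + Rabs b) ^ 2.
Proof.
intros Hc Hw; destruct (Laplace_taylor c v s Hc Hw) as [K [HK H]]; exists K; split; [exact HK|].
intros a b Hab.
assert (B : Cmod (a + Ci * b) <= Rabs a + Rabs b).
{ eapply Rle_trans; [apply Cmod_triangle|]; rewrite Cmod_mult, Cmod_Ci, !Cmod_R; lra. }
specialize (H (a + Ci * b)%C ltac:(lra)); rewrite Laplace_Clog_split in H by assumption.
eapply Rle_trans; [exact H|]; apply Rmult_le_compat_l; [exact HK|].
apply pow_incr; split; [apply Cmod_ge_0 | exact B].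
Qed.

Lemma is_derive_of_quadratic (f : R -> R) (x l K : R) : 0 <= K ->
  (forall h, Rabs h <= 1 -> Rabs (f (x + h) - f x - h * l) <= K * Rabs h ^ 2) -> is_derive f x l.
Proof.
intros HK H; apply is_derive_Reals; intros eps He.
assert (Hd : 0 < Rmin 1 (eps / (K + 1))) by (apply Rmin_pos; [lra | apply Rdiv_lt_0_compat; lra]).
exists (mkposreal _ Hd); intros h Hh0 Hh; simpl in Hh.
assert (B1 := Rlt_le_trans _ _ _ Hh (Rmin_l _ _)); assert (B2 := Rlt_le_trans _ _ _ Hh (Rmin_r _ _)).
specialize (H h ltac:(lra)).
replace ((f (x + h) - f x) / h - l) with ((f (x + h) - f x - h * l) / h) by (field; exact Hh0).
assert (Hp := Rabs_pos_lt h Hh0).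
unfold Rdiv; rewrite Rabs_mult, Rabs_inv.
apply Rmult_lt_reg_r with (Rabs h); [exact Hp|]; rewrite Rmult_assoc, Rinv_l, Rmult_1_r by lra.
apply (Rmult_lt_compat_l (K + 1)) in B2; [|lra].
replace ((K + 1) * (eps / (K + 1))) with eps in B2 by (field; lra).
simpl in H; nra.
Qed.

Lemma is_derive_Laplace_sigma (c : R) (v : C -> C) (sigma t : R) : 0 < c -> weight c v ->
  is_derive (fun x : R => Laplace c v (x + Ci * t)%C) sigma
    (Laplace c (fun x => (- (1) * Clog x * v x)%C) (sigma + Ci * t)%C).
Proof.
intros Hc Hw; destruct (Laplace_expand c v (sigma + Ci * t)%C Hc Hw) as [K [HK H]].
apply is_derive_of_quadratic with K; [exact HK|]; intros h Hh.
specialize (H h 0 ltac:(rewrite Rabs_R0; lra)); rewrite Rabs_R0, Rplus_0_r, Rmult_0_l, Rplus_0_r in H.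
replace (RtoC (sigma + h) + Ci * t)%C with (sigma + Ci * t + (h + Ci * 0))%C by (rewrite RtoC_plus; ring).
exact H.
Qed.

Lemma is_derive_Laplace_t (c : R) (v : C -> C) (sigma t : R) : 0 < c -> weight c v ->
  is_derive (fun y : R => Laplace c v (sigma + Ci * y)%C) t
    (Laplace c (fun x => (- Ci * Clog x * v x)%C) (sigma + Ci * t)%C).
Proof.
intros Hc Hw; destruct (Laplace_expand c v (sigma + Ci * t)%C Hc Hw) as [K [HK H]].
apply is_derive_of_quadratic with K; [exact HK|]; intros h Hh.
specialize (H 0 h ltac:(rewrite Rabs_R0; lra)); rewrite Rabs_R0, !Rplus_0_l, Rmult_0_l, Rplus_0_l in H.
replace (sigma + Ci * RtoC (t + h))%C with (sigma + Ci * t + (0 + Ci * h))%C by (rewrite RtoC_plus; ring).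
exact H.
Qed.

Lemma Laplace_continuity_2d (c : R) (v : C -> C) (sigma t : R) : 0 < c -> weight c v ->
  continuity_2d_pt (fun x y => Laplace c v (x + Ci * y)%C) sigma t.
Proof.
intros Hc Hw eps; destruct (Laplace_expand c v (sigma + Ci * t)%C Hc Hw) as [K [HK H]].
set (l1 := Laplace c (fun x => (- (1) * Clog x * v x)%C) _) in H; set (l2 := Laplace c (fun x => (- Ci * Clog x * v x)%C) _) in H.
set (M := Rabs l1 + Rabs l2 + K + 1).
assert (HM : 0 < M) by (unfold M; generalize (Rabs_pos l1) (Rabs_pos l2); lra).
assert (Hd : 0 < Rmin (1 / 2) (eps / (2 * M))).
{ apply Rmin_pos; [lra|]; apply Rdiv_lt_0_compat; [apply cond_pos | lra]. }
exists (mkposreal _ Hd); intros x y Hx Hy; simpl in Hx, Hy.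
assert (X1 := Rlt_le_trans _ _ _ Hx (Rmin_l _ _)); assert (X2 := Rlt_le_trans _ _ _ Hx (Rmin_r _ _)).
assert (Y1 := Rlt_le_trans _ _ _ Hy (Rmin_l _ _)); assert (Y2 := Rlt_le_trans _ _ _ Hy (Rmin_r _ _)).
specialize (H (x - sigma) (y - t) ltac:(lra)).
replace (sigma + Ci * t + (RtoC (x - sigma) + Ci * RtoC (y - t)))%C with (x + Ci * y)%C in H
  by (rewrite !RtoC_minus; ring).
set (a := x - sigma) in *; set (b := y - t) in *.
assert (Ha := Rabs_pos a); assert (Hb := Rabs_pos b).
assert (L : Rabs (a * l1 + b * l2) <= (Rabs a + Rabs b) * (Rabs l1 + Rabs l2)).
{ eapply Rle_trans; [apply Rabs_triang|]; rewrite !Rabs_mult.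
  generalize (Rabs_pos l1) (Rabs_pos l2); nra. }
assert (T := Rabs_triang (Laplace c v (x + Ci * y)%C - Laplace c v (sigma + Ci * t)%C - (a * l1 + b * l2)) (a * l1 + b * l2)).
replace (Laplace c v (x + Ci * y)%C - Laplace c v (sigma + Ci * t)%C - (a * l1 + b * l2) + (a * l1 + b * l2))
  with (Laplace c v (x + Ci * y)%C - Laplace c v (sigma + Ci * t)%C) in T by ring.
assert (Q : K * (Rabs a + Rabs b) ^ 2 <= (Rabs a + Rabs b) * K).
{ replace (K * (Rabs a + Rabs b) ^ 2) with ((Rabs a + Rabs b) * K * (Rabs a + Rabs b)) by ring.
  assert (P : 0 <= (Rabs a + Rabs b) * K) by (apply Rmult_le_pos; lra).
  rewrite <- (Rmult_1_r ((Rabs a + Rabs b) * K)) at 2; apply Rmult_le_compat_l; lra. }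
apply Rle_lt_trans with (1 := T).
apply Rle_lt_trans with ((Rabs a + Rabs b) * M); [unfold M; lra|].
assert (E : pos eps = (eps / (2 * M) + eps / (2 * M)) * M) by (field; lra).
rewrite E; apply Rmult_lt_compat_r; lra.
Qed.

Definition Raux_weight (k x : C) : C := (k * ((1 + Ci) * (Cexp (PI * Ci * (x * x)) * / Rden x)))%C.

Lemma weight_Raux (c : R) (k : C) : 0 < c < 1 -> weight c (Raux_weight k).
Proof.
intros Hc; unfold Raux_weight; apply weight_scal, weight_scal.
assert (Hc' : INR 0 < c < INR 0 + 1) by (simpl; lra).
split.
- intros u; eexists; apply holo_mult.
  + apply (holo_comp Cexp (fun y => (PI * Ci * (y * y))%C)); [apply holo_Cexp|].
    apply holo_scal, holo_mult; apply holo_id.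
  + apply holo_inv; [apply (den_line_neq_0 0); exact Hc' | apply holo_den].
- intros S HS; destruct (line_decay c c S ltac:(lra) ltac:(lra) HS) as [K [HK H]].
  destruct (den_line_lower 0 c Hc') as [m [Hm D]].
  exists (K / m); intros u; specialize (H c u ltac:(lra)); specialize (D u).
  rewrite Cmod_mult, Cmod_gauss_line, Cmod_inv by (apply (den_line_neq_0 0); exact Hc').
  rewrite <- Rmult_assoc.
  replace (K / m * exp (- Rabs u)) with (K * exp (- Rabs u) * / m) by (field; lra).
  apply Rmult_le_compat; [apply Rmult_le_pos; left; apply exp_pos | | exact H | apply Rinv_le_contravar; auto].
  left; apply Rinv_0_lt_compat; lra.
Qed.

Lemma Re_Raux_Laplace (k s : C) (c : R) : 0 < c < 1 ->
  Re (k * Raux c s)%C = - Laplace c (Raux_weight k) s.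
Proof.
intros Hc; rewrite Re_Raux by exact Hc; f_equal; apply II_ext; intros u.
unfold Gline, Raux_weight; f_equal; rewrite Raux_integrand_eq; unfold Rnum, Cpower; ring.
Qed.

Definition dRaux (c : R) (k s : C) : R := - Laplace c (fun x => (- (1) * Clog x * Raux_weight k x)%C) s.

Lemma is_derive_Raux_sigma (c : R) (k : C) (sigma t : R) : 0 < c < 1 ->
  is_derive (fun x : R => Re (k * Raux c (x + Ci * t))%C) sigma (dRaux c k (sigma + Ci * t)%C).
Proof.
intros Hc; apply (is_derive_ext (fun x : R => opp (Laplace c (Raux_weight k) (x + Ci * t)%C))).
{ intros x; symmetry; apply Re_Raux_Laplace; exact Hc. }
apply (is_derive_opp (V := R_NormedModule)), is_derive_Laplace_sigma; [lra | apply weight_Raux; exact Hc].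
Qed.

(** The t-derivative is i times the sigma-derivative; putting this i into the multiplier states the
    Cauchy-Riemann equations through [dRaux] alone. *)
Lemma is_derive_Raux_t (c : R) (k : C) (sigma t : R) : 0 < c < 1 ->
  is_derive (fun y : R => Re (k * Raux c (sigma + Ci * y))%C) t (dRaux c (Ci * k) (sigma + Ci * t)%C).
Proof.
intros Hc; apply (is_derive_ext (fun y : R => opp (Laplace c (Raux_weight k) (sigma + Ci * y)%C))).
{ intros x; symmetry; apply Re_Raux_Laplace; exact Hc. }
replace (dRaux c (Ci * k) (sigma + Ci * t)%C)
  with (opp (Laplace c (fun x => (- Ci * Clog x * Raux_weight k x)%C) (sigma + Ci * t)%C)).
- apply (is_derive_opp (V := R_NormedModule)), is_derive_Laplace_t; [lra | apply weight_Raux; exact Hc].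
- unfold dRaux, opp; simpl; f_equal; apply II_ext; intros u; f_equal; unfold Raux_weight; ring.
Qed.

Lemma Raux_continuity_2d (c : R) (k : C) (sigma t : R) : 0 < c < 1 ->
  continuity_2d_pt (fun x y => Re (k * Raux c (x + Ci * y))%C) sigma t.
Proof.
intros Hc; apply continuity_2d_pt_ext with (fun x y => - Laplace c (Raux_weight k) (x + Ci * y)%C).
{ intros x y; symmetry; apply Re_Raux_Laplace; exact Hc. }
apply continuity_2d_pt_opp, Laplace_continuity_2d; [lra | apply weight_Raux; exact Hc].
Qed.

Lemma dRaux_continuity_2d (c : R) (k : C) (sigma t : R) : 0 < c < 1 ->
  continuity_2d_pt (fun x y => dRaux c k (x + Ci * y)%C) sigma t.
Proof.
intros Hc; apply continuity_2d_pt_opp, (Laplace_continuity_2d c); [lra|].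
apply weight_mult_Clog; [lra | apply weight_Raux; exact Hc].
Qed.

Lemma dRaux_opp (c : R) (k s : C) : 0 < c < 1 -> dRaux c (- k) s = - dRaux c k s.
Proof.
intros Hc; unfold dRaux; f_equal.
assert (H := Laplace_lin c (fun x => (- (1) * Clog x * Raux_weight k x)%C)
  (fun x => (- (1) * Clog x * Raux_weight k x)%C) (-1) 0 s ltac:(lra)).
assert (W : weight c (fun x => (- (1) * Clog x * Raux_weight k x)%C))
  by (apply weight_mult_Clog; [lra | apply weight_Raux; exact Hc]).
specialize (H W W); rewrite Rmult_0_l, Rplus_0_r in H.
replace (- Laplace c (fun x => (- (1) * Clog x * Raux_weight k x)%C) s)
  with (-1 * Laplace c (fun x => (- (1) * Clog x * Raux_weight k x)%C) s) by ring.
rewrite <- H; apply II_ext; intros u; f_equal; unfold Raux_weight.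
replace (RtoC (-1)) with (- (1))%C by (apply C_eq; simpl; ring); ring.
Qed.

(** * Lipschitz bounds and decay from a derivative *)

Lemma Rabs_atan_sub_le (x y : R) : Rabs (atan x - atan y) <= Rabs (x - y).
Proof.
assert (P : forall x y, x < y -> 0 <= atan y - atan x <= y - x).
{ clear; intros x y H.
  destruct (MVT_gen atan x y (fun u => / (1 + u ^ 2))) as [c [_ E]].
  - intros u _; apply is_derive_Reals; apply derivable_pt_lim_atan.
  - intros u _; apply derivable_continuous_pt; apply derivable_pt_atan.
  - rewrite E.
    assert (Hc := pow2_ge_0 c).
    assert (/ (1 + c ^ 2) <= 1) by (rewrite <- Rinv_1; apply Rinv_le_contravar; lra).
    assert (0 < / (1 + c ^ 2)) by (apply Rinv_0_lt_compat; lra). nra. }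
destruct (Rtotal_order x y) as [H|[->|H]].
- rewrite (Rabs_minus_sym (atan x)), (Rabs_minus_sym x), !Rabs_pos_eq; apply P in H; lra.
- rewrite !Rminus_diag, Rabs_R0; lra.
- rewrite !Rabs_pos_eq; apply P in H; lra.
Qed.

Lemma Rabs_ln_le (y d : R) : 0 < d <= 1 -> d <= y -> Rabs (ln y) <= Rabs (y - 1) / d.
Proof.
intros Hd Hy.
assert (L1 := ln_le_sub_1 y ltac:(lra)).
assert (L2 := ln_le_sub_1 (/ y) (Rinv_0_lt_compat y ltac:(lra))); rewrite ln_Rinv in L2 by lra.
assert (HA := Rabs_pos (y - 1)).
assert (I : 1 <= / d) by (rewrite <- Rinv_1; apply Rinv_le_contravar; lra).
apply Rabs_le; split.
- assert (/ y - 1 <= Rabs (y - 1) / d); [|lra].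
  replace (/ y - 1) with ((1 - y) * / y) by (field; lra).
  assert (B : 1 - y <= Rabs (y - 1)) by (rewrite Rabs_minus_sym; apply Rle_abs).
  assert (0 < / y) by (apply Rinv_0_lt_compat; lra).
  assert (/ y <= / d) by (apply Rinv_le_contravar; lra).
  apply Rle_trans with (Rabs (y - 1) * / y); [apply Rmult_le_compat_r; lra | apply Rmult_le_compat_l; lra].
- generalize (Rle_abs (y - 1)); unfold Rdiv; nra.
Qed.

Lemma Rpower2_pos (x : R) : 0 < Rpower 2 x.
Proof. apply exp_pos. Qed.

Lemma is_derive_Rpower2 (x : R) : is_derive (fun x => Rpower 2 (- x)) x (- ln 2 * Rpower 2 (- x)).
Proof. unfold Rpower; auto_derive; [trivial|]; ring. Qed.

Lemma ln2_pos : 0 < ln 2.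
Proof. rewrite <- ln_1; apply ln_increasing; lra. Qed.

Lemma Rpower2_small (eps : R) : 0 < eps -> exists A, forall x, A <= x -> Rpower 2 (- x) < eps.
Proof.
intros He; destruct (exp_neg_small eps He) as [A [HA H]].
exists (A / ln 2); intros x Hx; unfold Rpower; assert (L := ln2_pos).
replace (- x * ln 2) with (- (x * ln 2)) by ring; apply H.
apply (Rmult_le_compat_r (ln 2)) in Hx; [|lra].
replace (A / ln 2 * ln 2) with A in Hx by (field; lra); exact Hx.
Qed.

(** [B] ensures that J tends to 0 and is absent from the conclusion. It may therefore depend on the
    interval of integration, while [M] does not. *)
Lemma decay_of_derivative (J J' : R -> R) (a b M B : R) : a < b -> 0 <= M ->
  (forall x, a < x -> is_derive J x (J' x)) ->
  (forall x, a < x -> Rabs (J' x) <= M * Rpower 2 (- x)) ->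
  (forall x, a < x -> Rabs (J x) <= B * Rpower 2 (- x)) ->
  Rabs (J b) <= M / ln 2 * Rpower 2 (- b).
Proof.
intros Hab HM HJ HJ' HB; assert (L := ln2_pos).
assert (P : forall e, (e = 1 \/ e = -1) -> forall y, b < y ->
  e * (J y - J b) <= M / ln 2 * Rpower 2 (- b) - M / ln 2 * Rpower 2 (- y)).
{ intros e He y Hy.
  (* The added term has derivative - M 2^(-x), so g is nonincreasing for either sign e. *)
  set (g := fun x => e * J x + M / ln 2 * Rpower 2 (- x)).
  assert (Hg : forall x, a < x -> is_derive g x (e * J' x + M / ln 2 * (- ln 2 * Rpower 2 (- x)))).
  { intros x Hx; unfold g; apply (is_derive_plus (V := R_NormedModule)).
    - apply (is_derive_scal J x e); apply HJ; exact Hx.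
    - apply (is_derive_scal (fun x => Rpower 2 (- x)) x (M / ln 2)); apply is_derive_Rpower2. }
  destruct (MVT_gen g b y (fun x => e * J' x + M / ln 2 * (- ln 2 * Rpower 2 (- x)))) as [x [Hx E]].
  - intros x Hx; rewrite Rmin_left, Rmax_right in Hx by lra; apply Hg; lra.
  - intros x Hx; rewrite Rmin_left, Rmax_right in Hx by lra.
    apply continuity_pt_filterlim, (ex_derive_continuous (V := R_NormedModule) g x); eexists; apply Hg; lra.
  - rewrite Rmin_left, Rmax_right in Hx by lra.
    assert (D : e * J' x + M / ln 2 * (- ln 2 * Rpower 2 (- x)) <= 0).
    { replace (M / ln 2 * (- ln 2 * Rpower 2 (- x))) with (- (M * Rpower 2 (- x))) by (field; lra).
      assert (Q := proj1 (Rabs_le_between _ _) (HJ' x ltac:(lra))).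
      destruct He as [-> | ->]; lra. }
    assert (g y - g b <= 0) by (rewrite E; nra).
    unfold g in H; lra. }
apply Rnot_lt_le; intros N.
set (d := Rabs (J b) - M / ln 2 * Rpower 2 (- b)) in *.
assert (Hd : 0 < d) by (unfold d; lra).
assert (HB0 : 0 <= B).
{ generalize (HB b Hab) (Rabs_pos (J b)) (Rpower2_pos (- b)); nra. }
destruct (Rpower2_small (d / (B + 1)) ltac:(apply Rdiv_lt_0_compat; lra)) as [A HA].
set (y := Rmax A (b + 1)).
assert (Hy : b < y) by (generalize (Rmax_r A (b + 1)); fold y; lra).
specialize (HA y (Rmax_l _ _)).
assert (Q1 := P 1 (or_introl eq_refl) y Hy); assert (Q2 := P (-1) (or_intror eq_refl) y Hy).
assert (Q3 := HB y ltac:(lra)).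
assert (R0 := Rpower2_pos (- y)).
assert (B * Rpower 2 (- y) < d).
{ replace d with ((B + 1) * (d / (B + 1))) by (field; lra). nra. }
assert (0 <= M / ln 2) by (apply Rdiv_le_0_compat; lra).
assert (0 <= M / ln 2 * Rpower 2 (- y)) by nra.
apply Rabs_le_between in Q3.
assert (Rabs (J b) < M / ln 2 * Rpower 2 (- b) + d) by (apply Rabs_def1; lra).
unfold d in *; lra.
Qed.

(** * From a half-plane bound to the integral of the logarithm *)

(* Found numerically: this rotation sends all the values of [Raux c s], [3 <= Re s], [1 <= Im s], into
   the half-plane [1 / 50 <= Re z]. *)
Definition theta0 : R := 9 / 20.
Definition rot : C := (cos theta0, sin theta0).

(** The left side is 1 - theta0^2 / 2. *)
Lemma cos_theta0 : 9 / 10 - 1/ 800 <= cos theta0.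
Proof.
assert (H := pre_cos_bound theta0 0 ltac:(unfold theta0; lra) ltac:(unfold theta0; lra)).
destruct H as [H _]; unfold theta0 in *; eapply Rle_trans; [|exact H].
unfold cos_approx, cos_term; simpl; lra.
Qed.

Lemma rot_norm : (cos theta0)² + (sin theta0)² = 1.
Proof. rewrite Rplus_comm; apply sin2_cos2. Qed.

Section Deduction.

Variables (c : R) (K delta : R).
Hypothesis Hc : 0 < c < 1.
Hypothesis Hdelta : 0 < delta <= 1.
Hypothesis Hsmall : forall sigma t, 3 <= sigma -> 1 <= t ->
  Cmod (Raux c (sigma + Ci * t) - 1) <= K * Rpower 2 (- sigma).
Hypothesis Hhalf : forall sigma t, 3 <= sigma -> 1 <= t ->
  delta <= Re (rot * Raux c (sigma + Ci * t))%C.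

(** The multiplier - i turns a real part into an imaginary part, so X + i Y is the rotated function
    [rot * Raux c]. *)
Let X (x y : R) : R := Re (rot * Raux c (x + Ci * y))%C.
Let Y (x y : R) : R := Re (- Ci * rot * Raux c (x + Ci * y))%C.
Let dX (x y : R) : R := dRaux c rot (x + Ci * y)%C.
Let dY (x y : R) : R := dRaux c (- Ci * rot) (x + Ci * y)%C.

Lemma K_nonneg : 0 <= K.
Proof using Hsmall.
assert (H := Hsmall 3 1 ltac:(lra) ltac:(lra)).
generalize (Cmod_ge_0 (Raux c (3 + Ci * 1) - 1)) (Rpower2_pos (- (3))); intros; nra.
Qed.

Lemma X2Y2 (x y : R) : X x y ^ 2 + Y x y ^ 2 = Cmod (Raux c (x + Ci * y)) ^ 2.
Proof using.
rewrite Cmod2_alt; unfold X, Y; generalize (Raux c (x + Ci * y)); intros [p q].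
replace (Re (rot * (p, q))%C) with (cos theta0 * p - sin theta0 * q) by (simpl; ring).
replace (Re (- Ci * rot * (p, q))%C) with (sin theta0 * p + cos theta0 * q) by (simpl; ring).
change (Re (p, q)) with p; change (Im (p, q)) with q.
transitivity (((cos theta0)² + (sin theta0)²) * (p ^ 2 + q ^ 2)); [unfold Rsqr; ring|].
rewrite rot_norm; ring.
Qed.

Lemma Raux_neq_0 (x y : R) : 3 <= x -> 1 <= y -> delta <= Cmod (Raux c (x + Ci * y)).
Proof using Hc Hhalf Hdelta.
intros Hx Hy; assert (H := Hhalf x y Hx Hy); fold (X x y) in H.
apply Rsqr_incr_0_var; [|apply Cmod_ge_0]; rewrite !Rsqr_pow2, <- X2Y2.
generalize (pow2_ge_0 (Y x y)); nra.
Qed.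

Lemma ln_Cmod_Raux (x y : R) : ln (Cmod (Raux c (x + Ci * y))) = / 2 * ln (X x y ^ 2 + Y x y ^ 2) \/ Cmod (Raux c (x + Ci * y)) = 0.
Proof using.
destruct (Cmod_ge_0 (Raux c (x + Ci * y))) as [H|H]; [left | right; auto].
rewrite X2Y2; simpl; rewrite Rmult_1_r, ln_mult by assumption; field.
Qed.

Lemma dX_t (x y : R) : is_derive (fun y => X x y) y (- dY x y).
Proof using Hc.
unfold X, dY; assert (H := is_derive_Raux_t c rot x y Hc).
replace (- Ci * rot)%C with (- (Ci * rot))%C by ring; rewrite dRaux_opp, Ropp_involutive by exact Hc; exact H.
Qed.

Lemma dY_t (x y : R) : is_derive (fun y => Y x y) y (dX x y).
Proof using Hc.
unfold Y, dX; assert (H := is_derive_Raux_t c (- Ci * rot) x y Hc).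
replace (Ci * (- Ci * rot))%C with rot in H; [exact H|].
replace (Ci * (- Ci * rot))%C with (- (Ci * Ci) * rot)%C by ring.
apply C_eq; simpl; ring.
Qed.

(* [P + i Q] is a logarithm of [rot * Raux c], and [D] is both [dP/dx] and [dQ/dy]. *)
Let P (x y : R) : R := ln (Cmod (Raux c (x + Ci * y))).
Let Q (x y : R) : R := atan (Y x y / X x y).
Let D (x y : R) : R := (X x y * dX x y + Y x y * dY x y) * / (X x y ^ 2 + Y x y ^ 2).

Lemma X2Y2_pos (x y : R) : 0 < Cmod (Raux c (x + Ci * y)) -> 0 < X x y ^ 2 + Y x y ^ 2.
Proof using. intros H; rewrite X2Y2; apply pow_lt; exact H. Qed.

Lemma is_derive_P (x y : R) : 3 < x -> 1 <= y -> is_derive (fun x => P x y) x (D x y).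
Proof using Hc Hdelta Hhalf.
intros Hx Hy.
apply is_derive_ext_loc with (fun x => / 2 * ln (X x y ^ 2 + Y x y ^ 2)).
- assert (H3 : 0 < x - 3) by lra; exists (mkposreal _ H3); intros z Hz.
  apply Rabs_lt_between in Hz; simpl in Hz; unfold P.
  destruct (ln_Cmod_Raux z y) as [E|E]; [symmetry; exact E|].
  assert (B := Raux_neq_0 z y ltac:(unfold minus, plus, opp in Hz; simpl in Hz; lra) Hy); lra.
- assert (HX := is_derive_Raux_sigma c rot x y Hc).
  assert (HY := is_derive_Raux_sigma c (- Ci * rot) x y Hc).
  fold (dX x y) in HX; fold (dY x y) in HY.
  assert (B := Raux_neq_0 x y ltac:(lra) Hy).
  assert (HP := X2Y2_pos x y ltac:(lra)).
  apply (is_derive_ext (fun x => / 2 * ln (X x y * X x y + Y x y * Y x y))); [intros; do 2 f_equal; ring|].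
  evar (l : R); replace (D x y) with l.
  + apply (is_derive_scal (fun x => ln (X x y * X x y + Y x y * Y x y)) x (/ 2)).
    apply (is_derive_comp (V := R_NormedModule) ln (fun x => X x y * X x y + Y x y * Y x y)).
    * apply is_derive_Reals, derivable_pt_lim_ln; replace (X x y * X x y + Y x y * Y x y) with (X x y ^ 2 + Y x y ^ 2) by ring; exact HP.
    * apply (is_derive_plus (V := R_NormedModule)); apply (is_derive_mult (K := R_AbsRing)); eauto; intros; apply Rmult_comm.
  + unfold l, D, scal, plus, mult; simpl; unfold mult; simpl; field; nra.
Qed.

Lemma is_derive_Q (x y : R) : 3 <= x -> 1 <= y -> is_derive (fun y => Q x y) y (D x y).
Proof using Hc Hdelta Hhalf.
intros Hx Hy; assert (B := Hhalf x y Hx Hy); fold (X x y) in B.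
assert (HX := dX_t x y); assert (HY := dY_t x y).
evar (l : R); replace (D x y) with l.
- apply (is_derive_comp (V := R_NormedModule) atan (fun y => Y x y / X x y)).
  + apply is_derive_Reals, derivable_pt_lim_atan.
  + apply is_derive_div; [exact HY | exact HX | lra].
- unfold l, D, scal; simpl; unfold mult; simpl; field; nra.
Qed.

Lemma D_continuity (x y : R) : 3 <= x -> 1 <= y -> continuity_2d_pt D x y.
Proof using Hc Hdelta Hhalf.
intros Hx Hy.
assert (HP := X2Y2_pos x y ltac:(generalize (Raux_neq_0 x y Hx Hy); lra)).
assert (HX : continuity_2d_pt X x y) by exact (Raux_continuity_2d c rot x y Hc).
assert (HY : continuity_2d_pt Y x y) by exact (Raux_continuity_2d c (- Ci * rot) x y Hc).
assert (HdX : continuity_2d_pt dX x y) by exact (dRaux_continuity_2d c rot x y Hc).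
assert (HdY : continuity_2d_pt dY x y) by exact (dRaux_continuity_2d c (- Ci * rot) x y Hc).
unfold D; apply continuity_2d_pt_mult.
- apply continuity_2d_pt_plus; apply continuity_2d_pt_mult; assumption.
- apply continuity_2d_pt_inv; [|lra].
  apply continuity_2d_pt_ext with (fun x y => X x y * X x y + Y x y * Y x y); [intros; ring|].
  apply continuity_2d_pt_plus; apply continuity_2d_pt_mult; assumption.
Qed.

Lemma P_continuous (x y : R) : 3 < x -> 1 <= y -> continuous (P x) y.
Proof using Hc Hdelta Hhalf.
intros Hx Hy; assert (B := Raux_neq_0 x y ltac:(lra) Hy).
assert (HP := X2Y2_pos x y ltac:(lra)).
assert (HX := dX_t x y); assert (HY := dY_t x y).
apply continuous_ext with (fun y => / 2 * ln (X x y * X x y + Y x y * Y x y)).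
- intros z; destruct (ln_Cmod_Raux x z) as [E|E].
  + unfold P; rewrite E; do 2 f_equal; ring.
  + unfold P; replace (X x z * X x z + Y x z * Y x z) with (X x z ^ 2 + Y x z ^ 2) by ring.
    (* At a zero of [Raux c] both sides take the default value [ln 0 = 0], so the identity holds for
       every z. *)
    assert (L0 : ln 0 = 0) by (unfold ln; destruct (Rlt_dec 0 0) as [F|F]; [exfalso; lra | reflexivity]).
    rewrite X2Y2, E; replace (0 ^ 2) with 0 by ring; rewrite L0; apply Rmult_0_r.
- apply (ex_derive_continuous (V := R_NormedModule) (fun y => / 2 * ln (X x y * X x y + Y x y * Y x y)) y).
  eexists.
  apply (is_derive_scal (fun y => ln (X x y * X x y + Y x y * Y x y)) y (/ 2)).
  apply (is_derive_comp (V := R_NormedModule) ln (fun y => X x y * X x y + Y x y * Y x y)).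
  + apply is_derive_Reals, derivable_pt_lim_ln; replace (X x y * X x y + Y x y * Y x y) with (X x y ^ 2 + Y x y ^ 2) by ring; exact HP.
  + apply (is_derive_plus (V := R_NormedModule)); apply (is_derive_mult (K := R_AbsRing)); eauto; intros; apply Rmult_comm.
Qed.

(** Writing theta0 as the arctangent of its tangent, the difference of the two arguments of atan is
    (Y cos theta0 - X sin theta0) / (X cos theta0). The numerator undoes the rotation and equals Im
    (R - 1); the denominator is at least delta / 2. *)
Lemma Q_bound (x y : R) : 3 <= x -> 1 <= y -> Rabs (Q x y - theta0) <= 2 * K / delta * Rpower 2 (- x).
Proof using Hc Hdelta Hhalf Hsmall.
intros Hx Hy; assert (B := Hhalf x y Hx Hy); assert (S := Hsmall x y Hx Hy); fold (X x y) in B.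
assert (Ct := cos_theta0).
assert (E : atan (tan theta0) = theta0) by (apply atan_tan; unfold theta0; generalize PI_bounds; lra).
unfold Q; rewrite <- E at 1; eapply Rle_trans; [apply Rabs_atan_sub_le|].
assert (Im_eq : Y x y * cos theta0 - X x y * sin theta0 = Im (Raux c (x + Ci * y) - 1)).
{ unfold X, Y; generalize (Raux c (x + Ci * y)); intros [p q].
  replace (Re (rot * (p, q))%C) with (cos theta0 * p - sin theta0 * q) by (simpl; ring).
  replace (Re (- Ci * rot * (p, q))%C) with (sin theta0 * p + cos theta0 * q) by (simpl; ring).
  replace (Im ((p, q) - 1)%C) with q by (simpl; ring).
  transitivity (((cos theta0)² + (sin theta0)²) * q); [unfold Rsqr; ring|].
  rewrite rot_norm; ring. }
unfold tan.
replace (Y x y / X x y - sin theta0 / cos theta0)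
  with ((Y x y * cos theta0 - X x y * sin theta0) * / (X x y * cos theta0)) by (field; lra).
rewrite Im_eq, Rabs_mult.
assert (I := im_le_Cmod (Raux c (x + Ci * y) - 1)).
assert (HP : delta / 2 <= X x y * cos theta0) by nra.
rewrite Rabs_inv, (Rabs_pos_eq (X x y * cos theta0)) by lra.
replace (2 * K / delta * Rpower 2 (- x)) with (K * Rpower 2 (- x) * / (delta / 2)) by (field; lra).
apply Rmult_le_compat; [apply Rabs_pos | left; apply Rinv_0_lt_compat; lra | lra | apply Rinv_le_contravar; lra].
Qed.

Lemma P_bound (x y : R) : 3 <= x -> 1 <= y -> Rabs (P x y) <= K / delta * Rpower 2 (- x).
Proof using Hc Hdelta Hhalf Hsmall.
intros Hx Hy; assert (B := Raux_neq_0 x y Hx Hy); assert (S := Hsmall x y Hx Hy).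
unfold P; eapply Rle_trans; [apply (Rabs_ln_le _ delta Hdelta B)|].
replace (K / delta * Rpower 2 (- x)) with (K * Rpower 2 (- x) / delta) by (field; lra).
apply Rmult_le_compat_r; [left; apply Rinv_0_lt_compat; lra|].
eapply Rle_trans; [|exact S]; apply Rabs_le.
assert (T1 := Cmod_triang_rev (Raux c (x + Ci * y)) 1); assert (T2 := Cmod_triang_rev 1 (Raux c (x + Ci * y))).
rewrite Cmod_1 in T1, T2; rewrite Cmod_sub_sym in T2; lra.
Qed.

Lemma log_integral_bound (sigma t0 T : R) : 3 < sigma -> 1 <= t0 -> t0 < T ->
  ex_RInt (fun t => ln (Cmod (Raux c (sigma + Ci * t)))) t0 T /\
  Rabs (RInt (fun t => ln (Cmod (Raux c (sigma + Ci * t)))) t0 T)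
    <= 4 * K / delta / ln 2 * Rpower 2 (- sigma).
Proof using Hc Hdelta Hhalf Hsmall.
intros Hs Ht0 HT; assert (HK := K_nonneg).
assert (Hex : forall x, 3 < x -> ex_RInt (P x) t0 T).
{ intros x Hx; apply (ex_RInt_continuous (V := R_CompleteNormedModule)); intros t Ht.
  rewrite Rmin_left, Rmax_right in Ht by lra; apply P_continuous; lra. }
split; [exact (Hex sigma Hs)|].
(* 4 K / delta collects the deviation of Q from theta0 at the two ends; the bound growing with T -
   t0 occurs only as the [B] of the decay lemma. *)
apply (decay_of_derivative (fun x => RInt (P x) t0 T) (fun x => Q x T - Q x t0) 3 sigma
  (4 * K / delta) ((T - t0) * (K / delta)) Hs).
- apply Rdiv_le_0_compat; lra.
- intros x Hx; apply (is_derive_RInt_exact P Q D t0 T x); [lra | | | |].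
  + exists (x - 3); split; [lra|]; intros y Hy t Ht; apply Rabs_lt_between in Hy; apply is_derive_P; lra.
  + intros t Ht; apply is_derive_Q; lra.
  + intros t Ht; apply D_continuity; lra.
  + assert (H3 : 0 < x - 3) by lra; exists (mkposreal _ H3); intros z Hz.
    apply Rabs_lt_between in Hz; unfold minus, plus, opp in Hz; simpl in Hz; apply Hex; lra.
- intros x Hx.
  replace (Q x T - Q x t0) with ((Q x T - theta0) + - (Q x t0 - theta0)) by ring.
  eapply Rle_trans; [apply Rabs_triang|]; rewrite Rabs_Ropp.
  assert (B1 := Q_bound x T ltac:(lra) ltac:(lra)); assert (B2 := Q_bound x t0 ltac:(lra) ltac:(lra)).
  replace (4 * K / delta * Rpower 2 (- x))
    with (2 * K / delta * Rpower 2 (- x) + 2 * K / delta * Rpower 2 (- x)) by (field; lra); lra.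
- intros x Hx; rewrite Rmult_assoc; apply abs_RInt_le_const; [lra | apply Hex; exact Hx|].
  intros t Ht; apply P_bound; lra.
Qed.

End Deduction.

(** * Envelopes of the integrand *)

Lemma nondecreasing_of_derive (g dg : R -> R) (y : R) : 0 <= y ->
  (forall x, 0 <= x <= y -> is_derive g x (dg x)) -> (forall x, 0 <= x <= y -> 0 <= dg x) -> g 0 <= g y.
Proof.
intros [Hy| <-] Hd Hp; [|lra].
destruct (MVT_gen g 0 y dg) as [x [Hx E]].
- intros x Hx; rewrite Rmin_left, Rmax_right in Hx by lra; apply Hd; lra.
- intros x Hx; rewrite Rmin_left, Rmax_right in Hx by lra.
  apply continuity_pt_filterlim, (ex_derive_continuous (V := R_NormedModule) g x); eexists; apply Hd; lra.
- rewrite Rmin_left, Rmax_right in Hx by lra; specialize (Hp x Hx); nra.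
Qed.

Lemma exp_opp_le_quadratic (y : R) : 0 <= y -> exp (- y) <= 1 - y + y ^ 2 / 2.
Proof.
intros Hy.
assert (H := nondecreasing_of_derive (fun y => 1 - y + y ^ 2 / 2 - exp (- y)) (fun y => -1 + y + exp (- y)) y Hy).
cbv beta in H; rewrite Ropp_0, exp_0 in H.
enough (1 - 0 + 0 ^ 2 / 2 - 1 <= 1 - y + y ^ 2 / 2 - exp (- y)) by lra.
apply H; intros x Hx.
- auto_derive; [trivial | field].
- generalize (exp_ineq1_le (- x)); lra.
Qed.

(** The right side has derivative 1 / ((1 - z)^2 + z^2) >= 1. For z = w / c it is minus the argument
    of the point c - w - i w. *)
Lemma atan_frac_ge (z : R) : 0 <= z < 1 -> z <= atan (z / (1 - z)).
Proof.
intros Hz.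
assert (H := nondecreasing_of_derive (fun z => atan (z / (1 - z)) - z)
  (fun z => / (1 - 2 * z + 2 * z ^ 2) - 1) z (proj1 Hz)).
cbv beta in H; replace (0 / (1 - 0)) with 0 in H by field; rewrite atan_0 in H.
enough (0 - 0 <= atan (z / (1 - z)) - z) by lra.
apply H; intros x Hx.
- assert (0 < 1 - 2 * x + 2 * x ^ 2) by nra.
  auto_derive; [lra|]; simpl in *; field; split; [|lra]; apply Rgt_not_eq; simpl; nra.
- assert (0 < 1 - 2 * x + 2 * x ^ 2) by nra.
  assert (/ 1 <= / (1 - 2 * x + 2 * x ^ 2)) by (apply Rinv_le_contravar; [assumption | nra]).
  rewrite Rinv_1 in H1; lra.
Qed.

Lemma sin_half_odd_sqr (N : nat) (u : R) : sin (PI * (INR N + 1 / 2 + u)) ^ 2 = cos (PI * u) ^ 2.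
Proof.
induction N as [|N IH].
- simpl INR; replace (PI * (0 + 1 / 2 + u)) with (PI / 2 + PI * u) by field.
  rewrite <- cos_sin; reflexivity.
- rewrite S_INR; replace (PI * (INR N + 1 + 1 / 2 + u)) with (PI * (INR N + 1 / 2 + u) + PI) by ring.
  rewrite neg_sin, <- IH; ring.
Qed.

Lemma exp_3_2_ge : 4 <= exp (3 / 2).
Proof.
replace (3 / 2) with (INR 15 * (1 / 10)) by (simpl; field).
assert (E : forall n, exp (INR n * (1 / 10)) = exp (1 / 10) ^ n).
{ induction n as [|n IH]; [rewrite Rmult_0_l; apply exp_0|].
  rewrite S_INR, Rmult_plus_distr_r, exp_plus, IH, Rmult_1_l; simpl; ring. }
rewrite E; apply Rle_trans with ((1 + 1 / 10) ^ 15); [lra|].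
apply pow_incr; split; [lra | apply exp_ineq1_le].
Qed.

(** At a half-integer the sine becomes cos (PI u). For y = PI |u| <= PI / 4, 4 cos^2 y >= 2 cancels
    the cross term -2 of (exp y - exp (- y))^2; beyond, exp (2 y) >= 4 makes exp y - exp (- y) at
    least 3 / 4 exp y. *)
Lemma Cmod_den_half (N : nat) (u : R) :
  3 / 4 * exp (PI * Rabs u) <= Cmod (Rden (slope1_line (INR N + 1 / 2) u)).
Proof.
assert (HP := PI_bounds).
apply Rsqr_incr_0_var; [|apply Cmod_ge_0].
rewrite !Rsqr_pow2, Cmod_den_sqr, Re_slope1_line, Im_slope1_line, sin_half_odd_sqr.
assert (E : (exp (PI * u) - exp (- (PI * u))) ^ 2 =
  (exp (PI * Rabs u) - exp (- (PI * Rabs u))) ^ 2).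
{ unfold Rabs; destruct Rcase_abs; [|reflexivity].
  replace (PI * - u) with (- (PI * u)) by ring; rewrite Ropp_involutive; ring. }
assert (E2 : cos (PI * u) = cos (PI * Rabs u)).
{ unfold Rabs; destruct Rcase_abs; [|reflexivity].
  replace (PI * - u) with (- (PI * u)) by ring; rewrite cos_neg; reflexivity. }
rewrite E, E2; set (y := PI * Rabs u).
assert (Hy : 0 <= y) by (unfold y; generalize (Rabs_pos u); nra).
assert (P : exp y * exp (- y) = 1) by (rewrite <- exp_plus, Rplus_opp_r; apply exp_0).
assert (P1 := exp_pos y); assert (P2 := exp_pos (- y)).
destruct (Rle_lt_dec y (PI / 4)) as [H|H].
- assert (Hc : cos (PI / 4) <= cos y) by (apply cos_decr_1; lra).
  rewrite cos_PI4 in Hc.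
  assert (S2 : / 2 = (1 / sqrt 2) ^ 2).
  { unfold Rdiv; rewrite Rmult_1_l, pow_inv, pow2_sqrt; lra. }
  assert (S0 : 0 < 1 / sqrt 2) by (apply Rdiv_lt_0_compat; [lra | apply sqrt_lt_R0; lra]).
  assert (/ 2 <= cos y ^ 2) by (rewrite S2; apply pow_incr; lra).
  nra.
- assert (Q : exp (- y) * 4 <= exp y).
  { apply Rle_trans with (exp (- y) * exp (2 * y)).
    - apply Rmult_le_compat_l; [lra|].
      eapply Rle_trans; [apply exp_3_2_ge | apply exp_le_compat; lra].
    - rewrite <- exp_plus; apply exp_le_compat; lra. }
  assert (0 <= cos y ^ 2) by apply pow2_ge_0.
  assert (3 / 4 * exp y <= exp y - exp (- y)) by lra.
  assert ((3 / 4 * exp y) ^ 2 <= (exp y - exp (- y)) ^ 2) by (apply pow_incr; lra).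
  lra.
Qed.

Lemma Cmod_num_line (sigma t c u : R) :
  Cmod (Rnum (sigma + Ci * t) (slope1_line c u)) =
  exp (- sigma * ln (Cmod (slope1_line c u)) + t * Carg (slope1_line c u) - 2 * PI * (c + u) * u).
Proof.
unfold Rnum; rewrite Cmod_mult, Cmod_gauss_line; unfold Cpower; rewrite Cmod_Cexp, <- exp_plus.
f_equal; unfold Clog; simpl; ring.
Qed.

Lemma Cmod_1_Ci_eq : Cmod (1 + Ci) = sqrt 2.
Proof. unfold Cmod; f_equal; simpl; ring. Qed.

Lemma sqrt2_bounds : 7 / 5 < sqrt 2 < 14143 / 10000.
Proof.
split.
- rewrite <- (sqrt_pow2 (7 / 5)) by lra; apply sqrt_lt_1; lra.
- rewrite <- (sqrt_pow2 (14143 / 10000)) by lra; apply sqrt_lt_1; lra.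
Qed.

(** 189 / 100 exceeds 4 / 3 sqrt 2: the denominator bound times |1 + i|. *)
Lemma Gline_half_le (k : C) (sigma t : R) (N : nat) (u : R) : Cmod k = 1 ->
  let c := INR N + 1 / 2 in
  Rabs (Gline k (sigma + Ci * t) c u) <= 189 / 100 *
    exp (- sigma * ln (Cmod (slope1_line c u)) + t * Carg (slope1_line c u) - 2 * PI * (c + u) * u - PI * Rabs u).
Proof.
intros Hk c.
eapply Rle_trans; [apply re_le_Cmod|]; rewrite !Cmod_mult, Hk, Rmult_1_l, Cmod_1_Ci_eq.
assert (Hd := Cmod_den_half N u); fold c in Hd.
assert (E := exp_pos (PI * Rabs u)).
assert (Hn : Rden (slope1_line c u) <> 0) by (apply Cmod_gt_0; lra).
rewrite Cmod_Raux_integrand, Cmod_num_line by exact Hn.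
set (X := - sigma * _ + _ - _).
assert (I : / Cmod (Rden (slope1_line c u)) <= 4 / 3 * exp (- (PI * Rabs u))).
{ rewrite exp_Ropp; replace (4 / 3 * / exp (PI * Rabs u)) with (/ (3 / 4 * exp (PI * Rabs u))) by (field; lra).
  apply Rinv_le_contravar; lra. }
unfold Rminus at 1; rewrite (exp_plus X).
assert (HX := exp_pos X); assert (S := sqrt2_bounds); assert (E' := exp_pos (- (PI * Rabs u))).
apply Rle_trans with (exp X * (4 / 3 * exp (- (PI * Rabs u))) * sqrt 2).
- apply Rmult_le_compat_r; [lra|]; apply Rmult_le_compat_l; lra.
- assert (0 < exp X * exp (- (PI * Rabs u))) by (apply Rmult_lt_0_compat; assumption). nra.
Qed.

(** * Argument and modulus along a line *)

Lemma Carg_upper (c u : R) : 0 < c -> 0 <= u ->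
  Carg (slope1_line c u) = atan (u / (c + u)) /\ 0 <= Carg (slope1_line c u) <= u / (c + u).
Proof.
intros Hc Hu.
assert (E : Carg (slope1_line c u) = atan (u / (c + u))).
{ assert (H := Clog_right_half (slope1_line c u)); rewrite Re_slope1_line, Im_slope1_line in H.
  specialize (H ltac:(lra)); apply (f_equal snd) in H; exact H. }
assert (0 <= u / (c + u)) by (apply Rdiv_le_0_compat; lra).
rewrite E; split; [reflexivity | split; [apply atan_pos | apply atan_le_id]; assumption].
Qed.

Lemma Carg_lower_left (c w : R) : 0 < c -> c <= w -> Carg (slope1_line c (- w)) <= -1.
Proof.
intros Hc Hw; unfold Carg; rewrite Im_slope1_line, Re_slope1_line.
destruct (Rle_dec 0 (- w)); [lra|].
assert (Hz : slope1_line c (- w) <> 0) by (apply Cmod_gt_0; generalize (Cmod_line_bounds c (- w) Hc); lra).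
assert (Hm := proj1 (Cmod_gt_0 _) Hz).
assert (Q : (c + - w) / Cmod (slope1_line c (- w)) <= 0).
{ apply Rmult_le_reg_r with (Cmod (slope1_line c (- w))); [exact Hm|].
  unfold Rdiv; rewrite Rmult_assoc, Rinv_l by lra; lra. }
assert (B := Re_div_Cmod_bounds _ Hz); rewrite Re_slope1_line in B.
set (q := (c + - w) / _) in *.
assert (P : PI / 2 <= acos q).
{ apply Rnot_lt_le; intros N; assert (B2 := acos_bound q).
  assert (0 < cos (acos q)) by (apply cos_gt_0; generalize PI_bounds; lra).
  rewrite cos_acos in H; lra. }
generalize PI_bounds; lra.
Qed.

Lemma Carg_lower (c w : R) : 0 < c -> 0 <= w <= c -> Carg (slope1_line c (- w)) <= - (w / c).
Proof.
intros Hc Hw; destruct (Req_dec w c) as [->|Hne].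
- replace (c / c) with 1 by (field; lra); apply Carg_lower_left; lra.
- assert (H := Clog_right_half (slope1_line c (- w))); rewrite Re_slope1_line, Im_slope1_line in H.
  specialize (H ltac:(lra)); apply (f_equal snd) in H; simpl in H; rewrite H.
  assert (Hz : 0 <= w / c < 1).
  { split; [apply Rdiv_le_0_compat; lra|]; apply Rmult_lt_reg_r with c; [exact Hc|].
    unfold Rdiv; rewrite Rmult_assoc, Rinv_l; lra. }
  assert (Q := atan_frac_ge _ Hz).
  replace (- w / (c + - w)) with (- (w / c / (1 - w / c))) by (field; split; lra).
  rewrite atan_opp; lra.
Qed.

Lemma Carg_neg (c w : R) : 0 < c -> 0 <= w -> Carg (slope1_line c (- w)) <= 0.
Proof.
intros Hc Hw; destruct (Rle_lt_dec w c) as [H|H].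
- generalize (Carg_lower c w Hc (conj Hw H)) (Rdiv_le_0_compat w c Hw Hc); lra.
- generalize (Carg_lower_left c w Hc); lra.
Qed.

Lemma Cmod_line_sqr (c u : R) : Cmod (slope1_line c u) ^ 2 = (c + u) ^ 2 + u ^ 2.
Proof. apply Cmod_sqr_eq; [apply Re_slope1_line | apply Im_slope1_line]. Qed.

(** The distance from 0 to the line is c / sqrt 2. *)
Lemma ln_Cmod_line_ge (c u r : R) : 0 < r -> 2 * r ^ 2 <= c ^ 2 -> ln r <= ln (Cmod (slope1_line c u)).
Proof.
intros Hr Hc.
assert (H : r <= Cmod (slope1_line c u)).
{ apply Rsqr_incr_0_var; [|apply Cmod_ge_0]; rewrite !Rsqr_pow2, Cmod_line_sqr.
  generalize (pow2_ge_0 (u + c / 2)); nra. }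
destruct H as [H|H]; [left; apply ln_increasing; assumption | rewrite <- H; lra].
Qed.

(** With y = 2 w / c, the ratio |x|^2 / c^2 is exactly 1 - y + y^2 / 2, the quadratic that dominates
    exp (- y). *)
Lemma ln_Cmod_line_left (c w : R) : 0 < c -> 0 <= w ->
  ln c - w / c <= ln (Cmod (slope1_line c (- w))).
Proof.
intros Hc Hw.
assert (Hz : 0 <= w / c) by (apply Rdiv_le_0_compat; lra).
assert (H : c * exp (- (w / c)) <= Cmod (slope1_line c (- w))).
{ apply Rsqr_incr_0_var; [|apply Cmod_ge_0]; rewrite !Rsqr_pow2, Cmod_line_sqr.
  replace ((c * exp (- (w / c))) ^ 2) with (c ^ 2 * exp (- (2 * (w / c)))).
  - assert (Q := exp_opp_le_quadratic (2 * (w / c)) ltac:(lra)).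
    replace ((c + - w) ^ 2 + (- w) ^ 2) with (c ^ 2 * (1 - 2 * (w / c) + (2 * (w / c)) ^ 2 / 2)) by (field; lra).
    apply Rmult_le_compat_l; [apply pow2_ge_0 | exact Q].
  - replace (- (2 * (w / c))) with (- (w / c) + - (w / c)) by ring; rewrite exp_plus; ring. }
assert (P : 0 < c * exp (- (w / c))) by (apply Rmult_lt_0_compat; [exact Hc | apply exp_pos]).
assert (L : ln (c * exp (- (w / c))) = ln c - w / c).
{ rewrite ln_mult, ln_exp; [ring | exact Hc | apply exp_pos]. }
rewrite <- L; destruct H as [H|H]; [left; apply ln_increasing; assumption | rewrite <- H; lra].
Qed.

Lemma ln_Cmod_line_right (c u : R) : 0 < c -> 0 <= u -> ln c <= ln (Cmod (slope1_line c u)).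
Proof.
intros Hc Hu.
assert (H : c <= Cmod (slope1_line c u)).
{ apply Rsqr_incr_0_var; [|apply Cmod_ge_0]; rewrite !Rsqr_pow2, Cmod_line_sqr; nra. }
destruct H as [H|H]; [left; apply ln_increasing; assumption | rewrite <- H; lra].
Qed.

(** Completing the square. Trading the Gaussian for an exponential of chosen rate k turns a
    half-line integral into G / k. *)
Lemma parabola_envelope (a k y : R) : a * y - 2 * PI * y ^ 2 <= (a + k) ^ 2 / (8 * PI) - k * y.
Proof.
assert (HP := PI_bounds).
assert (0 <= (a + k - 4 * PI * y) ^ 2 / (8 * PI)) by (apply Rdiv_le_0_compat; [apply pow2_ge_0 | lra]).
replace ((a + k) ^ 2 / (8 * PI) - k * y)
  with (a * y - 2 * PI * y ^ 2 + (a + k - 4 * PI * y) ^ 2 / (8 * PI)) by (field; lra).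
lra.
Qed.

Lemma II_le_exp (K : R) (g : R -> R) (G1 k1 G2 k2 : R) : Edec K g ->
  0 < k1 -> 0 <= G1 -> 0 < k2 -> 0 <= G2 ->
  (forall u, 0 <= u -> Rabs (g u) <= G1 * exp (- k1 * u)) ->
  (forall w, 0 <= w -> Rabs (g (- w)) <= G2 * exp (- k2 * w)) ->
  Rabs (II g) <= G1 / k1 + G2 / k2.
Proof.
intros HE Hk1 HG1 Hk2 HG2 H1 H2.
assert (P : forall h, Edec K h -> (forall u, Rabs (h u) = Rabs (g u)) -> - (G1 / k1 + G2 / k2) <= II h).
{ intros h Hh Heq.
  assert (Q := II_lower K h 0 0 G1 k1 G2 k2 Hh Hk1 HG1 Hk2 HG2).
  rewrite RInt_point in Q; unfold zero in Q; simpl in Q.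
  enough (0 - G1 / k1 - G2 / k2 <= II h) by lra.
  apply Q.
  - intros u Hu; specialize (H1 u Hu); rewrite <- Heq in H1; rewrite Rminus_0_r.
    apply Rabs_le_between in H1; lra.
  - intros u Hu; specialize (H2 (- u) ltac:(lra)); rewrite Ropp_involutive, <- Heq in H2.
    replace (0 - u) with (- u) by ring; apply Rabs_le_between in H2; lra. }
assert (P1 := P g HE (fun _ => eq_refl)).
assert (P2 := P _ (Edec_opp _ _ HE) (fun u => Rabs_Ropp (g u))).
assert (E : II (fun u => - g u) = - II g).
{ rewrite (II_ext _ (fun u => -1 * g u + 0 * g u)) by (intros; ring).
  rewrite (II_lin K K) by assumption; ring. }
rewrite E in P2; apply Rabs_le; lra.
Qed.

(** * Bounds for the arctangent, PI and the partial sums *)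

Lemma atan_le_cubic (y : R) : 0 <= y -> y - y ^ 3 / 3 <= atan y.
Proof.
intros Hy.
assert (H := nondecreasing_of_derive (fun y => atan y - (y - y ^ 3 / 3)) (fun y => y ^ 4 / (1 + y ^ 2)) y Hy).
cbv beta in H; rewrite atan_0 in H.
enough (0 - (0 - 0 ^ 3 / 3) <= atan y - (y - y ^ 3 / 3)) by lra.
assert (P : forall x : R, 0 < 1 + x ^ 2) by (intros x; generalize (pow2_ge_0 x); lra).
apply H; intros x Hx; specialize (P x).
- auto_derive; [trivial|]; field; simpl in *; lra.
- apply Rdiv_le_0_compat; [|exact P]. replace (x ^ 4) with ((x ^ 2) ^ 2) by ring; apply pow2_ge_0.
Qed.

Lemma atan_bounds5 (y : R) : 0 <= y ->
  y - y ^ 3 / 3 + y ^ 5 / 5 - y ^ 7 / 7 <= atan y <= y - y ^ 3 / 3 + y ^ 5 / 5.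
Proof.
intros Hy.
assert (P : forall x : R, 0 < 1 + x ^ 2) by (intros x; generalize (pow2_ge_0 x); lra).
split.
- assert (H := nondecreasing_of_derive (fun y => atan y - (y - y ^ 3 / 3 + y ^ 5 / 5 - y ^ 7 / 7))
    (fun y => y ^ 8 / (1 + y ^ 2)) y Hy).
  cbv beta in H; rewrite atan_0 in H.
  enough (0 - (0 - 0 ^ 3 / 3 + 0 ^ 5 / 5 - 0 ^ 7 / 7) <= atan y - (y - y ^ 3 / 3 + y ^ 5 / 5 - y ^ 7 / 7)) by lra.
  apply H; intros x Hx; specialize (P x).
  + auto_derive; [trivial|]; field; simpl in *; lra.
  + apply Rdiv_le_0_compat; [|exact P]. replace (x ^ 8) with ((x ^ 4) ^ 2) by ring; apply pow2_ge_0.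
- assert (H := nondecreasing_of_derive (fun y => y - y ^ 3 / 3 + y ^ 5 / 5 - atan y)
    (fun y => y ^ 6 / (1 + y ^ 2)) y Hy).
  cbv beta in H; rewrite atan_0 in H.
  enough (0 - 0 ^ 3 / 3 + 0 ^ 5 / 5 - 0 <= y - y ^ 3 / 3 + y ^ 5 / 5 - atan y) by lra.
  apply H; intros x Hx; specialize (P x).
  + auto_derive; [trivial|]; field; simpl in *; lra.
  + apply Rdiv_le_0_compat; [|exact P]. replace (x ^ 6) with ((x ^ 3) ^ 2) by ring; apply pow2_ge_0.
Qed.

(** Machin's formula, with arctangents of 1 / 5 and 1 / 239. *)
Lemma PI_precise : 31415 / 10000 < PI < 31417 / 10000.
Proof.
assert (M := Machin_4_5_239).
assert (B1 := atan_bounds5 (/ 5) ltac:(lra)); assert (B2 := atan_bounds5 (/ 239) ltac:(lra)).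
lra.
Qed.

Lemma Cmod_Cpower_INR (n : nat) (sigma t : R) : (1 <= n)%nat ->
  Cmod (Cpower (INR n) (- (sigma + Ci * t))) = exp (- sigma * ln (INR n)).
Proof.
intros Hn; assert (Hn' : 1 <= INR n) by (apply (le_INR 1); exact Hn).
unfold Cpower; rewrite Cmod_Cexp, Clog_right_half by (simpl; lra); f_equal.
simpl; replace (0 / INR n) with 0 by (field; lra); rewrite atan_0, Cmod_R, Rabs_pos_eq by lra; ring.
Qed.

Lemma Cpower_1 (s : C) : Cpower (INR 1) (- s) = 1%C.
Proof.
unfold Cpower; rewrite Clog_right_half by (simpl; lra); simpl INR.
rewrite Cmod_R, Rabs_R1, ln_1; simpl; replace (0 / 1) with 0 by field; rewrite atan_0.
replace (- s * (0, 0))%C with (RtoC 0) by (apply C_eq; simpl; ring); apply Cexp_0.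
Qed.

Lemma exp_ln_pow3 (x : R) : 0 < x -> exp (- 3 * ln x) = / x ^ 3.
Proof.
intros Hx; replace (- 3 * ln x) with (- (ln x + ln x + ln x)) by ring.
rewrite exp_Ropp, !exp_plus, exp_ln by exact Hx; f_equal; ring.
Qed.

Lemma exp_ln_neg_decr (sigma x : R) : 3 <= sigma -> 1 <= x -> exp (- sigma * ln x) <= / x ^ 3.
Proof.
intros Hs Hx; rewrite <- exp_ln_pow3 by lra; apply exp_le_compat.
assert (0 <= ln x); [|nra].
rewrite <- ln_1; destruct Hx as [Hx| <-]; [left; apply ln_increasing; lra | lra].
Qed.

(* [(n / 2) ^ - sigma <= (n / 2) ^ - 3] and [sum_(2 <= n <= N) n ^ - 3] telescopes under
   [1 / (n - 1) n (n + 1)]. *)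
Lemma zeta_partial_bound (k : C) (sigma t : R) (N : nat) : 3 <= sigma -> (1 <= N)%nat -> Cmod k = 1 ->
  Rabs (zeta_partial k (sigma + Ci * t) N - Re k)
    <= 8 * (1 / 4 - / (2 * INR N * (INR N + 1))) * Rpower 2 (- sigma).
Proof.
intros Hs HN Hk; induction HN as [|N HN IH].
- change (zeta_partial k (sigma + Ci * t) 1) with (0 + Re (k * Cpower (INR 1) (- (sigma + Ci * t)))%C).
  rewrite Cpower_1; change (INR 1) with 1.
  replace (0 + Re (k * 1)%C - Re k) with 0 by (simpl; unfold Re; ring).
  rewrite Rabs_R0; right; field.
- assert (Hn : 1 <= INR N) by (apply (le_INR 1); exact HN).
  change (zeta_partial k (sigma + Ci * t) (S N))
    with (zeta_partial k (sigma + Ci * t) N + Re (k * Cpower (INR (S N)) (- (sigma + Ci * t)))%C).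
  assert (B : Rabs (Re (k * Cpower (INR (S N)) (- (sigma + Ci * t)))%C)
    <= 8 * / (INR N * (INR N + 1) * (INR N + 2)) * Rpower 2 (- sigma)).
  { eapply Rle_trans; [apply re_le_Cmod|].
    rewrite Cmod_mult, Hk, Rmult_1_l, Cmod_Cpower_INR, S_INR by lia.
    assert (E : - sigma * ln (INR N + 1) = - sigma * ln ((INR N + 1) / 2) + - sigma * ln 2).
    { rewrite ln_div by lra; ring. }
    rewrite E, exp_plus; apply Rmult_le_compat_r; [left; apply exp_pos|].
    eapply Rle_trans; [apply exp_ln_neg_decr; lra|].
    replace (/ ((INR N + 1) / 2) ^ 3) with (8 * / (INR N + 1) ^ 3) by (field; lra).
    apply Rmult_le_compat_l; [lra|]; apply Rinv_le_contravar; [|nra].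
    repeat apply Rmult_lt_0_compat; lra. }
  replace (zeta_partial k (sigma + Ci * t) N + Re (k * Cpower (INR (S N)) (- (sigma + Ci * t)))%C - Re k)
    with ((zeta_partial k (sigma + Ci * t) N - Re k) + Re (k * Cpower (INR (S N)) (- (sigma + Ci * t)))%C) by ring.
  eapply Rle_trans; [apply Rabs_triang|].
  replace (8 * (1 / 4 - / (2 * INR (S N) * (INR (S N) + 1))) * Rpower 2 (- sigma))
    with (8 * (1 / 4 - / (2 * INR N * (INR N + 1))) * Rpower 2 (- sigma) +
      8 * / (INR N * (INR N + 1) * (INR N + 2)) * Rpower 2 (- sigma)); [lra|].
  rewrite S_INR; field; lra.
Qed.

Lemma Rpower2_3 (sigma : R) : 3 <= sigma -> Rpower 2 (- sigma) <= 1 / 8.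
Proof.
intros H; eapply Rle_trans; [apply (exp_ln_neg_decr sigma 2 H); lra | lra].
Qed.

Lemma exp_3_2_le : exp (3 / 2) <= 26 / 5.
Proof.
apply Rsqr_incr_0_var; [|lra]; unfold Rsqr; rewrite <- exp_plus.
replace (3 / 2 + 3 / 2) with (1 + 1 + 1) by field; rewrite !exp_plus.
generalize exp_le_3 (exp_pos 1); intros.
assert (exp 1 * exp 1 <= 9) by nra. nra.
Qed.

(** * Integrals over the lines through 5 / 2, 7 / 2 and beyond *)

Lemma Iline_le (k s : C) (N : nat) (G1 k1 G2 k2 : R) :
  0 < k1 -> 0 <= G1 -> 0 < k2 -> 0 <= G2 ->
  (forall u, 0 <= u -> Rabs (Gline k s (INR N + 1 / 2) u) <= G1 * exp (- k1 * u)) ->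
  (forall w, 0 <= w -> Rabs (Gline k s (INR N + 1 / 2) (- w)) <= G2 * exp (- k2 * w)) ->
  Rabs (Iline k s (INR N + 1 / 2)) <= G1 / k1 + G2 / k2.
Proof.
intros Hk1 HG1 Hk2 HG2 H1 H2.
destruct (Edec_Gline k s N (INR N + 1 / 2) ltac:(lra)) as [K HE].
apply (II_le_exp K); assumption.
Qed.

Lemma slope_right (t c u : R) : 0 <= t -> 0 < c -> 0 <= u -> t * Carg (slope1_line c u) <= t / c * u.
Proof.
intros Ht Hc Hu; destruct (Carg_upper c u Hc Hu) as [_ [_ B]].
apply Rle_trans with (t * (u / (c + u))); [apply Rmult_le_compat_l; assumption|].
unfold Rdiv; rewrite Rmult_assoc; apply Rmult_le_compat_l; [exact Ht|].
rewrite (Rmult_comm (/ c)); apply Rmult_le_compat_l; [exact Hu|]; apply Rinv_le_contravar; lra.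
Qed.

Lemma exp_bound_of (G X Y Z : R) : 0 <= G -> X <= Y + Z -> G * exp X <= G * exp Y * exp Z.
Proof.
intros HG H; rewrite Rmult_assoc, <- exp_plus; apply Rmult_le_compat_l; [exact HG | apply exp_le_compat, H].
Qed.

(* Slightly below [(7 / 2) / sqrt 2], the distance from 0 to the line through [7 / 2]. *)
Definition r3 : R := 247 / 100.

(** At u = 0 the exponent t arg x - 2 PI (c + u) u has slope t / c - 2 PI c, and the choice of N
    keeps it between - 2 PI and (2 + 1 / 7) PI. The decay exp (- PI |u|) of 1 / [Rden] takes PI off
    in either direction; what is left, at most 8 / 7 PI, is absorbed by the Gaussian. *)
Lemma Iline_large (k : C) (sigma t : R) (N : nat) : Cmod k = 1 -> 0 <= sigma -> (3 <= N)%nat ->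
  2 * PI * INR N ^ 2 <= t <= 2 * PI * (INR N + 1) ^ 2 ->
  Rabs (Iline k (sigma + Ci * t) (INR N + 1 / 2)) <= 787 / 100 * exp (- sigma * ln r3).
Proof.
intros Hk Hs HN Ht.
assert (HP := PI_precise).
assert (Hn : 3 <= INR N) by (apply (le_INR 3) in HN; simpl in HN; lra).
set (c := INR N + 1 / 2).
assert (Hc : 7 / 2 <= c) by (unfold c; lra).
assert (Ht0 : 0 <= t) by nra.
(* 2 (c + 1 / 2)^2 = 2 c^2 + 2 c + 1 / 2, and c / 7 covers the 1 / 2 because c >= 7 / 2. *)
assert (T1 : t / c <= (2 * c + 2 + 1 / 7) * PI).
{ apply Rmult_le_reg_r with c; [lra|]; replace (t / c * c) with t by (field; lra).
  apply Rle_trans with (1 := proj2 Ht).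
  replace (2 * PI * (INR N + 1) ^ 2) with (2 * (c + 1 / 2) ^ 2 * PI) by (unfold c; field).
  replace ((2 * c + 2 + 1 / 7) * PI * c) with ((2 * c + 2 + 1 / 7) * c * PI) by ring.
  apply Rmult_le_compat_r; [lra | nra]. }
assert (T2 : (2 * c - 2) * PI <= t / c).
{ apply Rmult_le_reg_r with c; [lra|]; replace (t / c * c) with t by (field; lra).
  apply Rle_trans with (2 := proj1 Ht).
  replace (2 * PI * INR N ^ 2) with (2 * (c - 1 / 2) ^ 2 * PI) by (unfold c; field).
  replace ((2 * c - 2) * PI * c) with ((2 * c - 2) * c * PI) by ring.
  apply Rmult_le_compat_r; [lra | nra]. }
assert (L : forall u, - sigma * ln (Cmod (slope1_line c u)) <= - sigma * ln r3).
{ intros u; assert (Q := ln_Cmod_line_ge c u r3 ltac:(unfold r3; lra) ltac:(unfold r3; nra)); nra. }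
(* Slope 8 / 7 PI and rate 5 / 2 give a maximum of about 1.48; each half-line then contributes 189 /
   100 exp (3 / 2) / (5 / 2), at most 787 / 200. *)
assert (A : forall a y, 0 <= y -> a <= 8 / 7 * PI -> a * y - 2 * PI * y ^ 2 <= 3 / 2 - 5 / 2 * y).
{ intros a y Hy Ha.
  assert (P := parabola_envelope (8 / 7 * PI) (5 / 2) y).
  assert (Q : (8 / 7 * PI + 5 / 2) ^ 2 / (8 * PI) <= 3 / 2).
  { apply Rmult_le_reg_r with (8 * PI); [lra|]; unfold Rdiv at 1; rewrite Rmult_assoc, Rinv_l, Rmult_1_r by lra; nra. }
  assert (a * y <= 8 / 7 * PI * y) by (apply Rmult_le_compat_r; assumption). lra. }
replace (787 / 100 * exp (- sigma * ln r3)) with (787 / 200 * exp (- sigma * ln r3) + 787 / 200 * exp (- sigma * ln r3)) by field.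
set (X := exp (- sigma * ln r3)) in *.
assert (HX : 0 < X) by apply exp_pos.
assert (E3 := exp_3_2_le).
assert (K1 : 189 / 100 * X * exp (3 / 2) / (5 / 2) <= 787 / 200 * X) by nra.
eapply Rle_trans; [apply (Iline_le k _ N (189 / 100 * X * exp (3 / 2)) (5 / 2) (189 / 100 * X * exp (3 / 2)) (5 / 2))|lra];
  try lra; try (generalize (exp_pos (3 / 2)); nra); fold c.
- intros u Hu; eapply Rle_trans; [apply (Gline_half_le k sigma t N u Hk)|]; fold c.
  rewrite (Rabs_pos_eq u Hu).
  rewrite (Rmult_assoc (189 / 100 * X)), <- exp_plus.
  unfold X; apply (exp_bound_of (189 / 100) _ (- sigma * ln r3)); [lra|].
  assert (S := slope_right t c u Ht0 ltac:(lra) Hu); specialize (L u).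
  assert (Q := A (t / c - 2 * PI * c - PI) u Hu ltac:(lra)).
  replace (2 * PI * (c + u) * u) with (2 * PI * c * u + 2 * PI * u ^ 2) by ring. lra.
- intros w Hw; eapply Rle_trans; [apply (Gline_half_le k sigma t N (- w) Hk)|]; fold c.
  rewrite Rabs_Ropp, (Rabs_pos_eq w Hw).
  rewrite (Rmult_assoc (189 / 100 * X)), <- exp_plus.
  unfold X; apply (exp_bound_of (189 / 100) _ (- sigma * ln r3)); [lra|].
  specialize (L (- w)).
  replace (2 * PI * (c + - w) * - w) with (- (2 * PI * c * w) + 2 * PI * w ^ 2) by ring.
  destruct (Rle_lt_dec w c) as [Hwc|Hwc].
  + assert (S := Carg_lower c w ltac:(lra) (conj Hw Hwc)).
    assert (S' : t * Carg (slope1_line c (- w)) <= - (t / c * w)).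
    { replace (- (t / c * w)) with (t * - (w / c)) by (field; lra); apply Rmult_le_compat_l; assumption. }
    assert (Q := A (2 * PI * c - t / c - PI) w Hw ltac:(lra)). lra.
  (* For w > c the exponent 2 PI c w - 2 PI w^2 is already negative and arg x <= -1 suffices; exp (-
     PI w) supplies the decay. *)
  + assert (S := Carg_lower_left c w ltac:(lra) ltac:(lra)).
    assert (S' : t * Carg (slope1_line c (- w)) <= - t) by nra.
    assert (T3 : (2 * c ^ 2 - 2 * c) * PI <= t).
    { apply Rle_trans with (2 := proj1 Ht).
      replace (2 * PI * INR N ^ 2) with (2 * (c - 1 / 2) ^ 2 * PI) by (unfold c; field).
      apply Rmult_le_compat_r; [lra | nra]. }
    assert (Q : PI * (2 * c * w - 2 * w ^ 2 - w - (2 * c ^ 2 - 2 * c)) <= PI * - w).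
    { apply Rmult_le_compat_l; [lra|]; nra. }
    nra.
Qed.

(** For a bound by 2^(-sigma) the line must stay farther than 2 from 0; those through 3 / 2 and 5 /
    2 do not, the one through 7 / 2 does. Being off the saddle for small t, it costs the factor exp
    25. *)
Lemma Iline_small_t (k : C) (sigma t : R) : Cmod k = 1 -> 0 <= sigma -> 0 <= t <= 18 * PI ->
  Rabs (Iline k (sigma + Ci * t) (INR 3 + 1 / 2)) <= 2 * exp 25 * exp (- sigma * ln r3).
Proof.
intros Hk Hs Ht.
assert (HP := PI_precise).
set (c := INR 3 + 1 / 2).
assert (Hc : c = 7 / 2) by (unfold c; simpl; lra).
assert (L : forall u, - sigma * ln (Cmod (slope1_line c u)) <= - sigma * ln r3).
{ intros u; assert (Q := ln_Cmod_line_ge c u r3 ltac:(unfold r3; lra) ltac:(rewrite Hc; unfold r3; nra)); nra. }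
set (X := exp (- sigma * ln r3)) in *.
assert (HX : 0 < X) by apply exp_pos.
assert (HE := exp_pos 25).
assert (HG : 0 < 189 / 100 * X * exp 25) by (repeat apply Rmult_lt_0_compat; lra).
eapply Rle_trans; [apply (Iline_le k _ 3 (189 / 100 * X * exp 25) (5 / 2) (189 / 100 * X * exp 25) (5 / 2))|];
  try lra; fold c.
- intros u Hu; eapply Rle_trans; [apply (Gline_half_le k sigma t 3 u Hk)|]; fold c.
  rewrite (Rabs_pos_eq u Hu).
  rewrite (Rmult_assoc (189 / 100 * X)), <- exp_plus.
  unfold X; apply (exp_bound_of (189 / 100) _ (- sigma * ln r3)); [lra|].
  assert (S := slope_right t c u ltac:(lra) ltac:(lra) Hu); specialize (L u).
  assert (T : t / c * u <= 2 * PI * c * u).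
  { apply Rmult_le_compat_r; [exact Hu|]; rewrite Hc; lra. }
  replace (2 * PI * (c + u) * u) with (2 * PI * c * u + 2 * PI * u ^ 2) by ring.
  assert (0 <= PI * u ^ 2) by (generalize (pow2_ge_0 u); nra). nra.
- intros w Hw; eapply Rle_trans; [apply (Gline_half_le k sigma t 3 (- w) Hk)|]; fold c.
  rewrite Rabs_Ropp, (Rabs_pos_eq w Hw).
  rewrite (Rmult_assoc (189 / 100 * X)), <- exp_plus.
  unfold X; apply (exp_bound_of (189 / 100) _ (- sigma * ln r3)); [lra|].
  specialize (L (- w)).
  assert (S := Carg_neg c w ltac:(lra) Hw).
  assert (S' : t * Carg (slope1_line c (- w)) <= 0) by nra.
  replace (2 * PI * (c + - w) * - w) with (- (2 * PI * c * w) + 2 * PI * w ^ 2) by ring.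
  assert (Q := parabola_envelope (6 * PI) (5 / 2) w).
  assert (Q2 : (6 * PI + 5 / 2) ^ 2 / (8 * PI) <= 25).
  { apply Rmult_le_reg_r with (8 * PI); [lra|]; unfold Rdiv at 1; rewrite Rmult_assoc, Rinv_l, Rmult_1_r by lra; nra. }
  rewrite Hc in *; nra.
Qed.

Lemma exp_r3_le (sigma : R) : 0 <= sigma -> exp (- sigma * ln r3) <= Rpower 2 (- sigma).
Proof.
intros Hs; apply exp_le_compat.
assert (ln 2 <= ln r3); [|nra]. left; apply ln_increasing; unfold r3; lra.
Qed.

Lemma floor_sqrt_ex (t : R) : 18 * PI <= t -> exists N, (3 <= N)%nat /\
  2 * PI * INR N ^ 2 <= t <= 2 * PI * (INR N + 1) ^ 2.
Proof.
intros Ht; assert (HP := PI_precise).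
set (x := sqrt (t / (2 * PI))).
assert (Hx0 : 0 <= t / (2 * PI)) by (apply Rdiv_le_0_compat; lra).
assert (Hx : x ^ 2 = t / (2 * PI)) by (apply pow2_sqrt; exact Hx0).
assert (Et : t = 2 * PI * x ^ 2) by (rewrite Hx; field; lra).
assert (Hx3 : 3 <= x).
{ apply Rsqr_incr_0_var; [|apply sqrt_pos]; rewrite !Rsqr_pow2.
  apply Rmult_le_reg_l with (2 * PI); [lra|]; rewrite <- Et; lra. }
destruct (nfloor_ex x ltac:(lra)) as [N [H1 H2]].
exists N; split.
- apply INR_le; simpl; destruct (Rle_lt_dec 3 (INR N)) as [Q|Q]; [lra|exfalso].
  assert (N < 3)%nat by (apply INR_lt; simpl; lra).
  assert (INR N + 1 <= 3); [|lra].
  rewrite <- S_INR; replace 3 with (INR 3) by (simpl; ring); apply le_INR; lia.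
- assert (HN := pos_INR N); rewrite Et; split; apply Rmult_le_compat_l; try lra; apply pow_incr; lra.
Qed.

Lemma Re_Raux_sub (c : R) (k : C) (sigma t : R) (N : nat) (B : R) : 0 < c < 1 -> Cmod k = 1 ->
  3 <= sigma -> (1 <= N)%nat -> Rabs (Iline k (sigma + Ci * t) (INR N + 1 / 2)) <= B ->
  Rabs (Re (k * Raux c (sigma + Ci * t))%C - Re k)
    <= 8 * (1 / 4 - / (2 * INR N * (INR N + 1))) * Rpower 2 (- sigma) + B.
Proof.
intros Hc Hk Hs HN HB; rewrite (Re_Raux_expand k (sigma + Ci * t) c N Hc).
assert (Z := zeta_partial_bound k sigma t N Hs HN Hk).
replace (zeta_partial k (sigma + Ci * t) N - Iline k (sigma + Ci * t) (INR N + 1 / 2) - Re k)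
  with ((zeta_partial k (sigma + Ci * t) N - Re k) + - Iline k (sigma + Ci * t) (INR N + 1 / 2)) by ring.
eapply Rle_trans; [apply Rabs_triang|]; rewrite Rabs_Ropp; lra.
Qed.

Lemma zeta_factor_le (N : nat) : (1 <= N)%nat -> 8 * (1 / 4 - / (2 * INR N * (INR N + 1))) <= 2.
Proof.
intros HN; assert (Hn : 1 <= INR N) by (apply (le_INR 1); exact HN).
assert (0 < / (2 * INR N * (INR N + 1))) by (apply Rinv_0_lt_compat; nra). lra.
Qed.

Lemma Raux_sub_1_small (c : R) : 0 < c < 1 -> exists K, forall sigma t, 3 <= sigma -> 1 <= t ->
  Cmod (Raux c (sigma + Ci * t) - 1) <= K * Rpower 2 (- sigma).
Proof.
(* Two coordinates, each bounded by 2 for the partial sum plus 8 (large t) or 2 exp 25 (small t) for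
   the line integral. *)
intros Hc; exists (2 * (2 + 8 + 2 * exp 25)); intros sigma t Hs Ht.
assert (HP := PI_precise).
assert (P : forall k, Cmod k = 1 ->
  Rabs (Re (k * Raux c (sigma + Ci * t))%C - Re k) <= (2 + 8 + 2 * exp 25) * Rpower 2 (- sigma)).
{ intros k Hk; assert (R0 : 0 < Rpower 2 (- sigma)) by apply exp_pos.
  assert (E := exp_r3_le sigma ltac:(lra)); assert (E0 := exp_pos (- sigma * ln r3)).
  assert (H25 := exp_pos 25).
  destruct (Rle_lt_dec t (18 * PI)) as [H|H].
  - assert (Q := Re_Raux_sub c k sigma t 3 _ Hc Hk Hs ltac:(lia) (Iline_small_t k sigma t Hk ltac:(lra) ltac:(lra))).
    assert (Z := zeta_factor_le 3 ltac:(lia)). nra.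
  - destruct (floor_sqrt_ex t ltac:(lra)) as [N [HN HtN]].
    assert (Q := Re_Raux_sub c k sigma t N _ Hc Hk Hs ltac:(lia) (Iline_large k sigma t N Hk ltac:(lra) HN HtN)).
    assert (Z := zeta_factor_le N ltac:(lia)). nra. }
assert (P1 := P 1%C Cmod_1).
assert (P2 := P (- Ci)%C ltac:(rewrite Cmod_opp; apply Cmod_Ci)).
eapply Rle_trans; [apply Cmod_le_sum|].
replace (Re (Raux c (sigma + Ci * t) - 1)) with (Re (1 * Raux c (sigma + Ci * t))%C - Re 1) by (simpl; unfold Re; ring).
replace (Im (Raux c (sigma + Ci * t) - 1)) with (Re (- Ci * Raux c (sigma + Ci * t))%C - Re (- Ci)%C)
  by (simpl; unfold Re, Im; ring).
lra.
Qed.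

(** At sigma = 3 the partial sum costs at most 2 / 8 and the line integral 787 / 100 times 67 /
    1000, together about 0.78. *)
Lemma Re_Raux_large (c : R) (k : C) (sigma t : R) : 0 < c < 1 -> Cmod k = 1 -> 3 <= sigma ->
  18 * PI <= t -> Re k - 4 / 5 <= Re (k * Raux c (sigma + Ci * t))%C.
Proof.
intros Hc Hk Hs Ht.
destruct (floor_sqrt_ex t Ht) as [N [HN HtN]].
assert (Q := Re_Raux_sub c k sigma t N _ Hc Hk Hs ltac:(lia) (Iline_large k sigma t N Hk ltac:(lra) HN HtN)).
assert (Z := zeta_factor_le N ltac:(lia)).
assert (E := exp_ln_neg_decr sigma r3 Hs ltac:(unfold r3; lra)).
assert (E2 : / r3 ^ 3 <= 67 / 1000).
{ unfold r3; lra. }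
assert (R8 := Rpower2_3 sigma Hs); assert (R0 : 0 < Rpower 2 (- sigma)) by apply exp_pos.
apply Rabs_le_between in Q; nra.
Qed.

Lemma exp_le_inv_pow (n : nat) (x : R) : (0 < n)%nat -> x < INR n -> exp x <= / (1 - x / INR n) ^ n.
Proof.
intros Hn Hx; assert (Hn' : 0 < INR n) by (apply (lt_INR 0); exact Hn).
assert (Hq : 0 < 1 - x / INR n).
{ apply Rmult_lt_reg_r with (INR n); [exact Hn'|]; rewrite Rmult_0_l.
  replace ((1 - x / INR n) * INR n) with (INR n - x) by (field; lra); lra. }
assert (E : forall m, exp (INR m * (- (x / INR n))) = exp (- (x / INR n)) ^ m).
{ induction m as [|m IH]; [rewrite Rmult_0_l; apply exp_0|].
  rewrite S_INR, Rmult_plus_distr_r, exp_plus, IH, Rmult_1_l; simpl; ring. }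
assert (H : (1 - x / INR n) ^ n <= exp (- x)).
{ replace (- x) with (INR n * (- (x / INR n))) by (field; lra); rewrite E.
  apply pow_incr; split; [lra | generalize (exp_ineq1_le (- (x / INR n))); lra]. }
rewrite <- (Ropp_involutive x) at 1; rewrite exp_Ropp.
apply Rinv_le_contravar; [apply pow_lt; exact Hq | exact H].
Qed.

(** The condition on c keeps |x| >= 1 on the line, so sigma = 3 is the worst case. *)
Lemma ln_line_weight_left (sigma c w : R) : 3 <= sigma -> 2 <= c ^ 2 -> 0 < c -> 0 <= w ->
  - sigma * ln (Cmod (slope1_line c (- w))) <= - 3 * ln c + 3 / c * w.
Proof.
intros Hs Hc Hc0 Hw.
assert (Q := ln_Cmod_line_left c w Hc0 Hw).
assert (P := ln_Cmod_line_ge c (- w) 1 Rlt_0_1 ltac:(lra)); rewrite ln_1 in P.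
replace (3 / c * w) with (3 * (w / c)) by (field; lra); nra.
Qed.

Lemma ln_line_weight_right (sigma c u : R) : 3 <= sigma -> 1 <= c -> 0 <= u ->
  - sigma * ln (Cmod (slope1_line c u)) <= - 3 * ln c.
Proof.
intros Hs Hc Hu.
assert (Q := ln_Cmod_line_right c u ltac:(lra) Hu).
assert (0 <= ln c); [|nra].
rewrite <- ln_1; destruct Hc as [Hc| <-]; [left; apply ln_increasing; lra | lra].
Qed.

(** Here N = 2. The distance to the line through 5 / 2 would give the weight 0.18, too much; the
    modulus at u = 0 gives (5 / 2)^(-3) = 8 / 125, at the price of the slope 3 / d on the left. The
    losses are about 0.17 for the sum, 0.23 for the right half and 0.43 for the left half. *)
Lemma Re_Raux_middle (c : R) (k : C) (sigma t : R) : 0 < c < 1 -> Cmod k = 1 -> 3 <= sigma ->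
  22 <= t <= 18 * PI -> Re k - 17 / 20 <= Re (k * Raux c (sigma + Ci * t))%C.
Proof.
intros Hc Hk Hs Ht; assert (HP := PI_precise).
set (d := INR 2 + 1 / 2).
assert (Hd : d = 5 / 2) by (unfold d; simpl; lra).
assert (X : exp (- 3 * ln d) = 8 / 125) by (rewrite exp_ln_pow3 by lra; rewrite Hd; field).
assert (E1 : exp (53 / 40) <= 384 / 100).
{ eapply Rle_trans; [apply (exp_le_inv_pow 64); [lia | simpl; lra]|].
  replace (INR 64) with 64 by (simpl; lra). lra. }
assert (E2 : exp (37 / 20) <= 655 / 100).
{ eapply Rle_trans; [apply (exp_le_inv_pow 64); [lia | simpl; lra]|].
  replace (INR 64) with 64 by (simpl; lra). lra. }
assert (B : Rabs (Iline k (sigma + Ci * t) (INR 2 + 1 / 2))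
  <= 189 / 100 * (8 / 125) * exp (53 / 40) / 2 + 189 / 100 * (8 / 125) * exp (37 / 20) / (37 / 20)).
{ apply Iline_le; try lra; try (generalize (exp_pos (53 / 40)) (exp_pos (37 / 20)); lra); fold d.
  - intros u Hu; eapply Rle_trans; [apply (Gline_half_le k sigma t 2 u Hk)|]; fold d.
    rewrite (Rabs_pos_eq u Hu), <- X.
    rewrite (Rmult_assoc (189 / 100 * exp (-3 * ln d))), <- exp_plus.
    apply exp_bound_of; [lra|].
    assert (L := ln_line_weight_right sigma d u Hs ltac:(lra) Hu).
    assert (S := slope_right t d u ltac:(lra) ltac:(lra) Hu).
    assert (Q := parabola_envelope (6 / 5 * PI) 2 u).
    assert (Q2 : (6 / 5 * PI + 2) ^ 2 / (8 * PI) <= 53 / 40).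
    { apply Rmult_le_reg_r with (8 * PI); [lra|]; unfold Rdiv at 1; rewrite Rmult_assoc, Rinv_l, Rmult_1_r by lra; nra. }
    assert (T : t / d * u <= 36 / 5 * PI * u) by (apply Rmult_le_compat_r; [exact Hu | rewrite Hd; lra]).
    replace (2 * PI * (d + u) * u) with (2 * PI * d * u + 2 * PI * u ^ 2) by ring.
    rewrite Hd in *; lra.
  - intros w Hw; eapply Rle_trans; [apply (Gline_half_le k sigma t 2 (- w) Hk)|]; fold d.
    rewrite Rabs_Ropp, (Rabs_pos_eq w Hw), <- X.
    rewrite (Rmult_assoc (189 / 100 * exp (-3 * ln d))), <- exp_plus.
    apply exp_bound_of; [lra|].
    assert (L := ln_line_weight_left sigma d w Hs ltac:(rewrite Hd; lra) ltac:(lra) Hw).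
    replace (2 * PI * (d + - w) * - w) with (- (2 * PI * d * w) + 2 * PI * w ^ 2) by ring.
    replace (3 / d * w) with (6 / 5 * w) in L by (rewrite Hd; field).
    destruct (Rle_lt_dec w d) as [Hwd|Hwd].
    + assert (S := Carg_lower d w ltac:(lra) (conj Hw Hwd)).
      assert (S' : t * Carg (slope1_line d (- w)) <= 22 * - (w / d)).
      { assert (0 <= w / d) by (apply Rdiv_le_0_compat; lra). nra. }
      replace (22 * - (w / d)) with (- (44 / 5 * w)) in S' by (rewrite Hd; field).
      (* The slope is 4 PI + 6 / 5 - 44 / 5: 2 PI d - PI from the Gaussian and the denominator, 3 /
         d from the modulus, - 22 / d from the argument. *)
      assert (Q := parabola_envelope (4967 / 1000) (37 / 20) w).
      assert (Q2 : (4967 / 1000 + 37 / 20) ^ 2 / (8 * PI) <= 37 / 20).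
      { apply Rmult_le_reg_r with (8 * PI); [lra|]; unfold Rdiv at 1; rewrite Rmult_assoc, Rinv_l, Rmult_1_r by lra; nra. }
      assert (T : (4 * PI + 6 / 5 - 44 / 5) * w <= 4967 / 1000 * w) by (apply Rmult_le_compat_r; lra).
      rewrite Hd in *; lra.
    + assert (S := Carg_lower_left d w ltac:(lra) ltac:(lra)).
      assert (S' : t * Carg (slope1_line d (- w)) <= - 22) by nra.
      assert (T : PI * (4 * w - 2 * w ^ 2) <= 314 / 100 * (4 * w - 2 * w ^ 2)).
      { assert (4 * w - 2 * w ^ 2 <= 0) by nra. nra. }
      rewrite Hd in *; nra. }
assert (Q := Re_Raux_sub c k sigma t 2 _ Hc Hk Hs ltac:(lia) B).
assert (R8 := Rpower2_3 sigma Hs); simpl INR in Q.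
apply Rabs_le_between in Q; lra.
Qed.

(** * The line through 3 / 2 *)

(* For [x = 3 / 2 - w - i w]: [arg1 w = - arg x], [log1 w = ln |x|] and
   [|Rden x|^2 = exp (2 PI w) * denom1 w]. *)
Definition arg1 (w : R) : R := atan (w / (3 / 2 - w)).
Definition log1 (w : R) : R := / 2 * ln ((3 / 2 - w) ^ 2 + w ^ 2).

Lemma Clog_first_line (w : R) : 0 <= w < 3 / 2 ->
  Clog (slope1_line (INR 1 + 1 / 2) (- w)) = (log1 w, - arg1 w).
Proof.
intros Hw; change (INR 1) with 1.
rewrite Clog_right_half by (rewrite Re_slope1_line; lra).
rewrite Re_slope1_line, Im_slope1_line; f_equal.
- assert (Hp : 0 < Cmod (slope1_line (1 + 1 / 2) (- w))).
  { generalize (Cmod_line_bounds (1 + 1 / 2) (- w) ltac:(lra)); lra. }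
  unfold log1; replace ((3 / 2 - w) ^ 2 + w ^ 2) with (Cmod (slope1_line (1 + 1 / 2) (- w)) ^ 2)
    by (rewrite Cmod_line_sqr; field).
  simpl; rewrite Rmult_1_r, ln_mult by assumption; field.
- unfold arg1; rewrite <- atan_opp; f_equal; field; lra.
Qed.

Lemma cos_plus_sin (B : R) : cos B + sin B = sqrt 2 * cos (B - PI / 4).
Proof.
rewrite cos_minus, cos_PI4, sin_PI4; field; apply Rgt_not_eq, sqrt_lt_R0; lra.
Qed.

Definition cis_exp (a b : R) : C := (exp a * cos b, exp a * sin b).

Lemma cis_exp_plus (a b a' b' : R) : (cis_exp a b * cis_exp a' b')%C = cis_exp (a + a') (b + b').
Proof. exact (eq_sym (Cexp_plus (a, b) (a', b'))). Qed.

Definition denom1 (w : R) : R := 1 + 2 * exp (- (2 * PI * w)) * cos (2 * PI * w) + exp (- (2 * PI * w)) ^ 2.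

(** The second factor is the conjugate of the first, so this is a squared modulus; it serves to make
    the denominator real. *)
Lemma denom1_eq (w : R) :
  ((cis_exp (PI * w) (- (PI * w)) + cis_exp (- (PI * w)) (PI * w)) *
   (cis_exp (PI * w) (PI * w) + cis_exp (- (PI * w)) (- (PI * w))))%C = RtoC (exp (2 * PI * w) * denom1 w).
Proof.
rewrite !Cmult_plus_distr_l, !Cmult_plus_distr_r, !cis_exp_plus; unfold denom1.
assert (E : exp (2 * PI * w) * exp (- (2 * PI * w)) = 1) by (rewrite <- exp_plus, Rplus_opp_r; apply exp_0).
replace (exp (2 * PI * w) * (1 + 2 * exp (- (2 * PI * w)) * cos (2 * PI * w) + exp (- (2 * PI * w)) ^ 2))
  with (exp (2 * PI * w) + 2 * (exp (2 * PI * w) * exp (- (2 * PI * w))) * cos (2 * PI * w)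
    + (exp (2 * PI * w) * exp (- (2 * PI * w))) * exp (- (2 * PI * w))) by ring.
rewrite E; unfold cis_exp.
replace (PI * w + PI * w) with (2 * PI * w) by ring.
replace (- (PI * w) + PI * w) with 0 by ring.
replace (PI * w + - (PI * w)) with 0 by ring.
replace (- (PI * w) + - (PI * w)) with (- (2 * PI * w)) by ring.
rewrite exp_0, cos_0, sin_0, cos_neg, sin_neg; apply C_eq; simpl; ring.
Qed.

Lemma denom1_pos (w : R) : 0 < w -> 0 < denom1 w.
Proof.
intros Hw; unfold denom1; assert (HP := PI_bounds).
set (q := exp (- (2 * PI * w))).
assert (Hq : 0 < q) by apply exp_pos.
assert (Hq1 : q < 1) by (rewrite <- exp_0; apply exp_increasing; nra).
assert (C := COS_bound (2 * PI * w)); nra.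
Qed.

Lemma denom1_pos0 (w : R) : 0 <= w -> 0 < denom1 w.
Proof.
intros [H| <-]; [apply denom1_pos; exact H|].
unfold denom1; rewrite !Rmult_0_r, Ropp_0, exp_0, cos_0; lra.
Qed.

Lemma Rden_first_line (w : R) : Rden (slope1_line (INR 1 + 1 / 2) (- w)) =
  (- Ci * (cis_exp (PI * w) (- (PI * w)) + cis_exp (- (PI * w)) (PI * w)))%C.
Proof.
unfold Rden, slope1_line, Cexp, cis_exp.
assert (E1 : (PI * Ci * (RtoC (INR 1 + 1 / 2) + (1 + Ci) * RtoC (- w)))%C = (PI * w, 3 * (PI / 2) - PI * w)).
{ apply C_eq; simpl; field. }
rewrite E1; simpl.
replace (- (3 * (PI / 2) - PI * w)) with (PI * w - 3 * (PI / 2)) by ring.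
rewrite !cos_minus, !sin_minus, cos_neg, sin_neg, cos_3PI2, sin_3PI2.
apply C_eq; simpl; ring.
Qed.

Lemma Gline_first_formula (sigma t w : R) : 0 <= w < 3 / 2 ->
  let psi := sigma * arg1 w - t * log1 w - 2 * PI * w + theta0 in
  - Gline rot (sigma + Ci * t) (INR 1 + 1 / 2) (- w) =
  sqrt 2 * exp (- sigma * log1 w - t * arg1 w + 2 * PI * w * (1 - w)) *
    (cos psi + exp (- (2 * PI * w)) * cos (psi - 2 * PI * w)) / denom1 w.
Proof.
intros Hw psi.
set (x := slope1_line (INR 1 + 1 / 2) (- w)).
set (T := (cis_exp (PI * w) (- (PI * w)) + cis_exp (- (PI * w)) (PI * w))%C).
set (Tb := (cis_exp (PI * w) (PI * w) + cis_exp (- (PI * w)) (- (PI * w)))%C).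
set (nrm := exp (2 * PI * w) * denom1 w).
assert (HD := denom1_pos0 w (proj1 Hw)).
assert (HE := exp_pos (2 * PI * w)).
assert (Hn : 0 < nrm) by (apply Rmult_lt_0_compat; assumption).
assert (ET : (T * Tb)%C = RtoC nrm) by apply denom1_eq.
assert (HT : T <> 0).
{ intros H; rewrite H in ET; apply (f_equal Re) in ET; simpl in ET; lra. }
assert (HTb : Tb <> 0).
{ intros H; rewrite H in ET; apply (f_equal Re) in ET; simpl in ET; lra. }
assert (HCi : Ci <> 0) by (apply Cmod_gt_0; rewrite Cmod_Ci; lra).
assert (Ei : (Ci * Ci)%C = (- (1))%C) by (apply C_eq; simpl; ring).
assert (Einv : (/ (- Ci * T))%C = (Ci * Tb * RtoC (/ nrm))%C).
{ rewrite RtoC_inv by lra; rewrite <- ET.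
  transitivity (- (Ci * Ci) * / (- Ci * T))%C; [rewrite Ei; ring|].
  field; repeat split; assumption. }
set (a := - sigma * log1 w - t * arg1 w + 3 * PI * w - 2 * PI * w ^ 2).
(* 9 PI / 4 is PI (3 / 2)^2, from the Gaussian at w = 0. It equals PI / 4 up to a full turn, which
   the argument of 1 + i compensates through [cos_plus_sin]. *)
set (B := psi - PI * w + 9 * PI / 4).
assert (Enum : (rot * Rnum (sigma + Ci * t) x)%C = cis_exp a B).
{ unfold Rnum, Cpower, x; rewrite Clog_first_line by exact Hw.
  replace rot with (Cexp (0, theta0)) by (unfold Cexp, rot; simpl; rewrite exp_0, !Rmult_1_l; reflexivity).
  rewrite <- !Cexp_plus; change (cis_exp a B) with (Cexp (a, B)); f_equal; apply C_eq; simpl; unfold a, B, psi; field. }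
unfold Gline; fold x; rewrite Raux_integrand_eq; unfold x at 2; rewrite Rden_first_line; fold T.
rewrite Einv.
replace (rot * (Rnum (sigma + Ci * t) x * (Ci * Tb * RtoC (/ nrm)) * (1 + Ci)))%C
  with ((Ci + Ci * Ci) * (rot * Rnum (sigma + Ci * t) x * Tb) * RtoC (/ nrm))%C by ring.
rewrite Ei, Enum; unfold Tb.
rewrite Cmult_plus_distr_l, !cis_exp_plus.
set (Z := (cis_exp _ _ + cis_exp _ _)%C).
assert (EZ : Re Z + Im Z = sqrt 2 * (exp (a + PI * w) * cos psi + exp (a - PI * w) * cos (psi - 2 * PI * w))).
{ assert (P : forall b v, exp b * cos (v + PI / 4 + 2 * PI) + exp b * sin (v + PI / 4 + 2 * PI) = sqrt 2 * (exp b * cos v)).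
  { intros b v; rewrite <- Rmult_plus_distr_l, cos_plus_sin.
    replace (v + PI / 4 + 2 * PI - PI / 4) with (v + 2 * INR 1 * PI) by (simpl; ring).
    rewrite cos_period; ring. }
  rewrite Rmult_plus_distr_l, <- !P; unfold Z, cis_exp; simpl; unfold B.
  replace (psi - PI * w + 9 * PI / 4 + PI * w) with (psi + PI / 4 + 2 * PI) by field.
  replace (psi - PI * w + 9 * PI / 4 + - (PI * w)) with (psi - 2 * PI * w + PI / 4 + 2 * PI) by field.
  unfold Rminus; ring. }
replace (- Re ((Ci + - (1)) * Z * RtoC (/ nrm))%C) with ((Re Z + Im Z) * / nrm) by (simpl; unfold Re, Im; ring).
rewrite EZ; unfold nrm.
replace (a + PI * w) with ((- sigma * log1 w - t * arg1 w + 2 * PI * w * (1 - w)) + 2 * PI * w) by (unfold a; ring).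
replace (a - PI * w) with ((- sigma * log1 w - t * arg1 w + 2 * PI * w * (1 - w)) + - (2 * PI * w) + 2 * PI * w)
  by (unfold a; ring).
rewrite !exp_plus; field; lra.
Qed.

(** * Polynomial bounds for the elementary functions *)

Lemma sin_cos_taylor (y : R) : 0 <= y ->
  sin y <= y /\ 1 - y ^ 2 / 2 <= cos y /\ y - y ^ 3 / 6 <= sin y /\
  cos y <= 1 - y ^ 2 / 2 + y ^ 4 / 24 /\ sin y <= y - y ^ 3 / 6 + y ^ 5 / 120 /\
  1 - y ^ 2 / 2 + y ^ 4 / 24 - y ^ 6 / 720 <= cos y.
Proof.
assert (S1 : forall y, 0 <= y -> sin y <= y).
{ clear y; intros y Hy.
  assert (H := nondecreasing_of_derive (fun y => y - sin y) (fun y => 1 - cos y) y Hy).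
  cbv beta in H; rewrite sin_0 in H; enough (0 - 0 <= y - sin y) by lra.
  apply H; intros x Hx; [auto_derive; [trivial | ring] | generalize (COS_bound x); lra]. }
assert (S2 : forall y, 0 <= y -> 1 - y ^ 2 / 2 <= cos y).
{ clear y; intros y Hy.
  assert (H := nondecreasing_of_derive (fun y => cos y - (1 - y ^ 2 / 2)) (fun y => y - sin y) y Hy).
  cbv beta in H; rewrite cos_0 in H; enough (1 - (1 - 0 ^ 2 / 2) <= cos y - (1 - y ^ 2 / 2)) by lra.
  apply H; intros x Hx; [auto_derive; [trivial | field] | specialize (S1 x (proj1 Hx)); lra]. }
assert (S3 : forall y, 0 <= y -> y - y ^ 3 / 6 <= sin y).
{ clear y; intros y Hy.
  assert (H := nondecreasing_of_derive (fun y => sin y - (y - y ^ 3 / 6)) (fun y => cos y - (1 - y ^ 2 / 2)) y Hy).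
  cbv beta in H; rewrite sin_0 in H; enough (0 - (0 - 0 ^ 3 / 6) <= sin y - (y - y ^ 3 / 6)) by lra.
  apply H; intros x Hx; [auto_derive; [trivial | field] | specialize (S2 x (proj1 Hx)); lra]. }
assert (S4 : forall y, 0 <= y -> cos y <= 1 - y ^ 2 / 2 + y ^ 4 / 24).
{ clear y; intros y Hy.
  assert (H := nondecreasing_of_derive (fun y => 1 - y ^ 2 / 2 + y ^ 4 / 24 - cos y) (fun y => sin y - (y - y ^ 3 / 6)) y Hy).
  cbv beta in H; rewrite cos_0 in H;
    enough (1 - 0 ^ 2 / 2 + 0 ^ 4 / 24 - 1 <= 1 - y ^ 2 / 2 + y ^ 4 / 24 - cos y) by lra.
  apply H; intros x Hx; [auto_derive; [trivial | field] | specialize (S3 x (proj1 Hx)); lra]. }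
assert (S5 : forall y, 0 <= y -> sin y <= y - y ^ 3 / 6 + y ^ 5 / 120).
{ clear y; intros y Hy.
  assert (H := nondecreasing_of_derive (fun y => y - y ^ 3 / 6 + y ^ 5 / 120 - sin y)
    (fun y => 1 - y ^ 2 / 2 + y ^ 4 / 24 - cos y) y Hy).
  cbv beta in H; rewrite sin_0 in H;
    enough (0 - 0 ^ 3 / 6 + 0 ^ 5 / 120 - 0 <= y - y ^ 3 / 6 + y ^ 5 / 120 - sin y) by lra.
  apply H; intros x Hx; [auto_derive; [trivial | field] | specialize (S4 x (proj1 Hx)); lra]. }
intros Hy; repeat split; auto.
assert (H := nondecreasing_of_derive (fun y => cos y - (1 - y ^ 2 / 2 + y ^ 4 / 24 - y ^ 6 / 720))
  (fun y => y - y ^ 3 / 6 + y ^ 5 / 120 - sin y) y Hy).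
cbv beta in H; rewrite cos_0 in H;
  enough (1 - (1 - 0 ^ 2 / 2 + 0 ^ 4 / 24 - 0 ^ 6 / 720) <= cos y - (1 - y ^ 2 / 2 + y ^ 4 / 24 - y ^ 6 / 720)) by lra.
apply H; intros x Hx; [auto_derive; [trivial | field] | specialize (S5 x (proj1 Hx)); lra].
Qed.

(** As a function of the square of y the sextic is decreasing on the whole half-line: its difference
    quotient is minus a positive quadratic form. Any upper bound of the square may thus be
    substituted, with no restriction on the size of y. *)
Lemma cos_ge_sextic (y m x : R) : Rabs y <= m -> m ^ 2 <= x ->
  1 - x / 2 + x ^ 2 / 24 - x ^ 3 / 720 <= cos y.
Proof.
intros Hy Hm.
assert (E : cos y = cos (Rabs y)).
{ unfold Rabs; destruct Rcase_abs; [rewrite cos_neg|]; reflexivity. }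
assert (H0 := Rabs_pos y).
destruct (sin_cos_taylor (Rabs y) H0) as [_ [_ [_ [_ [_ T]]]]].
rewrite E; eapply Rle_trans; [|exact T].
set (z := Rabs y ^ 2).
assert (Hz : 0 <= z <= x).
{ split; [apply pow2_ge_0|]; apply Rle_trans with (2 := Hm); apply pow_incr; lra. }
replace (Rabs y ^ 4) with (z ^ 2) by (unfold z; ring).
replace (Rabs y ^ 6) with (z ^ 3) by (unfold z; ring).
fold z.
(* The quadratic factor is smallest near x + z = 20, which dictates the square below. *)
assert (F : 0 <= (x - z) * (1 / 2 - (x + z) / 24 + (x ^ 2 + x * z + z ^ 2) / 720)).
{ apply Rmult_le_pos; [lra|].
  assert (0 <= (x + z - 20) ^ 2) by apply pow2_ge_0.
  assert (0 <= (x - z) ^ 2) by apply pow2_ge_0. nra. }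
replace (1 - z / 2 + z ^ 2 / 24 - z ^ 3 / 720)
  with (1 - x / 2 + x ^ 2 / 24 - x ^ 3 / 720 + (x - z) * (1 / 2 - (x + z) / 24 + (x ^ 2 + x * z + z ^ 2) / 720)) by field.
lra.
Qed.

(** Integrated twice from the linear bound 1 + 3 / 2 z; the coefficient 1 / 4 instead of 1 / 6
    absorbs the Taylor remainder for z <= 1 / 3. *)
Lemma exp_le_cubic (z : R) : 0 <= z <= 1 / 3 -> exp z <= 1 + z + z ^ 2 / 2 + z ^ 3 / 4.
Proof.
assert (T0 : forall z, 0 <= z <= 1 / 3 -> exp z <= 1 + 3 / 2 * z).
{ clear z; intros z Hz.
  assert (Q := exp_ineq1_le (- z)); rewrite exp_Ropp in Q.
  assert (P := exp_pos z).
  assert (exp z * (1 - z) <= 1).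
  { replace 1 with (exp z * / exp z) at 2 by (field; lra); apply Rmult_le_compat_l; lra. }
  nra. }
assert (T1 : forall z, 0 <= z <= 1 / 3 -> exp z <= 1 + z + 3 / 4 * z ^ 2).
{ clear z; intros z Hz.
  assert (H := nondecreasing_of_derive (fun z => 1 + z + 3 / 4 * z ^ 2 - exp z) (fun z => 1 + 3 / 2 * z - exp z) z (proj1 Hz)).
  cbv beta in H; rewrite exp_0 in H; enough (1 + 0 + 3 / 4 * 0 ^ 2 - 1 <= 1 + z + 3 / 4 * z ^ 2 - exp z) by lra.
  apply H; intros x Hx; [auto_derive; [trivial | field] | specialize (T0 x ltac:(lra)); lra]. }
intros Hz.
assert (H := nondecreasing_of_derive (fun z => 1 + z + z ^ 2 / 2 + z ^ 3 / 4 - exp z)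
  (fun z => 1 + z + 3 / 4 * z ^ 2 - exp z) z (proj1 Hz)).
cbv beta in H; rewrite exp_0 in H;
  enough (1 + 0 + 0 ^ 2 / 2 + 0 ^ 3 / 4 - 1 <= 1 + z + z ^ 2 / 2 + z ^ 3 / 4 - exp z) by lra.
apply H; intros x Hx; [auto_derive; [trivial | field] | specialize (T1 x ltac:(lra)); lra].
Qed.

Definition artanh (r : R) : R := / 2 * (ln (1 + r) - ln (1 - r)).

Lemma is_derive_artanh (x : R) : -1 < x < 1 -> is_derive artanh x (/ (1 - x ^ 2)).
Proof. intros Hx; unfold artanh; auto_derive; [lra|]; field; nra. Qed.

Lemma artanh_0 : artanh 0 = 0.
Proof. unfold artanh; rewrite Rplus_0_r, Rminus_0_r, ln_1; ring. Qed.

Lemma artanh_bounds (r : R) : 0 <= r <= 1 / 3 -> r <= artanh r <= r + r ^ 3 / 2.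
Proof.
intros Hr.
assert (P : forall x, 0 <= x <= r -> 0 < 1 - x ^ 2 /\ 1 <= / (1 - x ^ 2) <= 1 + 3 / 2 * x ^ 2).
{ intros x Hx; assert (Hp : 0 < 1 - x ^ 2) by nra; split; [exact Hp|].
  assert (E : (1 - x ^ 2) * / (1 - x ^ 2) = 1) by (field; lra).
  assert (0 < / (1 - x ^ 2)) by (apply Rinv_0_lt_compat; exact Hp).
  split; [nra|]. apply Rmult_le_reg_l with (1 - x ^ 2); [exact Hp|]; rewrite E.
  assert (x ^ 2 <= 1 / 9) by nra.
  replace ((1 - x ^ 2) * (1 + 3 / 2 * x ^ 2)) with (1 + x ^ 2 * (1 / 2 - 3 / 2 * x ^ 2)) by field.
  assert (0 <= x ^ 2) by apply pow2_ge_0. nra. }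
split.
- assert (H := nondecreasing_of_derive (fun r => artanh r - r) (fun x => / (1 - x ^ 2) - 1) r (proj1 Hr)).
  cbv beta in H; rewrite artanh_0 in H; enough (0 - 0 <= artanh r - r) by lra.
  apply H; intros x Hx; [|generalize (P x Hx); lra].
  apply (is_derive_minus (V := R_NormedModule)); [apply is_derive_artanh; lra | apply (is_derive_id (K := R_AbsRing))].
- assert (H := nondecreasing_of_derive (fun r => r + r ^ 3 / 2 - artanh r)
    (fun x => (1 + 3 / 2 * x ^ 2) - / (1 - x ^ 2)) r (proj1 Hr)).
  cbv beta in H; rewrite artanh_0 in H; enough (0 + 0 ^ 3 / 2 - 0 <= r + r ^ 3 / 2 - artanh r) by lra.
  apply H; intros x Hx; [|generalize (P x Hx); lra].
  apply (is_derive_minus (V := R_NormedModule)); [auto_derive; [trivial | field] | apply is_derive_artanh; lra].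
Qed.

Lemma artanh_opp (r : R) : artanh (- r) = - artanh r.
Proof. unfold artanh; replace (1 + - r) with (1 - r) by ring; replace (1 - - r) with (1 + r) by ring; ring. Qed.

Lemma artanh_approx (r x : R) : Rabs r <= x -> x <= 1 / 3 -> Rabs (artanh r - r) <= x ^ 3 / 2.
Proof.
intros Hr Hx; assert (H0 := Rabs_pos r).
assert (B := artanh_bounds (Rabs r) ltac:(lra)).
assert (C : Rabs r ^ 3 <= x ^ 3) by (apply pow_incr; lra).
assert (D : artanh (Rabs r) - Rabs r = artanh r - r \/ artanh (Rabs r) - Rabs r = - (artanh r - r)).
{ unfold Rabs; destruct Rcase_abs; [right; rewrite artanh_opp; ring | left; reflexivity]. }
apply Rabs_le; destruct D as [D|D]; lra.
Qed.

(** Expresses an increment of log |x| as artanh of a small rational, where the low-order bounds of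
    artanh are sharp. *)
Lemma half_ln_ratio (a b : R) : 0 < a -> 0 < b -> / 2 * ln b - / 2 * ln a = artanh ((b - a) / (b + a)).
Proof.
intros Ha Hb; unfold artanh.
replace (1 + (b - a) / (b + a)) with (2 * b / (b + a)) by (field; lra).
replace (1 - (b - a) / (b + a)) with (2 * a / (b + a)) by (field; lra).
rewrite !ln_div, !ln_mult by (try apply Rmult_lt_0_compat; lra); field.
Qed.

Lemma ln_3_2_bounds : 4051 / 10000 <= ln (3 / 2) <= 4057 / 10000.
Proof.
assert (E : forall a b, 0 < a -> 0 < b -> ln b - ln a = 2 * artanh ((b - a) / (b + a))).
{ intros a b Ha Hb; rewrite <- half_ln_ratio by assumption; field. }
(* 3 / 2 is reached from 1 through 9 / 8, 10 / 8 and 11 / 8, each step giving a small artanh. *)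
assert (Q : ln (3 / 2) = 2 * artanh (1 / 23) + 2 * artanh (1 / 21) + 2 * artanh (1 / 19) + 2 * artanh (1 / 17)).
{ replace (1 / 17) with ((9 / 8 - 1) / (9 / 8 + 1)) by field.
  replace (1 / 19) with ((10 / 8 - 9 / 8) / (10 / 8 + 9 / 8)) by field.
  replace (1 / 21) with ((11 / 8 - 10 / 8) / (11 / 8 + 10 / 8)) by field.
  replace (1 / 23) with ((3 / 2 - 11 / 8) / (3 / 2 + 11 / 8)) by field.
  rewrite <- !E by lra; rewrite ln_1; ring. }
assert (B1 := artanh_bounds (1 / 17) ltac:(lra)); assert (B2 := artanh_bounds (1 / 19) ltac:(lra)).
assert (B3 := artanh_bounds (1 / 21) ltac:(lra)); assert (B4 := artanh_bounds (1 / 23) ltac:(lra)).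
lra.
Qed.

(** * Interval evaluation on a grid *)

(* Fixed-point arithmetic: the integer [z] stands for [z / 2 ^ 20]; [U] and [L] mark upper and lower bounds. *)
Definition fx : Z := 1048576.
Definition val (z : Z) : R := IZR z / 1048576.
Definition mulU (a b : Z) : Z := (- Z.shiftr (- (a * b)) 20)%Z.
Definition mulD (a b : Z) : Z := Z.shiftr (a * b) 20.

(* [exp y = exp (y / 16) ^ 16], the inner exponential being bounded by a polynomial. *)
Definition expU (y : Z) : Z :=
  let z := (Z.shiftr y 4 + 1)%Z in
  let x := mulU z z in
  let p := (fx + z + Z.shiftr x 1 + 1 + (if z <=? 0 then 0 else Z.shiftr (mulU x z) 2 + 1))%Z in
  let p2 := mulU p p in let p4 := mulU p2 p2 in let p8 := mulU p4 p4 in mulU p8 p8.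

(** A lower bound of cos over all of [-m, m], clipped at -1 because the sextic falls below it for
    large m. *)
Definition cosL (m : Z) : Z :=
  let x := mulU m m in
  Z.max (- fx) (fx - (Z.shiftr x 1 + 1) + mulD x x / 24 - (mulU (mulU x x) x / 720 + 1))%Z.

Lemma Zdiv_bounds (a b : Z) : (0 < b)%Z -> IZR (a / b) <= IZR a / IZR b < IZR (a / b) + 1.
Proof.
intros Hb; assert (Hb' : 0 < IZR b) by (apply IZR_lt; exact Hb).
assert (E := Z_div_mod_eq_full a b); assert (M := Z.mod_pos_bound a b Hb).
apply (f_equal IZR) in E; rewrite plus_IZR, mult_IZR in E.
destruct M as [M1 M2]; apply IZR_le in M1; apply IZR_lt in M2.
assert (Q : IZR a / IZR b = IZR (a / b) + IZR (a mod b) / IZR b) by (rewrite E at 1; field; lra).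
assert (0 <= IZR (a mod b) / IZR b) by (apply Rdiv_le_0_compat; lra).
assert (IZR (a mod b) / IZR b < 1).
{ apply Rmult_lt_reg_r with (IZR b); [exact Hb'|]; unfold Rdiv; rewrite Rmult_assoc, Rinv_l by lra; lra. }
lra.
Qed.

Lemma shiftr_bounds (a n : Z) : (0 <= n)%Z ->
  IZR (Z.shiftr a n) <= IZR a / IZR (2 ^ n) < IZR (Z.shiftr a n) + 1.
Proof.
intros Hn; rewrite Z.shiftr_div_pow2 by exact Hn; apply Zdiv_bounds; lia.
Qed.

Lemma mulU_ge (a b : Z) : val a * val b <= val (mulU a b).
Proof.
unfold val, mulU; rewrite opp_IZR.
assert (B := shiftr_bounds (- (a * b)) 20 ltac:(lia)); rewrite opp_IZR, mult_IZR in B.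
change (IZR (2 ^ 20)) with 1048576 in B; lra.
Qed.

Lemma mulD_le (a b : Z) : val (mulD a b) <= val a * val b.
Proof.
unfold val, mulD; assert (B := shiftr_bounds (a * b) 20 ltac:(lia)); rewrite mult_IZR in B.
change (IZR (2 ^ 20)) with 1048576 in B; lra.
Qed.

Lemma val_plus (a b : Z) : val (a + b) = val a + val b.
Proof. unfold val; rewrite plus_IZR; field. Qed.

Lemma val_minus (a b : Z) : val (a - b) = val a - val b.
Proof. unfold val; rewrite minus_IZR; field. Qed.

Lemma val_opp (a : Z) : val (- a) = - val a.
Proof. unfold val; rewrite opp_IZR; field. Qed.

Lemma val_scal (k a : Z) : val (k * a) = IZR k * val a.
Proof. unfold val; rewrite mult_IZR; field. Qed.

Lemma val_fx : val fx = 1.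
Proof. unfold val, fx; field. Qed.

Lemma val_le (a b : Z) : (a <= b)%Z -> val a <= val b.
Proof. intros H; apply IZR_le in H; unfold val; lra. Qed.

Lemma val_max (a b : Z) : val (Z.max a b) = Rmax (val a) (val b).
Proof.
destruct (Z.max_spec a b) as [[H ->]|[H ->]].
- rewrite Rmax_right; [reflexivity | apply val_le; lia].
- rewrite Rmax_left; [reflexivity | apply val_le; lia].
Qed.

Lemma val_shiftr (a n : Z) : (0 <= n)%Z ->
  val (Z.shiftr a n) <= val a / IZR (2 ^ n) <= val (Z.shiftr a n + 1).
Proof.
intros Hn; assert (B := shiftr_bounds a n Hn); unfold val; rewrite plus_IZR.
assert (0 < IZR (2 ^ n)) by (apply IZR_lt; lia).
replace (IZR a / 1048576 / IZR (2 ^ n)) with (IZR a / IZR (2 ^ n) / 1048576) by (field; lra); lra.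
Qed.

Lemma val_div (a b : Z) : (0 < b)%Z -> val (a / b) <= val a / IZR b <= val (a / b + 1).
Proof.
intros Hb; assert (B := Zdiv_bounds a b Hb); unfold val; rewrite plus_IZR.
assert (0 < IZR b) by (apply IZR_lt; lia).
replace (IZR a / 1048576 / IZR b) with (IZR a / IZR b / 1048576) by (field; lra); lra.
Qed.

Lemma mulU_sqr (a : Z) (x : R) : 0 <= x -> x <= val a -> x * x <= val (mulU a a).
Proof. intros Hx Ha; eapply Rle_trans; [|apply mulU_ge]; nra. Qed.

Lemma expU_correct (y : Z) (x : R) : (y <= 4 * fx)%Z -> x <= val y -> exp x <= val (expU y).
Proof.
intros Hy Hx; unfold expU; set (z := (Z.shiftr y 4 + 1)%Z); set (m := mulU z z).
set (p := (fx + z + _ + 1 + _)%Z).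
assert (Hz := proj2 (val_shiftr y 4 ltac:(lia))); change (IZR (2 ^ 4)) with 16 in Hz; fold z in Hz.
(* The argument is at most 4, so a sixteenth of it plus one rounding unit stays in the range of
   [exp_le_cubic]. *)
assert (Hz1 : val z <= 1 / 3).
{ assert (Q := proj1 (val_shiftr y 4 ltac:(lia))); change (IZR (2 ^ 4)) with 16 in Q.
  assert (V := val_le _ _ Hy); rewrite val_scal, val_fx in V.
  assert (V1 : val 1 = 1 / 1048576) by reflexivity.
  unfold z; rewrite val_plus; lra. }
assert (Hm : val z * val z <= val m) by apply mulU_ge.
assert (Hp : exp (val z) <= val p).
{ assert (B1 := proj2 (val_shiftr m 1 ltac:(lia))); change (IZR (2 ^ 1)) with 2 in B1; rewrite val_plus in B1.
  unfold p; rewrite !val_plus, val_fx; destruct (Z.leb_spec z 0) as [H|H].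
  - assert (V := val_le _ _ H); change (val 0) with (0 / 1048576) in *.
    assert (Q := exp_opp_le_quadratic (- val z) ltac:(lra)); rewrite Ropp_involutive in Q; lra.
  - assert (V := val_le 0 z ltac:(lia)); change (val 0) with (0 / 1048576) in V.
    assert (Q := exp_le_cubic (val z) ltac:(lra)).
    assert (B2 := proj2 (val_shiftr (mulU m z) 2 ltac:(lia))); change (IZR (2 ^ 2)) with 4 in B2.
    assert (B3 := mulU_ge m z).
    assert (val z ^ 3 <= val m * val z) by (replace (val z ^ 3) with (val z * val z * val z) by ring; apply Rmult_le_compat_r; lra).
    rewrite val_plus in B2; rewrite val_plus; lra. }
assert (E := exp_pos (val z)).
assert (P2 := mulU_sqr p _ (Rlt_le _ _ E) Hp).
assert (P4 := mulU_sqr _ _ (Rle_0_sqr _) P2).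
assert (P8 := mulU_sqr _ _ (Rle_0_sqr _) P4).
assert (P16 := mulU_sqr _ _ (Rle_0_sqr _) P8).
eapply Rle_trans; [|exact P16].
unfold Rsqr; rewrite <- !exp_plus; apply exp_le_compat; lra.
Qed.

Lemma cosL_correct (m : Z) (y : R) : Rabs y <= val m -> val (cosL m) <= cos y.
Proof.
intros Hy; unfold cosL; rewrite val_max; apply Rmax_lub.
- rewrite val_opp, val_fx; generalize (COS_bound y); lra.
- set (x := mulU m m).
  assert (Hx : val m ^ 2 <= val x) by (simpl; rewrite Rmult_1_r; apply mulU_ge).
  assert (Q := cos_ge_sextic y (val m) (val x) Hy Hx).
  assert (B1 := proj2 (val_shiftr x 1 ltac:(lia))); change (IZR (2 ^ 1)) with 2 in B1.
  assert (B2 := proj1 (val_div (mulD x x) 24 ltac:(lia))); assert (B3 := mulD_le x x).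
  assert (B4 := proj2 (val_div (mulU (mulU x x) x) 720 ltac:(lia))).
  assert (B5 := mulU_ge x x); assert (B6 := mulU_ge (mulU x x) x).
  assert (Hx0 : 0 <= val x) by (eapply Rle_trans; [apply pow2_ge_0 | exact Hx]).
  assert (B7 : val x ^ 3 <= val (mulU x x) * val x).
  { replace (val x ^ 3) with (val x * val x * val x) by ring; apply Rmult_le_compat_r; assumption. }
  rewrite val_minus, val_plus, val_minus, val_fx; lra.
Qed.

(* Fixed-point bounds for [PI]. *)
Definition piL : Z := 3294101.
Definition piU : Z := 3294312.

(** Holds what is independent of (sigma, t), so that one table serves every box. *)
Record cell : Type := Cell {
  c_arg0 : Z; c_arg1 : Z; c_log0 : Z; c_log1 : Z; c_exp : Z;
  c_q : Z; c_ph0 : Z; c_ph1 : Z; c_den : Z; c_fac : Z }.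

(** 1 - w changes sign at j = 32, hence the maximum over both bounds of PI. *)
Definition expo_bound (j : Z) : Z :=
  let x := (j * (32 - j))%Z in (Z.max (piU * x) (piL * x) / 512 + 1)%Z.

(** The exponent is bounded by its end values because the vertex w = 1 / 2 of w (1 - w) is a grid
    point. [d] bounds [denom1] below by discarding the square of the exponential and a nonnegative
    cosine; 14143 / 10000 stands for sqrt 2. *)
Definition mk_cell (j aL aU lL lU : Z) : cell :=
  let p0 := (piL * j / 16)%Z in
  let p1 := (piU * (j + 1) / 16 + 1)%Z in
  let q := expU (- p0) in
  let d := (fx - 2 * mulU q (Z.max 0 (- cosL p1)))%Z in
  Cell aL aU lL lU (Z.max (expo_bound j) (expo_bound (j + 1))) q p0 p1 d (14143 * fx * fx / (10000 * d) + 1).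

(* The grid is [j / 32]; the argument and the logarithm of [3 / 2 - w - i w] are updated through
   [atan (48 / n)] and [artanh ((4 j - 94) / m)]. *)
Fixpoint cells (k : nat) (j aL aU lL lU : Z) : list cell :=
  match k with
  | O => nil
  | S k =>
    let dL := (48 * fx / ((48 - j) * (47 - j) + j * (j + 1)))%Z in
    let dU := (dL + 1)%Z in
    let aL' := (aL + dL - (mulU (mulU dU dU) dU / 3 + 1))%Z in
    let aU' := (aU + dU)%Z in
    let r := ((4 * j - 94) * fx / ((48 - j) * (48 - j) + j * j + (47 - j) * (47 - j) + (j + 1) * (j + 1)))%Z in
    let x := Z.max (- r) (r + 1) in
    let e := (Z.shiftr (mulU (mulU x x) x) 1 + 1)%Z in
    let lL' := (lL + r - e)%Z in
    let lU' := (lU + r + 1 + e)%Z in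
    mk_cell j aL aU' (Z.min lL lL') (Z.max lU lU') :: cells k (j + 1) aL' aU' lL' lU'
  end.

Definition cell_ok (w0 w1 : R) (c : cell) : Prop := forall w, w0 <= w <= w1 ->
  val (c_arg0 c) <= arg1 w <= val (c_arg1 c) /\
  val (c_log0 c) <= log1 w <= val (c_log1 c) /\
  2 * PI * w * (1 - w) <= val (c_exp c) /\
  exp (- (2 * PI * w)) <= val (c_q c) /\
  val (c_ph0 c) <= 2 * PI * w <= val (c_ph1 c) /\
  ((0 < c_den c)%Z -> sqrt 2 / denom1 w <= val (c_fac c)).

Fixpoint cells_ok (j : Z) (l : list cell) : Prop :=
  match l with
  | nil => True
  | c :: l => cell_ok (IZR j / 32) (IZR (j + 1) / 32) c /\ cells_ok (j + 1) l
  end.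

Lemma arg1_step (j : Z) : (0 <= j < 40)%Z ->
  arg1 (IZR (j + 1) / 32) - arg1 (IZR j / 32) = atan (48 / IZR ((48 - j) * (47 - j) + j * (j + 1))).
Proof.
intros Hj; unfold arg1.
assert (H0 : 0 <= IZR j <= 39) by (split; apply IZR_le; lia).
rewrite !plus_IZR, !mult_IZR, !minus_IZR, !plus_IZR; set (x := IZR j) in *.
set (u := (x + 1) / 32 / (3 / 2 - (x + 1) / 32)); set (v := x / 32 / (3 / 2 - x / 32)).
assert (Hu : 0 <= u) by (apply Rdiv_le_0_compat; lra).
assert (Hv : 0 <= v) by (apply Rdiv_le_0_compat; lra).
assert (E : 48 / ((48 - x) * (47 - x) + x * (x + 1)) = atan_sub u v).
{ unfold atan_sub, u, v; field; repeat split; nra. }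
rewrite E; assert (B1 := atan_bound u); assert (B2 := atan_bound v); assert (B3 := atan_bound (atan_sub u v)).
assert (P1 := atan_pos u Hu); assert (P2 := atan_pos v Hv).
rewrite (atan_sub_correct u v); [ring | nra | lra | lra].
Qed.

Lemma log1_step (j : Z) : (0 <= j < 40)%Z ->
  log1 (IZR (j + 1) / 32) - log1 (IZR j / 32) =
  artanh (IZR (4 * j - 94) / IZR ((48 - j) * (48 - j) + j * j + (47 - j) * (47 - j) + (j + 1) * (j + 1))).
Proof.
intros Hj; unfold log1; rewrite half_ln_ratio.
- f_equal; rewrite ?plus_IZR, ?minus_IZR, ?mult_IZR, ?minus_IZR, ?plus_IZR.
  set (x := IZR j); field; split; nra.
- assert (0 <= (IZR j / 32) ^ 2) by apply pow2_ge_0; assert (0 <= (3 / 2 - IZR j / 32) ^ 2) by apply pow2_ge_0; nra.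
- assert (0 <= (IZR (j + 1) / 32) ^ 2) by apply pow2_ge_0; assert (0 <= (3 / 2 - IZR (j + 1) / 32) ^ 2) by apply pow2_ge_0; nra.
Qed.

Lemma arg1_incr (w w' : R) : 0 <= w -> w <= w' -> w' < 3 / 2 -> arg1 w <= arg1 w'.
Proof.
intros H0 H1 H2; unfold arg1.
assert (Q : w / (3 / 2 - w) <= w' / (3 / 2 - w')).
{ apply Rmult_le_compat; [lra | left; apply Rinv_0_lt_compat; lra | lra | apply Rinv_le_contravar; lra]. }
destruct Q as [Q|Q]; [left; apply atan_increasing; exact Q | rewrite Q; lra].
Qed.

Lemma log1_mono (w w' : R) : (3 / 2 - w) ^ 2 + w ^ 2 <= (3 / 2 - w') ^ 2 + w' ^ 2 -> log1 w <= log1 w'.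
Proof.
intros H; unfold log1; apply Rmult_le_compat_l; [lra|].
assert (0 < (3 / 2 - w) ^ 2 + w ^ 2) by nra.
destruct H as [H|H]; [left; apply ln_increasing; assumption | rewrite H; lra].
Qed.

(** The modulus is least at w = 3 / 4, the grid point j = 24, so [log1] is monotone on each cell. *)
Lemma log1_between (j : Z) (w : R) : IZR j / 32 <= w <= IZR (j + 1) / 32 ->
  Rmin (log1 (IZR j / 32)) (log1 (IZR (j + 1) / 32)) <= log1 w <=
  Rmax (log1 (IZR j / 32)) (log1 (IZR (j + 1) / 32)).
Proof.
intros Hw; rewrite plus_IZR in *.
destruct (Z_lt_le_dec j 24) as [H|H].
- assert (IZR j <= 23) by (apply IZR_le; lia).
  assert (Q1 : log1 ((IZR j + 1) / 32) <= log1 w) by (apply log1_mono; nra).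
  assert (Q2 : log1 w <= log1 (IZR j / 32)) by (apply log1_mono; nra).
  rewrite Rmin_right, Rmax_left; lra.
- apply IZR_le in H.
  assert (Q1 : log1 w <= log1 ((IZR j + 1) / 32)) by (apply log1_mono; nra).
  assert (Q2 : log1 (IZR j / 32) <= log1 w) by (apply log1_mono; nra).
  rewrite Rmin_left, Rmax_right; lra.
Qed.

Lemma val_pi : val piL <= PI <= val piU.
Proof. generalize PI_precise; unfold val, piL, piU; lra. Qed.

Lemma expo_bound_correct (j : Z) : 2 * PI * (IZR j / 32) * (1 - IZR j / 32) <= val (expo_bound j).
Proof.
unfold expo_bound; set (x := (j * (32 - j))%Z).
assert (E : 2 * PI * (IZR j / 32) * (1 - IZR j / 32) = PI * IZR x / 512).
{ unfold x; rewrite mult_IZR, minus_IZR; field. }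
rewrite E; eapply Rle_trans; [|apply (proj2 (val_div _ 512 ltac:(lia)))].
rewrite val_max, !(Z.mul_comm _ x), !val_scal; assert (P := val_pi).
apply Rmult_le_compat_r; [lra|].
destruct (Rle_lt_dec 0 (IZR x)) as [H|H].
- eapply Rle_trans; [|apply Rmax_l]; nra.
- eapply Rle_trans; [|apply Rmax_r]; nra.
Qed.

Lemma expo_mono (w y : R) : 0 <= (y - w) * (1 - y - w) -> 2 * PI * w * (1 - w) <= 2 * PI * y * (1 - y).
Proof.
intros H; assert (HP := PI_bounds).
assert (0 <= 2 * PI * ((y - w) * (1 - y - w))) by (apply Rmult_le_pos; lra). lra.
Qed.

Lemma val_0 : val 0 = 0.
Proof. unfold val; field. Qed.

Lemma mk_cell_ok (j aL aU lL lU : Z) : (0 <= j < 40)%Z ->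
  (forall w, IZR j / 32 <= w <= IZR (j + 1) / 32 ->
    val aL <= arg1 w <= val aU /\ val lL <= log1 w <= val lU) ->
  cell_ok (IZR j / 32) (IZR (j + 1) / 32) (mk_cell j aL aU lL lU).
Proof.
intros Hj H w Hw; unfold mk_cell; cbn [c_arg0 c_arg1 c_log0 c_log1 c_exp c_q c_ph0 c_ph1 c_den c_fac].
set (p0 := (piL * j / 16)%Z); set (p1 := (piU * (j + 1) / 16 + 1)%Z).
set (q := expU (- p0)); set (m := mulU q _); set (d := (fx - 2 * m)%Z).
assert (P := val_pi).
assert (Hj0 : 0 <= IZR j <= 39) by (split; apply IZR_le; lia).
destruct (H w Hw) as [H1 H2].
assert (Hw' : IZR j / 32 <= w <= (IZR j + 1) / 32) by (rewrite plus_IZR in Hw; exact Hw).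
assert (Hp0 : val p0 <= 2 * PI * w).
{ eapply Rle_trans; [apply (proj1 (val_div (piL * j) 16 ltac:(lia)))|].
  rewrite (Z.mul_comm piL), val_scal.
  assert (IZR j * val piL <= IZR j * PI) by (apply Rmult_le_compat_l; lra).
  assert (PI * (IZR j / 32) <= PI * w) by (apply Rmult_le_compat_l; generalize PI_bounds; lra). lra. }
assert (Hp1 : 2 * PI * w <= val p1).
{ eapply Rle_trans; [|apply (proj2 (val_div (piU * (j + 1)) 16 ltac:(lia)))].
  rewrite (Z.mul_comm piU), val_scal, plus_IZR.
  assert ((IZR j + 1) * PI <= (IZR j + 1) * val piU) by (apply Rmult_le_compat_l; lra).
  assert (PI * w <= PI * ((IZR j + 1) / 32)) by (apply Rmult_le_compat_l; generalize PI_bounds; lra). lra. }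
assert (Hq : exp (- (2 * PI * w)) <= val q).
{ apply expU_correct; [|rewrite val_opp; lra].
  assert (0 <= p0)%Z by (apply Z.div_pos; unfold piL; lia). unfold fx; lia. }
split; [exact H1|]; split; [exact H2|]; split; [|split; [exact Hq|split; [lra|]]].
- rewrite val_max.
  assert (B1 := expo_bound_correct j); assert (B2 := expo_bound_correct (j + 1)); rewrite plus_IZR in B2.
  destruct (Z_lt_le_dec j 16) as [L|L].
  + assert (IZR j <= 15) by (apply IZR_le; lia).
    eapply Rle_trans; [|apply Rmax_r]; eapply Rle_trans; [|exact B2].
    apply expo_mono; nra.
  + apply IZR_le in L.
    eapply Rle_trans; [|apply Rmax_l]; eapply Rle_trans; [|exact B1].
    apply expo_mono; nra.
- intros Hd.
  assert (Hdr : 0 < val d) by (unfold val; apply Rdiv_lt_0_compat; [apply IZR_lt; exact Hd | lra]).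
  assert (Hc : val (cosL p1) <= cos (2 * PI * w)).
  { apply cosL_correct; rewrite Rabs_pos_eq; [exact Hp1|].
    apply Rmult_le_pos; [generalize PI_bounds; lra | lra]. }
  assert (D : val d <= denom1 w).
  { assert (Hm : val q * val (Z.max 0 (- cosL p1)) <= val m) by apply mulU_ge.
    rewrite val_max, val_0, val_opp in Hm.
    unfold d; rewrite val_minus, val_scal, val_fx; unfold denom1.
    assert (Q0 := exp_pos (- (2 * PI * w))).
    assert (M1 := Rmax_l 0 (- val (cosL p1))); assert (M2 := Rmax_r 0 (- val (cosL p1))).
    set (mx := Rmax 0 (- val (cosL p1))) in *.
    assert (- cos (2 * PI * w) <= mx) by lra.
    assert (exp (- (2 * PI * w)) * - cos (2 * PI * w) <= val q * mx) by nra.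
    assert (0 <= exp (- (2 * PI * w)) ^ 2) by apply pow2_ge_0. lra. }
  assert (F : 14143 / 10000 / val d <= val (14143 * fx * fx / (10000 * d) + 1)).
  { assert (B := Zdiv_bounds (14143 * fx * fx) (10000 * d) ltac:(lia)).
    unfold val at 2; rewrite plus_IZR; rewrite !mult_IZR in B.
    replace (14143 / 10000 / val d) with (14143 * IZR fx * IZR fx / (10000 * IZR d) / 1048576).
    - lra.
    - unfold val, fx; field; apply Rgt_not_eq, IZR_lt; lia. }
  eapply Rle_trans; [|exact F].
  apply Rmult_le_compat; [apply sqrt_pos | left; apply Rinv_0_lt_compat; lra | generalize sqrt2_bounds; lra
    | apply Rinv_le_contravar; assumption].
Qed.

Lemma val_min (a b : Z) : val (Z.min a b) = Rmin (val a) (val b).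
Proof.
destruct (Z.min_spec a b) as [[H ->]|[H ->]].
- rewrite Rmin_left; [reflexivity | apply val_le; lia].
- rewrite Rmin_right; [reflexivity | apply val_le; lia].
Qed.

Lemma cells_correct (k : nat) : forall j aL aU lL lU, (0 <= j)%Z -> (j + Z.of_nat k <= 40)%Z ->
  val aL <= arg1 (IZR j / 32) <= val aU -> val lL <= log1 (IZR j / 32) <= val lU ->
  cells_ok j (cells k j aL aU lL lU).
Proof.
induction k as [|k IH]; intros j aL aU lL lU Hj Hk Ha Hl; [exact I|].
cbn [cells cells_ok].
set (n := ((48 - j) * (47 - j) + j * (j + 1))%Z); set (dL := (48 * fx / n)%Z).
set (dU := (dL + 1)%Z); set (d3 := mulU (mulU dU dU) dU).
set (m := ((48 - j) * (48 - j) + j * j + (47 - j) * (47 - j) + (j + 1) * (j + 1))%Z); set (r := ((4 * j - 94) * fx / m)%Z).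
set (x := Z.max (- r) (r + 1)); set (x3 := mulU (mulU x x) x).
assert (Hn : (0 < n)%Z) by (unfold n; nia).
assert (Hm : (0 < m)%Z) by (unfold m; nia).
assert (Hjr : (0 <= j < 40)%Z) by lia.
assert (S1 := arg1_step j Hjr); fold n in S1; assert (S2 := log1_step j Hjr); fold m in S2.
set (dl := 48 / IZR n) in *; set (rho := IZR (4 * j - 94) / IZR m) in *.
assert (Hnr : 0 < IZR n) by (apply IZR_lt; exact Hn).
assert (Hmr : 0 < IZR m) by (apply IZR_lt; exact Hm).
assert (Hdl0 : 0 <= dl) by (apply Rdiv_le_0_compat; lra).
assert (Hdl : val dL <= dl <= val dU).
{ assert (B := Zdiv_bounds (48 * fx) n Hn); rewrite mult_IZR in B.
  unfold dU, dL, val; rewrite plus_IZR.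
  replace dl with (48 * IZR fx / IZR n / 1048576) by (unfold dl, fx; field; lra). lra. }
assert (Hrho : val r <= rho <= val (r + 1)).
{ assert (B := Zdiv_bounds ((4 * j - 94) * fx) m Hm); rewrite mult_IZR in B.
  unfold r, val; rewrite plus_IZR.
  replace rho with (IZR (4 * j - 94) * IZR fx / IZR m / 1048576) by (unfold rho, fx; field; lra). lra. }
assert (Hat : val (aL + dL - (d3 / 3 + 1)) <= arg1 (IZR (j + 1) / 32) <= val (aU + dU)).
{ assert (B1 := atan_le_cubic dl Hdl0); assert (B2 := atan_le_id dl Hdl0).
  assert (B3 := proj2 (val_div d3 3 ltac:(lia))).
  assert (B4 : dl ^ 3 <= val d3).
  { unfold d3; eapply Rle_trans; [|apply mulU_ge].
    assert (Q := mulU_sqr dU dl Hdl0 (proj2 Hdl)).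
    replace (dl ^ 3) with (dl * dl * dl) by ring; apply Rmult_le_compat; nra. }
  rewrite val_minus, !val_plus in *; lra. }
assert (Hx : Rabs rho <= val x).
{ unfold x; rewrite val_max, val_opp; apply Rabs_le.
  generalize (Rmax_l (- val r) (val (r + 1))) (Rmax_r (- val r) (val (r + 1))); lra. }
assert (Hrho3 : Rabs rho <= 1 / 3).
{ assert (Hmb : 1000 <= IZR m) by (apply IZR_le; unfold m; nia).
  assert (Hjb : -94 <= IZR (4 * j - 94) <= 94) by (split; apply IZR_le; lia).
  apply Rabs_le; unfold rho; split.
  - apply Rmult_le_reg_r with (IZR m); [exact Hmr|]; unfold Rdiv; rewrite Rmult_assoc, Rinv_l by lra; lra.
  - apply Rmult_le_reg_r with (IZR m); [exact Hmr|]; unfold Rdiv; rewrite Rmult_assoc, Rinv_l by lra; lra. }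
assert (Hlt : val (lL + r - (Z.shiftr x3 1 + 1)) <= log1 (IZR (j + 1) / 32) <= val (lU + r + 1 + (Z.shiftr x3 1 + 1))).
{ assert (B1 := artanh_approx rho (Rabs rho) (Rle_refl _) Hrho3).
  assert (B2 := proj2 (val_shiftr x3 1 ltac:(lia))); change (IZR (2 ^ 1)) with 2 in B2.
  assert (B3 : Rabs rho ^ 3 <= val x3).
  { unfold x3; eapply Rle_trans; [|apply mulU_ge].
    assert (H0 := Rabs_pos rho); assert (Q := mulU_sqr x _ H0 Hx).
    replace (Rabs rho ^ 3) with (Rabs rho * Rabs rho * Rabs rho) by ring; apply Rmult_le_compat; nra. }
  apply Rabs_le_between in B1.
  rewrite val_minus, !val_plus in *; lra. }
split.
- apply mk_cell_ok; [exact Hjr|]; intros w Hw.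
  assert (Hjb : 0 <= IZR j <= 39) by (split; apply IZR_le; lia).
  assert (Hj1 : IZR (j + 1) = IZR j + 1) by (rewrite plus_IZR; reflexivity).
  assert (M1 : arg1 (IZR j / 32) <= arg1 w) by (apply arg1_incr; lra).
  assert (M2 : arg1 w <= arg1 (IZR (j + 1) / 32)) by (apply arg1_incr; lra).
  assert (M3 := log1_between j w Hw).
  split; [lra|]; rewrite val_min, val_max; split.
  + eapply Rle_trans; [|exact (proj1 M3)]; apply Rmin_glb; [eapply Rle_trans; [apply Rmin_l | lra] | eapply Rle_trans; [apply Rmin_r | lra]].
  + eapply Rle_trans; [exact (proj2 M3)|]; apply Rmax_lub; [eapply Rle_trans; [|apply Rmax_l]; lra | eapply Rle_trans; [|apply Rmax_r]; lra].
- apply IH; [lia | lia | exact Hat | exact Hlt].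
Qed.

(* The last two arguments bound [log1 0 = ln (3 / 2)]. *)
Definition table : list cell := cells 40 0 0 0 424778 425408.

Lemma table_ok : cells_ok 0 table.
Proof.
apply cells_correct; [lia | simpl; lia | |].
- unfold arg1; replace (IZR 0 / 32 / (3 / 2 - IZR 0 / 32)) with 0 by field.
  rewrite atan_0, val_0; lra.
- unfold log1; replace ((3 / 2 - IZR 0 / 32) ^ 2 + (IZR 0 / 32) ^ 2) with (3 / 2 * (3 / 2)) by field.
  rewrite ln_mult by lra; generalize ln_3_2_bounds; unfold val; lra.
Qed.

(** Nonnegative lower bounds of logarithm and argument make their products with sigma and t
    monotone; the cap on [c_exp] keeps [expU] in its range. *)
Definition cell_good (c : cell) : bool :=
  ((0 <? c_den c)%Z && (c_exp c <=? 4 * fx)%Z && (0 <=? c_log0 c)%Z && (0 <=? c_arg0 c)%Z)%bool.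

(* Fixed-point bounds for [theta0]. *)
Definition thL : Z := 471859.
Definition thU : Z := 471860.

(* [bracket] is the oscillating factor of [- Gline]. [neg_phase] bounds its negative part from above on a
   box [s0, s1] x [t0, t1] of values of [(sigma, t)]; [neg_any] does so without using the phase. *)
Definition neg_phase (s0 s1 t0 t1 : Z) (c : cell) : Z :=
  let pL := (s0 * c_arg0 c - t1 * c_log1 c - c_ph1 c + thL)%Z in
  let pU := (s1 * c_arg1 c - t0 * c_log0 c - c_ph0 c + thU)%Z in
  let c1 := cosL (Z.max (- pL) pU) in
  let c2 := cosL (Z.max (c_ph1 c - pL) (pU - c_ph0 c)) in
  Z.max 0 (mulU (c_q c) (Z.max 0 (- c2)) - c1).

Definition neg_any (c : cell) : Z := (fx + c_q c)%Z.

(** The exponential factor decreases in sigma and t, so the lower corner of the box bounds it. *)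
Definition cell_val (s0 t0 : Z) (neg : cell -> Z) (c : cell) : Z :=
  mulU (mulU (neg c) (c_fac c)) (expU (c_exp c - s0 * c_log0 c - t0 * c_arg0 c)).

Definition total (v : cell -> Z) (l : list cell) : Z := fold_right (fun c a => (v c + a)%Z) 0%Z l.

Definition bracket (sigma t w : R) : R :=
  let psi := sigma * arg1 w - t * log1 w - 2 * PI * w + theta0 in
  cos psi + exp (- (2 * PI * w)) * cos (psi - 2 * PI * w).

Lemma cell_good_spec (c : cell) : cell_good c = true ->
  (0 < c_den c /\ c_exp c <= 4 * fx /\ 0 <= c_log0 c /\ 0 <= c_arg0 c)%Z.
Proof.
unfold cell_good; intros H; repeat (apply andb_prop in H; destruct H as [H ?]).
apply Z.ltb_lt in H; repeat match goal with X : (_ <=? _)%Z = true |- _ => apply Z.leb_le in X end; auto.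
Qed.

Lemma val_nonneg (a : Z) : (0 <= a)%Z -> 0 <= val a.
Proof. intros H; rewrite <- val_0; apply val_le; exact H. Qed.

Lemma cell_lower (w0 w1 w sigma t : R) (s0 t0 : Z) (neg : cell -> Z) (c : cell) :
  cell_ok w0 w1 c -> w0 <= w <= w1 -> cell_good c = true -> 0 <= w < 3 / 2 ->
  (0 <= s0)%Z -> (0 <= t0)%Z -> IZR s0 <= sigma -> IZR t0 <= t ->
  0 <= val (neg c) -> - val (neg c) <= bracket sigma t w ->
  - val (cell_val s0 t0 neg c) <= - Gline rot (sigma + Ci * t) (INR 1 + 1 / 2) (- w).
Proof.
intros Hok Hw Hg Hw2 Hs0 Ht0 Hs Ht Hn Hb.
destruct (cell_good_spec c Hg) as [G1 [G2 [G3 G4]]].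
destruct (Hok w Hw) as [[A1 A2] [[L1 L2] [E1 [Q1 [P1 F1]]]]]; specialize (F1 G1).
rewrite Gline_first_formula by exact Hw2; cbv zeta; fold (bracket sigma t w).
assert (HD := denom1_pos0 w (proj1 Hw2)).
assert (V1 := val_nonneg _ G3); assert (V2 := val_nonneg _ G4).
assert (S0 : 0 <= IZR s0) by (apply IZR_le; exact Hs0); assert (T0 : 0 <= IZR t0) by (apply IZR_le; exact Ht0).
set (Y := - sigma * log1 w - t * arg1 w + 2 * PI * w * (1 - w)).
assert (HY : exp Y <= val (expU (c_exp c - s0 * c_log0 c - t0 * c_arg0 c))).
{ apply expU_correct.
  - assert (0 <= s0 * c_log0 c)%Z by (apply Z.mul_nonneg_nonneg; assumption).
    assert (0 <= t0 * c_arg0 c)%Z by (apply Z.mul_nonneg_nonneg; assumption). lia.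
  - rewrite !val_minus, !val_scal; unfold Y.
    assert (IZR s0 * val (c_log0 c) <= sigma * log1 w) by (apply Rmult_le_compat; assumption).
    assert (IZR t0 * val (c_arg0 c) <= t * arg1 w) by (apply Rmult_le_compat; assumption).
    lra. }
assert (HE := exp_pos Y).
set (e := val (expU _)) in *.
assert (Hf : 0 <= sqrt 2 / denom1 w) by (apply Rdiv_le_0_compat; [apply sqrt_pos | exact HD]).
replace (sqrt 2 * exp Y * bracket sigma t w / denom1 w) with (sqrt 2 / denom1 w * exp Y * bracket sigma t w) by (field; lra).
assert (M : sqrt 2 / denom1 w * exp Y * val (neg c) <= val (cell_val s0 t0 neg c)).
{ unfold cell_val; eapply Rle_trans; [|apply mulU_ge]; fold e.
  assert (B := mulU_ge (neg c) (c_fac c)).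
  assert (sqrt 2 / denom1 w * val (neg c) <= val (mulU (neg c) (c_fac c))) by nra.
  replace (sqrt 2 / denom1 w * exp Y * val (neg c)) with (sqrt 2 / denom1 w * val (neg c) * exp Y) by ring.
  apply Rmult_le_compat; try assumption; [apply Rmult_le_pos; assumption | lra]. }
assert (0 <= sqrt 2 / denom1 w * exp Y) by (apply Rmult_le_pos; lra).
nra.
Qed.

Lemma neg_any_correct (w0 w1 w sigma t : R) (c : cell) : cell_ok w0 w1 c -> w0 <= w <= w1 ->
  0 <= val (neg_any c) /\ - val (neg_any c) <= bracket sigma t w.
Proof.
intros Hok Hw; destruct (Hok w Hw) as [_ [_ [_ [Q1 _]]]].
unfold neg_any, bracket; cbv zeta; rewrite val_plus, val_fx.
assert (E := exp_pos (- (2 * PI * w))).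
set (psi := sigma * arg1 w - _ - _ + _).
assert (B1 := COS_bound psi); assert (B2 := COS_bound (psi - 2 * PI * w)).
split; [lra|]; nra.
Qed.

Lemma neg_phase_correct (w0 w1 w sigma t : R) (s0 s1 t0 t1 : Z) (c : cell) :
  cell_ok w0 w1 c -> w0 <= w <= w1 -> cell_good c = true ->
  (0 <= s0)%Z -> (0 <= t0)%Z -> IZR s0 <= sigma <= IZR s1 -> IZR t0 <= t <= IZR t1 ->
  0 <= val (neg_phase s0 s1 t0 t1 c) /\ - val (neg_phase s0 s1 t0 t1 c) <= bracket sigma t w.
Proof.
intros Hok Hw Hg Hs0 Ht0 Hs Ht.
destruct (cell_good_spec c Hg) as [G1 [G2 [G3 G4]]].
destruct (Hok w Hw) as [[A1 A2] [[L1 L2] [E1 [Q1 [[P0 P1] _]]]]].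
assert (V1 := val_nonneg _ G3); assert (V2 := val_nonneg _ G4).
assert (S0 : 0 <= IZR s0) by (apply IZR_le; exact Hs0); assert (T0 : 0 <= IZR t0) by (apply IZR_le; exact Ht0).
unfold neg_phase, bracket; cbv zeta.
set (pL := (s0 * c_arg0 c - _ - _ + _)%Z); set (pU := (s1 * c_arg1 c - _ - _ + _)%Z).
set (psi := sigma * arg1 w - _ - _ + _).
assert (Hth : val thL <= theta0 <= val thU) by (unfold val, thL, thU, theta0; lra).
assert (HpL : val pL <= psi).
{ unfold pL; rewrite !val_plus, !val_minus, !val_scal; unfold psi.
  assert (IZR s0 * val (c_arg0 c) <= sigma * arg1 w) by (apply Rmult_le_compat; lra).
  assert (t * log1 w <= IZR t1 * val (c_log1 c)) by (apply Rmult_le_compat; lra).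
  lra. }
assert (HpU : psi <= val pU).
{ unfold pU; rewrite !val_plus, !val_minus, !val_scal; unfold psi.
  assert (sigma * arg1 w <= IZR s1 * val (c_arg1 c)) by (apply Rmult_le_compat; lra).
  assert (IZR t0 * val (c_log0 c) <= t * log1 w) by (apply Rmult_le_compat; lra).
  lra. }
assert (C1 : val (cosL (Z.max (- pL) pU)) <= cos psi).
{ apply cosL_correct; rewrite val_max, val_opp; apply Rabs_le.
  generalize (Rmax_l (- val pL) (val pU)) (Rmax_r (- val pL) (val pU)); lra. }
assert (C2 : val (cosL (Z.max (c_ph1 c - pL) (pU - c_ph0 c))) <= cos (psi - 2 * PI * w)).
{ apply cosL_correct; rewrite val_max, !val_minus; apply Rabs_le.
  generalize (Rmax_l (val (c_ph1 c) - val pL) (val pU - val (c_ph0 c)))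
    (Rmax_r (val (c_ph1 c) - val pL) (val pU - val (c_ph0 c))); lra. }
set (k1 := cosL (Z.max (- pL) pU)) in *; set (k2 := cosL (Z.max (c_ph1 c - pL) (pU - c_ph0 c))) in *.
rewrite val_max, val_0, val_minus.
split; [apply Rmax_l|].
assert (M := mulU_ge (c_q c) (Z.max 0 (- k2))); rewrite val_max, val_0, val_opp in M.
assert (M1 := Rmax_l 0 (- val k2)); assert (M2 := Rmax_r 0 (- val k2)).
set (mx := Rmax 0 (- val k2)) in *.
assert (E := exp_pos (- (2 * PI * w))).
assert (N : exp (- (2 * PI * w)) * - cos (psi - 2 * PI * w) <= val (c_q c) * mx) by nra.
generalize (Rmax_r 0 (val (mulU (c_q c) (Z.max 0 (- k2))) - val k1)); lra.
Qed.

(** * From the cells to the integral *)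

Fixpoint below (g : R -> R) (v : cell -> Z) (j : Z) (l : list cell) : Prop :=
  match l with
  | nil => True
  | c :: l => (forall w, IZR j / 32 <= w <= IZR (j + 1) / 32 -> - val (v c) <= g (- w)) /\ below g v (j + 1) l
  end.

Lemma RInt_below (g : R -> R) (v : cell -> Z) (l : list cell) : (forall a b, ex_RInt g a b) ->
  forall j, below g v j l ->
  - (val (total v l) / 32) <= RInt g (- (IZR (j + Z.of_nat (length l)) / 32)) (- (IZR j / 32)).
Proof.
intros Hex; induction l as [|c l IH]; intros j Hb.
- simpl; rewrite Z.add_0_r, RInt_point, val_0; unfold zero; simpl; lra.
- destruct Hb as [H1 H2]; specialize (IH _ H2).
  replace (j + Z.of_nat (length (c :: l)))%Z with (j + 1 + Z.of_nat (length l))%Z by (simpl length; lia).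
  rewrite <- (RInt_Chasles (V := R_CompleteNormedModule) g _ (- (IZR (j + 1) / 32)) _) by apply Hex.
  change (plus ?x ?y) with (x + y).
  assert (Q : (- (IZR j / 32) - - (IZR (j + 1) / 32)) * - val (v c) <= RInt g (- (IZR (j + 1) / 32)) (- (IZR j / 32))).
  { assert (R1 := RInt_const (V := R_CompleteNormedModule) (- (IZR (j + 1) / 32)) (- (IZR j / 32)) (- val (v c))).
    change (scal ?x ?y) with (x * y) in R1; rewrite <- R1; apply RInt_le; [rewrite plus_IZR; lra | eexists; apply is_RInt_const | apply Hex|].
    intros u Hu; specialize (H1 (- u) ltac:(lra)); rewrite Ropp_involutive in H1; exact H1. }
  change (total v (c :: l)) with (v c + total v l)%Z; rewrite val_plus.
  replace (- (IZR j / 32) - - (IZR (j + 1) / 32)) with (1 / 32) in Q by (rewrite plus_IZR; field).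
  lra.
Qed.

Lemma below_of_cells (sigma t : R) (s0 t0 : Z) (neg : cell -> Z) (l : list cell) :
  (0 <= s0)%Z -> (0 <= t0)%Z -> IZR s0 <= sigma -> IZR t0 <= t ->
  (forall w0 w1 w c, cell_ok w0 w1 c -> w0 <= w <= w1 -> cell_good c = true ->
     0 <= val (neg c) /\ - val (neg c) <= bracket sigma t w) ->
  forall j, (0 <= j)%Z -> (j + Z.of_nat (length l) <= 40)%Z -> cells_ok j l -> forallb cell_good l = true ->
  below (fun u => - Gline rot (sigma + Ci * t) (INR 1 + 1 / 2) u) (cell_val s0 t0 neg) j l.
Proof.
intros Hs0 Ht0 Hs Ht Hneg; induction l as [|c l IH]; intros j Hj Hl Hok Hg; [exact I|].
destruct Hok as [H1 H2]; simpl in Hg; apply andb_prop in Hg; destruct Hg as [G1 G2].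
simpl length in Hl; split.
- intros w Hw; destruct (Hneg _ _ w c H1 Hw G1) as [N1 N2].
  assert (B0 : 0 <= IZR j) by (apply IZR_le; lia); assert (B1 : IZR (j + 1) <= 40) by (apply IZR_le; lia).
  apply (cell_lower _ _ w sigma t s0 t0 neg c H1 Hw G1); try assumption; lra.
- apply IH; [lia | lia | exact H2 | exact G2].
Qed.

Definition check_total (v : cell -> Z) (num : Z) (l : list cell) : bool := (100 * total v l <=? num * 32 * fx)%Z.

(* Beyond the boxes, decay in [sigma] or [t] allows for [neg_any]. *)
Definition sigma_grid : list Z := (3 :: 4 :: 5 :: 6 :: 7 :: 8 :: 9 :: 10 :: 11 :: 12 :: nil)%Z.
Definition t_grid : list (Z * Z) := ((1, 2) :: (2, 4) :: (4, 6) :: nil)%Z.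

(** The allowances 73, 53, 28, in hundredths, shrink as t grows, because the right tail decays more
    slowly: its rates are 17 / 2, 29 / 5 and 2. *)
Definition checks (l : list cell) : bool :=
  (forallb cell_good l && Nat.eqb (length l) 40 &&
  forallb (fun s => forallb (fun p =>
    check_total (cell_val s (fst p) (neg_phase s (s + 1) (fst p) (snd p))) 73 l) t_grid) sigma_grid &&
  check_total (cell_val 13 1 neg_any) 73 l &&
  check_total (cell_val 3 6 neg_any) 53 l &&
  check_total (cell_val 3 10 neg_any) 28 l)%bool.

Lemma checks_table : checks table = true.
Proof. vm_compute; reflexivity. Qed.

Lemma check_total_spec (v : cell -> Z) (num : Z) (l : list cell) : check_total v num l = true ->
  val (total v l) / 32 <= IZR num / 100.
Proof.
unfold check_total; intros H; apply Z.leb_le, IZR_le in H; rewrite !mult_IZR in H.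
unfold val; change (IZR fx) with 1048576 in H; lra.
Qed.

Lemma Cmod_rot : Cmod rot = 1.
Proof.
unfold Cmod, rot; cbn [fst snd]; rewrite <- !Rsqr_pow2, rot_norm; apply sqrt_1.
Qed.

Lemma checks_spec (l : list cell) : checks l = true ->
  forallb cell_good l = true /\ length l = 40%nat /\
  (forall s t0 t1, In s sigma_grid -> In (t0, t1) t_grid ->
     check_total (cell_val s t0 (neg_phase s (s + 1) t0 t1)) 73 l = true) /\
  check_total (cell_val 13 1 neg_any) 73 l = true /\
  check_total (cell_val 3 6 neg_any) 53 l = true /\
  check_total (cell_val 3 10 neg_any) 28 l = true.
Proof.
unfold checks; intros H; repeat (apply andb_prop in H; destruct H as [H ?]).
repeat split; try assumption; [apply Nat.eqb_eq; assumption|].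
intros s t0 t1 Is It.
match goal with X : forallb (fun s => forallb _ _) _ = true |- _ =>
  rewrite forallb_forall in X; specialize (X s Is); rewrite forallb_forall in X; exact (X _ It) end.
Qed.

Lemma RInt_first_middle (sigma t : R) (s0 t0 num : Z) (neg : cell -> Z) :
  (0 <= s0)%Z -> (0 <= t0)%Z -> IZR s0 <= sigma -> IZR t0 <= t ->
  (forall w0 w1 w c, cell_ok w0 w1 c -> w0 <= w <= w1 -> cell_good c = true ->
     0 <= val (neg c) /\ - val (neg c) <= bracket sigma t w) ->
  check_total (cell_val s0 t0 neg) num table = true ->
  - (IZR num / 100) <= RInt (fun u => - Gline rot (sigma + Ci * t) (INR 1 + 1 / 2) u) (- (5 / 4)) 0.
Proof.
intros Hs0 Ht0 Hs Ht Hneg Hc.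
destruct (checks_spec _ checks_table) as [H [HL _]].
destruct (Edec_Gline rot (sigma + Ci * t) 1 (INR 1 + 1 / 2) ltac:(lra)) as [K HE].
assert (B := below_of_cells sigma t s0 t0 neg table Hs0 Ht0 Hs Ht Hneg 0 (Z.le_refl 0)
  ltac:(rewrite HL; discriminate) table_ok H).
assert (Q := RInt_below _ _ table (fun a b => Edec_ex_RInt _ _ a b (Edec_opp _ _ HE)) 0%Z B).
rewrite HL in Q; change (IZR (0 + Z.of_nat 40)) with 40 in Q.
replace (- (40 / 32)) with (- (5 / 4)) in Q by field.
replace (- (0 / 32)) with 0 in Q by field.
generalize (check_total_spec _ _ _ Hc); lra.
Qed.

Lemma RInt_first_box (sigma t : R) (s t0 t1 : Z) : In s sigma_grid -> In (t0, t1) t_grid ->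
  IZR s <= sigma <= IZR (s + 1) -> IZR t0 <= t <= IZR t1 ->
  - (73 / 100) <= RInt (fun u => - Gline rot (sigma + Ci * t) (INR 1 + 1 / 2) u) (- (5 / 4)) 0.
Proof.
intros Is It Hs Ht.
assert (Ps : (0 <= s)%Z) by (simpl in Is; lia).
assert (Pt : (0 <= t0)%Z) by (simpl in It; destruct It as [E|[E|[E|[]]]]; injection E; lia).
destruct (checks_spec _ checks_table) as [_ [_ [H _]]]; specialize (H s t0 t1 Is It).
apply (RInt_first_middle sigma t s t0 73 _ Ps Pt (proj1 Hs) (proj1 Ht)) with (2 := H).
intros w0 w1 w c Hok Hw Hg; apply (neg_phase_correct w0 w1); assumption.
Qed.

Lemma RInt_first_any (sigma t : R) (s0 t0 num : Z) : (0 <= s0)%Z -> (0 <= t0)%Z ->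
  IZR s0 <= sigma -> IZR t0 <= t -> check_total (cell_val s0 t0 neg_any) num table = true ->
  - (IZR num / 100) <= RInt (fun u => - Gline rot (sigma + Ci * t) (INR 1 + 1 / 2) u) (- (5 / 4)) 0.
Proof.
intros Hs0 Ht0 Hs Ht H.
apply (RInt_first_middle sigma t s0 t0 num _ Hs0 Ht0 Hs Ht) with (2 := H).
intros w0 w1 w c Hok Hw _; apply (neg_any_correct w0 w1); assumption.
Qed.

Lemma RInt_first_73 (sigma t : R) : 3 <= sigma -> 1 <= t <= 6 ->
  - (73 / 100) <= RInt (fun u => - Gline rot (sigma + Ci * t) (INR 1 + 1 / 2) u) (- (5 / 4)) 0.
Proof.
intros Hs Ht; destruct (Rle_lt_dec 13 sigma) as [H13|H13].
- destruct (checks_spec _ checks_table) as [_ [_ [_ [H _]]]].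
  apply (RInt_first_any sigma t 13 1 73); try lia; try lra; exact H.
- destruct (archimed sigma) as [A1 A2].
  set (s := (up sigma - 1)%Z).
  assert (Es : IZR (s + 1) = IZR s + 1) by apply plus_IZR.
  assert (Eu : IZR (up sigma) = IZR s + 1) by (unfold s; rewrite minus_IZR; ring).
  assert (Is : In s sigma_grid).
  { assert (L1 : (3 < s + 1)%Z) by (apply lt_IZR; lra).
    assert (L2 : (s < 13)%Z) by (apply lt_IZR; lra).
    simpl; lia. }
  destruct (Rle_lt_dec t 2) as [H2|H2]; [|destruct (Rle_lt_dec t 4) as [H4|H4]].
  + apply (RInt_first_box sigma t s 1 2); [exact Is | simpl; tauto | lra | lra].
  + apply (RInt_first_box sigma t s 2 4); [exact Is | simpl; tauto | lra | lra].
  + apply (RInt_first_box sigma t s 4 6); [exact Is | simpl; tauto | lra | lra].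
Qed.

Lemma RInt_first_53 (sigma t : R) : 3 <= sigma -> 6 <= t ->
  - (53 / 100) <= RInt (fun u => - Gline rot (sigma + Ci * t) (INR 1 + 1 / 2) u) (- (5 / 4)) 0.
Proof.
intros Hs Ht.
destruct (checks_spec _ checks_table) as [_ [_ [_ [_ [H _]]]]].
apply (RInt_first_any sigma t 3 6 53); try lia; try lra; exact H.
Qed.

Lemma RInt_first_28 (sigma t : R) : 3 <= sigma -> 10 <= t ->
  - (28 / 100) <= RInt (fun u => - Gline rot (sigma + Ci * t) (INR 1 + 1 / 2) u) (- (5 / 4)) 0.
Proof.
intros Hs Ht.
destruct (checks_spec _ checks_table) as [_ [_ [_ [_ [_ H]]]]].
apply (RInt_first_any sigma t 3 10 28); try lia; try lra; exact H.
Qed.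

(** * Tails on the line through 3 / 2, and conclusion *)

Lemma Gline_first_right (sigma t E k u : R) : 3 <= sigma -> 0 <= u ->
  t * Carg (slope1_line (INR 1 + 1 / 2) u) - 4 * PI * u - 2 * PI * u ^ 2 <= E - k * u ->
  Rabs (Gline rot (sigma + Ci * t) (INR 1 + 1 / 2) u) <= 14 / 25 * exp E * exp (- k * (u - 0)).
Proof.
intros Hs Hu H.
(* 14 / 25 is exactly 189 / 100 times 8 / 27. *)
assert (X : exp (- 3 * ln (3 / 2)) = 8 / 27) by (rewrite exp_ln_pow3 by lra; field).
eapply Rle_trans; [apply (Gline_half_le rot sigma t 1 u Cmod_rot)|].
replace (14 / 25 * exp E * exp (- k * (u - 0))) with (189 / 100 * exp (- 3 * ln (3 / 2)) * exp (E - k * u)).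
- apply exp_bound_of; [lra|].
  assert (L := ln_line_weight_right sigma (INR 1 + 1 / 2) u Hs ltac:(simpl; lra) Hu).
  rewrite (Rabs_pos_eq u Hu); change (INR 1) with 1 in *.
  replace (1 + 1 / 2) with (3 / 2) in * by field; lra.
- rewrite X; unfold Rminus; rewrite exp_plus; replace (- k * (u + - 0)) with (- (k * u)) by ring; field.
Qed.

(** With u = - 5 / 4 - y, the Gaussian and the denominator give the exponent - 5 PI / 8 - 3 PI y - 2
    PI y^2: hence exp (- 3 / 2) and the rate 9. The modulus is at least 1 and the argument is not
    positive. *)
Lemma Gline_first_left (sigma t u : R) : 3 <= sigma -> 0 <= t -> u <= - (5 / 4) ->
  Rabs (Gline rot (sigma + Ci * t) (INR 1 + 1 / 2) u) <= 48 / 100 * exp (- 9 * (- (5 / 4) - u)).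
Proof.
intros Hs Ht Hu; assert (HP := PI_bounds).
eapply Rle_trans; [apply (Gline_half_le rot sigma t 1 u Cmod_rot)|].
assert (E : exp (- (3 / 2)) <= 1 / 4).
{ rewrite exp_Ropp; replace (1 / 4) with (/ 4) by field; apply Rinv_le_contravar; [lra | apply exp_3_2_ge]. }
apply Rle_trans with (189 / 100 * exp (- (3 / 2)) * exp (- 9 * (- (5 / 4) - u))).
- apply exp_bound_of; [lra|].
  assert (L := ln_Cmod_line_ge (INR 1 + 1 / 2) u 1 Rlt_0_1 ltac:(simpl; lra)); rewrite ln_1 in L.
  assert (A := Carg_neg (INR 1 + 1 / 2) (- u) ltac:(simpl; lra) ltac:(lra)); rewrite Ropp_involutive in A.
  rewrite (Rabs_left u) by lra; change (INR 1) with 1 in *.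
  set (y := - (5 / 4) - u).
  assert (Hy : 0 <= y) by (unfold y; lra).
  replace u with (- (5 / 4) - y) at 3 4 5 by (unfold y; ring).
  assert (0 <= sigma * ln (Cmod (slope1_line (1 + 1 / 2) u))) by (apply Rmult_le_pos; lra).
  assert (t * Carg (slope1_line (1 + 1 / 2) u) <= 0) by nra.
  assert (0 <= (PI - 3) * y) by (apply Rmult_le_pos; lra).
  assert (0 <= PI * y ^ 2) by (apply Rmult_le_pos; [lra | apply pow2_ge_0]).
  lra.
- apply Rmult_le_compat_r; [left; apply exp_pos | lra].
Qed.

Lemma Re_Raux_first_of (c sigma t M G k : R) : 0 < c < 1 -> 3 <= sigma -> 0 <= t -> 0 <= G -> 0 < k ->
  - M <= RInt (fun u => - Gline rot (sigma + Ci * t) (INR 1 + 1 / 2) u) (- (5 / 4)) 0 ->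
  (forall u, 0 <= u -> Rabs (Gline rot (sigma + Ci * t) (INR 1 + 1 / 2) u) <= G * exp (- k * (u - 0))) ->
  cos theta0 - M - G / k - 6 / 100 <= Re (rot * Raux c (sigma + Ci * t))%C.
Proof.
intros Hc Hs Ht HG Hk HM HR.
rewrite (Re_Raux_expand rot (sigma + Ci * t) c 1 Hc).
replace (zeta_partial rot (sigma + Ci * t) 1) with (cos theta0).
2:{ change (cos theta0 = 0 + Re (rot * Cpower (INR 1) (- (sigma + Ci * t)))%C).
    rewrite Cpower_1; simpl; ring. }
destruct (Edec_Gline rot (sigma + Ci * t) 1 (INR 1 + 1 / 2) ltac:(lra)) as [K HE].
assert (Q := II_lower K _ (- (5 / 4)) 0 G k (48 / 100) 9 (Edec_opp _ _ HE) Hk HG ltac:(lra) ltac:(lra)).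
assert (N : II (fun u => - Gline rot (sigma + Ci * t) (INR 1 + 1 / 2) u)
  = - Iline rot (sigma + Ci * t) (INR 1 + 1 / 2)).
{ rewrite (II_ext _ (fun u => (-1) * Gline rot (sigma + Ci * t) (INR 1 + 1 / 2) u
    + 0 * Gline rot (sigma + Ci * t) (INR 1 + 1 / 2) u)) by (intros; ring).
  rewrite (II_lin K K) by exact HE; unfold Iline; ring. }
rewrite N in Q.
(* 6 / 100 covers the left tail 48 / 100 / 9; - 5 / 4 is the end of the grid, 40 cells of width 1 /
   32. *)
enough (Q' : RInt (fun u => - Gline rot (sigma + Ci * t) (INR 1 + 1 / 2) u) (- (5 / 4)) 0 - G / k - 48 / 100 / 9
  <= - Iline rot (sigma + Ci * t) (INR 1 + 1 / 2)) by lra.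
apply Q; intros u Hu.
- specialize (HR u Hu); apply Rabs_le_between in HR; lra.
- assert (HL := Gline_first_left sigma t u Hs Ht Hu); change (-9) with (Ropp 9) in HL; apply Rabs_le_between in HL; lra.
Qed.

Lemma Re_Raux_first (c sigma t : R) : 0 < c < 1 -> 3 <= sigma -> 1 <= t <= 22 ->
  1 / 50 <= Re (rot * Raux c (sigma + Ci * t))%C.
Proof.
intros Hc Hs Ht; assert (HP := PI_precise); assert (HC := cos_theta0).
assert (D : INR 1 + 1 / 2 = 3 / 2) by (simpl; field).
assert (L : forall b k u, t <= b -> k <= 4 * PI - 2 / 3 * b -> 0 <= u ->
  t * Carg (slope1_line (INR 1 + 1 / 2) u) - 4 * PI * u - 2 * PI * u ^ 2 <= 0 - k * u).
{ intros b k u Hb Hk Hu.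
  assert (S := slope_right t (INR 1 + 1 / 2) u ltac:(lra) ltac:(simpl; lra) Hu).
  replace (t / (INR 1 + 1 / 2) * u) with (2 / 3 * (t * u)) in S by (rewrite D; field).
  assert (t * u <= b * u) by (apply Rmult_le_compat_r; assumption).
  assert (k * u <= (4 * PI - 2 / 3 * b) * u) by (apply Rmult_le_compat_r; assumption).
  assert (0 <= PI * u ^ 2) by (apply Rmult_le_pos; [lra | apply pow2_ge_0]).
  lra. }
destruct (Rle_lt_dec t 6) as [H6|H6]; [|destruct (Rle_lt_dec t 10) as [H10|H10]].
- assert (Q := Re_Raux_first_of c sigma t (73 / 100) (14 / 25 * exp 0) (17 / 2) Hc Hs ltac:(lra)
    ltac:(generalize (exp_pos 0); lra) ltac:(lra) (RInt_first_73 sigma t Hs ltac:(lra))).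
  enough (cos theta0 - 73 / 100 - 14 / 25 * exp 0 / (17 / 2) - 6 / 100 <= Re (rot * Raux c (sigma + Ci * t))%C) by (rewrite exp_0 in *; lra).
  apply Q; intros u Hu; apply Gline_first_right; [exact Hs | exact Hu |].
  apply (L 6); [exact H6 | lra | exact Hu].
- assert (Q := Re_Raux_first_of c sigma t (53 / 100) (14 / 25 * exp 0) (29 / 5) Hc Hs ltac:(lra)
    ltac:(generalize (exp_pos 0); lra) ltac:(lra) (RInt_first_53 sigma t Hs ltac:(lra))).
  enough (cos theta0 - 53 / 100 - 14 / 25 * exp 0 / (29 / 5) - 6 / 100 <= Re (rot * Raux c (sigma + Ci * t))%C) by (rewrite exp_0 in *; lra).
  apply Q; intros u Hu; apply Gline_first_right; [exact Hs | exact Hu |].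
  apply (L 10); [exact H10 | lra | exact Hu].
- assert (E : exp (3 / 10) <= 17 / 12).
  { eapply Rle_trans; [apply (exp_le_inv_pow 4); [lia | simpl; lra]|].
    replace (INR 4) with 4 by (simpl; lra). lra. }
  assert (Q := Re_Raux_first_of c sigma t (28 / 100) (14 / 25 * exp (3 / 10)) 2 Hc Hs ltac:(lra)
    ltac:(generalize (exp_pos (3 / 10)); lra) ltac:(lra) (RInt_first_28 sigma t Hs ltac:(lra))).
  enough (cos theta0 - 28 / 100 - 14 / 25 * exp (3 / 10) / 2 - 6 / 100 <= Re (rot * Raux c (sigma + Ci * t))%C) by lra.
  apply Q; intros u Hu; apply Gline_first_right; [exact Hs | exact Hu |].
  destruct (Carg_upper (INR 1 + 1 / 2) u ltac:(lra) Hu) as [_ [A0 A1]]; rewrite D in *.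
  (* Tangent to the concave [u / (3 / 2 + u)] at [u = 3 / 20]. *)
  assert (T : u / (3 / 2 + u) <= 1 / 121 + 200 / 363 * u).
  { apply Rmult_le_reg_r with (3 / 2 + u); [lra|].
    unfold Rdiv at 1; rewrite Rmult_assoc, Rinv_l, Rmult_1_r by lra.
    generalize (pow2_ge_0 (20 * u - 3)); lra. }
  assert (T1 : t * Carg (slope1_line (3 / 2) u) <= 22 * (1 / 121 + 200 / 363 * u)) by (apply Rmult_le_compat; lra).
  (* 22 times 200 / 363, minus 4 PI, is below - 11 / 25; the constants 22 / 121 and 1 / 10 add up to
     less than 3 / 10. *)
  assert (Q1 := parabola_envelope (- (11 / 25)) 2 u).
  assert (Q2 : (- (11 / 25) + 2) ^ 2 / (8 * PI) <= 1 / 10).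
  { apply Rmult_le_reg_r with (8 * PI); [lra|]; unfold Rdiv at 1; rewrite Rmult_assoc, Rinv_l, Rmult_1_r by lra; lra. }
  assert (12566 / 1000 * u <= 4 * PI * u) by (apply Rmult_le_compat_r; lra).
  lra.
Qed.

(** cos theta0 > 0.898 leaves at least 0.04 in each range of t: after the allowances on the line
    through 3 / 2, after 17 / 20 for N = 2 and after 4 / 5 for N >= 3. *)
Lemma Re_rot_Raux (c sigma t : R) : 0 < c < 1 -> 3 <= sigma -> 1 <= t ->
  1 / 50 <= Re (rot * Raux c (sigma + Ci * t))%C.
Proof.
intros Hc Hs Ht; assert (HC := cos_theta0).
destruct (Rle_lt_dec t 22) as [H1|H1]; [apply Re_Raux_first; [exact Hc | exact Hs | lra]|].
destruct (Rle_lt_dec t (18 * PI)) as [H2|H2].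
- assert (Q := Re_Raux_middle c rot sigma t Hc Cmod_rot Hs ltac:(lra)); simpl (Re rot) in Q; lra.
- assert (Q := Re_Raux_large c rot sigma t Hc Cmod_rot Hs ltac:(lra)); simpl (Re rot) in Q; lra.
Qed.

Theorem theorem3 :
  forall c : R, 0 < c < 1 ->
  forall sigma1 : R, 3 < sigma1 ->
  exists K : R,
    forall sigma : R, sigma1 <= sigma ->
    forall t0 T : R, 1 <= t0 -> t0 < T ->
      ex_RInt (fun t : R => ln (Cmod (Raux c (sigma + Ci * t)%C))) t0 T /\
      Rabs (RInt (fun t : R => ln (Cmod (Raux c (sigma + Ci * t)%C))) t0 T)
        <= K * Rpower 2 (- sigma).
Proof.
intros c Hc sigma1 Hs1; destruct (Raux_sub_1_small c Hc) as [K HK].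
exists (4 * K / (1 / 50) / ln 2); intros sigma Hs t0 T Ht0 HT.
apply (log_integral_bound c K (1 / 50) Hc ltac:(lra) HK); try lra.
intros x y Hx Hy; apply Re_rot_Raux; assumption.
Qed.
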